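(* Consider the resource sharing problem $$\min_{\xi}\ \varphi(\xi)=\sum_{i\in\mathcal N}\varphi_i(\xi_i)\quad\text{s.t.}\quad g(\xi)=\sum_{i\in\mathcal N}g_i(\xi_i)\in-\mathcal K ,\qquad (\mathrm P)$$ and suppose that the assumptions on $(\rho_i,f_i,g_i)$, on communication, on existence of a primal-dual solution with zero duality gap, and on the approximate averaging operators $\mathcal R^k$, all listed in the context, hold. For any $\gamma>0$, let the primal-dual step-sizes $\{\tau_i,\kappa_i\}_{i\in\mathcal N}$ be chosen such that, for some $\beta>0$, $$\tau_i=\big(\max\{1,L_{f_i}+\beta L_{g_i}\}+C_{g_i}\big)^{-1},\qquad \kappa_i=\big(C_{g_i}+\tfrac{5\gamma}{2}\big)^{-1},\qquad \forall\, i\in\mathcal N .$$ Given $B\in(0,\infty]$, starting from $v^0=\mathbf y^0=\mathbf 0$ and an arbitrary $\xi^0$, let $\{(\xi^k,v^k)\}_{k\ge0}$ be the primal, and $\{\mathbf y^k\}_{k\ge 0}$ the dual iterate sequence generated by Algorithm DPDA-D (see context), using $q_k\in\mathbb Z_+$ communication rounds for the $k$-th iteration such that $C_0:=\sum_{k=0}^\infty\alpha^{q_k}(k+1)<\infty$. For any $\gamma>0$, if $\beta>0$ is chosen as discussed in CASE 1 and CASE 2 below, then $\{(\xi^k,\mathbf y^k)\}_{k\ge0}$ converges to $(\xi^*,\mathbf y^* )$ such that $\mathbf y^*=\mathbf 1\otimes y^*$ and $(\xi^*,y^* )$ is an optimal primal-dual solution to (P). Moreover, both the infeasibility $F(\bar\xi^K,\bar{\mathbf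 y}^K)$ and the suboptimality $|\varphi(\bar\xi^K)-\varphi(\xi^* )|$ are $O(1/K)$, i.e., for all $K\ge1$, $$F(\bar\xi^K,\bar{\mathbf y}^K):=d_{\mathcal C}(\bar{\mathbf y}^K)+\|y^*\|\,d_{\mathcal K}\big(-g(\bar\xi^K)\big)\le\frac{\Lambda(\gamma,\beta)}{K},\qquad(\mathrm a)$$ $$0\le\varphi(\bar\xi^K)-\varphi(\xi^* )+\|y^*\|\,d_{\mathcal K}\big(-g(\bar\xi^K)\big)\le\frac{\Lambda(\gamma,\beta)}{K}-F(\bar\xi^K,\bar{\mathbf y}^K),\qquad(\mathrm b)$$ for some $\Lambda(\gamma,\beta)\in\mathbb R_+$, where $\bar\xi^K=\frac1K\sum_{k=1}^K\xi^k$ and $\bar{\mathbf y}^K=\frac1K\sum_{k=1}^K\mathbf y^k$ for $K\ge1$. CASE 1. If a dual bound is known, i.e., $B<\infty$, then (a) and (b) hold for $\beta=2B$; moreover, setting the free parameter $\gamma=(N^{3/2}\Gamma C_0B)^{-1}$ gives $$\Lambda(\gamma,\beta)=O\big(NB(\bar R_x^2+\bar C_gB)+N^{3/2}\Gamma C_0B\big).$$ CASE 2. If the dual bound does not exist, set $B=\infty$ within DPDA-D. Assuming $q_k\ge\log_{1/\alpha}(24N\Gamma(k+1))$ for $k\ge0$, there exists $\bar\beta>0$ such that (a) and (b) hold for all $\beta\ge\bar\beta$; moreover, selecting $\gamma=N^{3/2}\Gamma C_0\bar R_x^2$ gives $\Lambda(\gamma,\beta)=O\big(N^{9/2}\Gamma^3C_0^3\bar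 R_x^2\max\{1,\|y^*\|^2\}\big)$. Finally, when $g_i$ is affine for $i\in\mathcal N$ and $\{\tau_i\}$ are independent of $\beta$, $\gamma=(N^{3/2}\Gamma C_0)^{-1}$ leads to $\Lambda(\gamma,\beta)=O\big(N^3\Gamma^2C_0^2(\bar R_x^2+\bar C_g\max\{1,\|y^*\|^2\})\big)$.
   Context: **Problem data.** $\mathcal N=\{1,\dots,N\}$ is a set of nodes, $\xi=[\xi_i]_{i\in\mathcal N}$ with $\xi_i\in\mathbb R^{n_i}$, $n=\sum_i n_i$, $n_0=mN$; $\|\cdot\|$ is the Euclidean (or spectral) norm and $\|z\|_Q=(z^\top Qz)^{1/2}$. $\mathcal K\subseteq\mathbb R^m$ is a closed convex cone, $\mathcal K^*$ its dual cone, $\mathcal K^\circ=-\mathcal K^*$ its polar cone. $d_S$ and $\mathcal P_S$ denote Euclidean distance to and projection onto a closed convex set $S$. $\mathbf 1$ is the all-ones vector in $\mathbb R^N$ and $\otimes$ the Kronecker product. For each $i$: $\varphi_i=\rho_i+f_i$, where $\rho_i:\mathbb R^{n_i}\to\mathbb R\cup\{+\infty\}$ is proper, closed, convex with efficiently computable prox map, $\mathbf{prox}_{\rho}(\xi)=\arg\min_x\{\rho(x)+\frac12\|x-\xi\|^2\}$; $f_i:\mathbb R^{n_i}\to\mathbb R$ is a smooth convex function, differentiable on an open set containing $\mathrm{dom}\,\rho_i$, with $\nabla f_i$ Lipschitz with constant $L_{f_i}$; $g_i:\mathbb R^{n_i}\to\mathbb R^m$ is $\mathcal K$-convex, Lipschitz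 continuous with constant $C_{g_i}$, and its Jacobian $\mathbf Jg_i$ is Lipschitz with constant $L_{g_i}$. **Duality.** The Lagrangian of (P) is $\varphi(\xi)-\langle g(\xi),y\rangle$ with dual variable $y\in\mathcal K^\circ$. It is assumed that a primal-dual solution to (P) exists and the duality gap is $0$. $B\in(0,\infty]$ is a given (possibly trivial, $B=\infty$) bound such that $\|y^*\|\le B$ for a dual optimal solution $y^*$. **Consensus sets.** For $\mathbf y=[y_i]_{i\in\mathcal N}\in\mathbb R^{n_0}$, $y_i\in\mathbb R^m$: $\mathcal C=\{\mathbf y:\ \exists\bar y\in\mathbb R^m,\ y_i=\bar y\ \forall i\}$. $\mathcal B_0=\{y\in\mathbb R^m:\|y\|\le2B\}$ ($=\mathbb R^m$ if $B=\infty$), $\mathcal B=\prod_{i\in\mathcal N}\mathcal B_0$, $\tilde{\mathcal C}=\mathcal C\cap\mathcal B$. **Communication and approximate averaging.** Nodes communicate over a time-varying (directed or undirected) graph $\mathcal G^t=(\mathcal N,\mathcal E^t)$; at time $t$ node $i$ can receive data from $j$ only if $(j,i)\in\mathcal E^t$ and can send data to $j$ only if $(i,j)\in\mathcal E^t$ (in the undirected case, both directions are available along each edge). There is a global clock known to all nodes; the local $\xi_i$- and $y_i$-updates can be completed between two ticks, and at every tick a communication round with instantaneous messaging between neighbors takes place. For each $k\ge0$ there is an operator $\mathcal R^k=[\mathcal R^k_i]_{i\in\mathcal N}$ on $\mathbb R^{n_0}$ such that $\mathcal R^k_i$ can be computed with local information available to node $i$ and decentralized computation of $\mathcal R^k$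 requires $q_k$ communication rounds; and there exist $\Gamma>0$, $\alpha\in(0,1)$ with $N\Gamma\ge1$ such that for all $k\ge 0$ and all $w\in\mathbb R^{n_0}$: $\mathcal R^k(w)\in\mathcal B$ and $\|\mathcal R^k(w)-\mathcal P_{\tilde{\mathcal C}}(w)\|\le N\Gamma\alpha^{q_k}\|w\|$. **Algorithm DPDA-D** (parameters $\xi^0,\gamma,\{\tau_i,\kappa_i\}$; $v_i^0=y_i^0=\mathbf 0$). Iteration $k\ge0$, for all $i\in\mathcal N$: 1. $v_i^c=\frac1\gamma v_i^k+y_i^k$, $\ v_i^{k+1}=\gamma v_i^c-\gamma\mathcal R_i^k(v^c)$, where $v^c=[v^c_i]_{i\in\mathcal N}$; 2. $\xi_i^{k+1}=\mathbf{prox}_{\tau_i\rho_i}\big(\xi_i^k-\tau_i(\nabla f_i(\xi_i^k)-\mathbf Jg_i(\xi_i^k)^\top y_i^k)\big)$; 3. $y_i^{k+1}=\mathcal P_{\mathcal K^\circ\cap\mathcal B_0}\big(y_i^k-\kappa_i(2g_i(\xi_i^{k+1})-g_i(\xi_i^k)+2v_i^{k+1}-v_i^k)\big)$. Here $\mathbf y^k=[y_i^k]_{i\in\mathcal N}$, $v^k=[v_i^k]_{i\in\mathcal N}$. **Constants.** $\bar C_g=\frac1N\sum_iC_{g_i}$; $\bar R_x=\max\{\|\xi^*-\xi^0\|_{\mathbf L_g},\|\xi^*-\xi^0\|_{\mathbf L'}\}/\sqrt N$ with $\mathbf L'=\mathrm{diag}([(1+L_{f_i}+C_{g_i})I_{n_i}]_i)$,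 $\mathbf L_g=\mathrm{diag}([L_{g_i}I_{n_i}]_i)$.
   Formalization: The O(.) constants are uniform only while B, C_0 (Case 1), C_0, R_x (Case 2), C_0, C_g mean (affine) stay at least some delta>0 and the distance of [g_i(xi*_i)] to C (and C_g mean in Case 2's first estimate) is at most M; that first estimate is at beta = betabar. *)

(* Defs.v *)
From HB Require Import structures.
From mathcomp Require Import all_boot all_order all_algebra.
From mathcomp Require Import all_classical all_reals all_analysis.

Set Implicit Arguments.
Unset Strict Implicit.
Unset Printing Implicit Defensive.

Import Order.TTheory GRing.Theory Num.Theory.
Import numFieldNormedType.Exports.

Local Open Scope classical_set_scope.
Local Open Scope ring_scope.

(* Vectors are row vectors. The norm that the library puts on matrices is the
   max norm, which is used here only through the topology it induces; every
   metric notion below is Euclidean and is stated with [enorm]. *)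
Section Euclid.
Variable R : realType.

Definition dotp n (u v : 'rV[R]_n) : R := \sum_j u 0 j * v 0 j.

(* A stacked vector [y_i]_{i < N}, y_i in R^m, is the N x m matrix whose i-th
   row is y_i: its Euclidean norm is the one of the mN entries. *)
Definition enorm p q (A : 'M[R]_(p, q)) : R :=
  Num.sqrt (\sum_i \sum_j A i j ^+ 2).

Definition spectral_norm p q (A : 'M[R]_(p, q)) : R :=
  sup [set enorm (x *m A) | x in [set x : 'rV[R]_p | enorm x <= 1]].

Definition eucl_dist p q (S : set 'M[R]_(p, q)) (x : 'M[R]_(p, q)) : R :=
  inf [set enorm (x - s) | s in S].

Definition is_proj p q (S : set 'M[R]_(p, q)) (x z : 'M[R]_(p, q)) : Prop :=
  S z /\ forall s, S s -> enorm (x - z) <= enorm (x - s).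

Definition convex_cone n (K : set 'rV[R]_n) : Prop :=
  [/\ K 0, (forall x y, K x -> K y -> K (x + y)) &
      (forall (t : R) x, 0 <= t -> K x -> K (t *: x))].

Definition dual_cone n (K : set 'rV[R]_n) : set 'rV[R]_n :=
  [set y | forall x, K x -> 0 <= dotp y x].

Definition polar_cone n (K : set 'rV[R]_n) : set 'rV[R]_n :=
  [set y | dual_cone K (- y)].

Definition edom n (rho : 'rV[R]_n -> \bar R) : set 'rV[R]_n :=
  [set x | (rho x < +oo)%E].

Definition proper_fun n (rho : 'rV[R]_n -> \bar R) : Prop :=
  (forall x, (-oo < rho x)%E) /\ edom rho !=set0.

Definition closed_fun n (rho : 'rV[R]_n -> \bar R) : Prop :=
  closed [set z : 'rV[R]_n * R | (rho z.1 <= z.2%:E)%E].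

Definition convex_efun n (rho : 'rV[R]_n -> \bar R) : Prop :=
  forall (x y : 'rV[R]_n) (t : R), 0 <= t -> t <= 1 ->
    (rho (t *: x + (1 - t) *: y)%R <= t%:E * rho x + (1 - t)%:E * rho y)%E.

Definition convex_fun n (f : 'rV[R]_n -> R) : Prop :=
  forall (x y : 'rV[R]_n) (t : R), 0 <= t -> t <= 1 ->
    f (t *: x + (1 - t) *: y) <= t * f x + (1 - t) * f y.

Definition cone_convex n m (K : set 'rV[R]_m) (g : 'rV[R]_n -> 'rV[R]_m) : Prop :=
  forall (x y : 'rV[R]_n) (t : R), 0 <= t -> t <= 1 ->
    K (t *: g x + (1 - t) *: g y - g (t *: x + (1 - t) *: y)).

Definition affine_map n m (g : 'rV[R]_n -> 'rV[R]_m) : Prop :=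
  exists (A : 'M[R]_(n, m)) (b : 'rV[R]_m), forall x, g x = x *m A + b.

Definition gradient n (f : 'rV[R]_n -> R) (x : 'rV[R]_n) : 'rV[R]_n :=
  \row_j ('d (f : 'rV[R]_n -> R^o) x) (delta_mx 0 j).

(* z = prox_{t rho}(x), for t > 0 *)
Definition is_prox n (t : R) (rho : 'rV[R]_n -> \bar R) (x z : 'rV[R]_n) : Prop :=
  forall u : 'rV[R]_n,
    (t%:E * rho z + (2^-1 * enorm (z - x) ^+ 2)%:E <=
     t%:E * rho u + (2^-1 * enorm (u - x) ^+ 2)%:E)%E.

(* the mean of the terms of index 1, ..., K *)
Definition ergodic (V : lmodType R) (u : nat -> V) (K : nat) : V :=
  K%:R^-1 *: \sum_(1 <= k < K.+1) u k.

Definition consensus N m : set 'M[R]_(N, m) :=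
  [set y | exists ybar : 'rV[R]_m, forall i, row i y = ybar].

(* 1 (x) y *)
Definition replicate N m (y : 'rV[R]_m) : 'M[R]_(N, m) := \matrix_(i, j) y 0 j.

(* B_0; all of R^m when B = +oo *)
Definition dual_ball m (B : \bar R) : set 'rV[R]_m :=
  [set y | ((enorm y)%:E <= 2%:E * B)%E].

Definition dual_box N m (B : \bar R) : set 'M[R]_(N, m) :=
  [set y | forall i, dual_ball B (row i y)].

Definition bounded_consensus N m (B : \bar R) : set 'M[R]_(N, m) :=
  @consensus N m `&` dual_box B.

End Euclid.

(* (j, i) is an edge at round t when [E t j i]. [reaches E s q j i] holds when
   data held by j before round s can be at i after the q rounds s, ..., s+q-1. *)
Fixpoint reaches N (E : nat -> rel 'I_N) (s q : nat) (j i : 'I_N) : bool :=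
  if q is q'.+1 then
    reaches E s q' j i || [exists l, reaches E s q' j l && E (s + q')%N l i]
  else j == i.

Record problem (R : realType) := Problem {
  nodes : nat;
  cdim : nat;
  dim : 'I_nodes -> nat;
  cone : set 'rV[R]_cdim;
  rho : forall i, 'rV[R]_(dim i) -> \bar R;
  fsm : forall i, 'rV[R]_(dim i) -> R;
  (* the open set containing dom rho_i on which f_i is differentiable *)
  fdom : forall i, set 'rV[R]_(dim i);
  gcon : forall i, 'rV[R]_(dim i) -> 'rV[R]_cdim;
  Lf : 'I_nodes -> R;
  Cg : 'I_nodes -> R;
  Lg : 'I_nodes -> R }.

Arguments cone {R} p _.
Arguments rho {R} p i _.
Arguments fsm {R} p i _.
Arguments fdom {R} p i _.
Arguments gcon {R} p i _.
Arguments Lf {R} p _.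
Arguments Cg {R} p _.
Arguments Lg {R} p _.

Section Problem.
Variables (R : realType) (P : problem R).
Local Notation N := (nodes P).
Local Notation m := (cdim P).

Definition primal := forall i : 'I_N, 'rV[R]_(dim i).

Definition smooth_part_ok (i : 'I_N) : Prop :=
  [/\ 0 <= Lf P i, convex_fun (fsm P i),
      open (fdom P i) /\ edom (rho P i) `<=` fdom P i,
      (forall x, fdom P i x ->
         differentiable (fsm P i : 'rV[R]_(dim i) -> R^o) x) &
      (forall x y, fdom P i x -> fdom P i y ->
         enorm (gradient (fsm P i) x - gradient (fsm P i) y) <=
         Lf P i * enorm (x - y))].

Definition constraint_ok (i : 'I_N) : Prop :=
  [/\ 0 <= Cg P i /\ 0 <= Lg P i, cone_convex (cone P) (gcon P i),
      (forall x y, enorm (gcon P i x - gcon P i y) <= Cg P i * enorm (x - y)),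
      (forall x, differentiable (gcon P i) x) &
      (forall x y, spectral_norm ('J (gcon P i) x - 'J (gcon P i) y) <=
                   Lg P i * enorm (x - y))].

Definition problem_ok : Prop :=
  [/\ closed (cone P) /\ convex_cone (cone P),
      (forall i, [/\ proper_fun (rho P i), closed_fun (rho P i) &
                     convex_efun (rho P i)]),
      (forall i, smooth_part_ok i) &
      (forall i, constraint_ok i)].

Definition objective (xi : primal) : \bar R :=
  (\sum_(i < N) (rho P i (xi i) + (fsm P i (xi i))%:E))%E.

Definition gsum (xi : primal) : 'rV[R]_m := \sum_(i < N) gcon P i (xi i).

Definition gstack (xi : primal) : 'M[R]_(N, m) :=
  \matrix_(i, j) gcon P i (xi i) 0 j.

Definition feasible (xi : primal) : Prop := cone P (- gsum xi).

Definition primal_value : \bar R :=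
  ereal_inf [set objective xi | xi in feasible].

Definition dual_function (y : 'rV[R]_m) : \bar R :=
  ereal_inf [set (objective xi - (dotp (gsum xi) y)%:E)%E | xi in setT].

Definition dual_value : \bar R :=
  ereal_sup [set dual_function y | y in polar_cone (cone P)].

Definition primal_optimal (xs : primal) : Prop :=
  feasible xs /\ objective xs = primal_value.

Definition dual_optimal (ys : 'rV[R]_m) : Prop :=
  polar_cone (cone P) ys /\ dual_function ys = dual_value.

Definition optimal_pair (xs : primal) (ys : 'rV[R]_m) : Prop :=
  primal_optimal xs /\ dual_optimal ys.

Definition Cg_mean : R := N%:R^-1 * \sum_(i < N) Cg P i.

(* the norm weighted by diag([d_i I_{n_i}]_i) *)
Definition wnorm (d : 'I_N -> R) (z : primal) : R :=
  Num.sqrt (\sum_(i < N) d i * dotp (z i) (z i)).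

Definition Rx (xi0 xs : primal) : R :=
  let z : primal := fun i => xs i - xi0 i in
  Num.max (wnorm (Lg P) z) (wnorm (fun i => 1 + Lf P i + Cg P i) z)
  / Num.sqrt N%:R.

Definition tau (beta : R) (i : 'I_N) : R :=
  (Num.max 1 (Lf P i + beta * Lg P i) + Cg P i)^-1.

Definition kappa (gamma : R) (i : 'I_N) : R := (Cg P i + 5 * gamma / 2)^-1.

End Problem.

Record instance (R : realType) := Instance {
  prob :> problem R;
  bnd : \bar R;
  edges : nat -> rel 'I_(nodes prob);
  averager : nat -> 'M[R]_(nodes prob, cdim prob) -> 'M[R]_(nodes prob, cdim prob);
  rounds : nat -> nat;
  Gam : R;
  alpha : R;
  start : primal prob }.

Arguments edges {R} i _ _ _.
Arguments averager {R} i _ _.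
Arguments rounds {R} i _.
Arguments start {R} i _.

Section Instance.
Variables (R : realType) (I : instance R).
Local Notation N := (nodes I).
Local Notation m := (cdim I).

(* Iteration k occupies the q_k communication rounds that follow the
   q_0 + ... + q_{k-1} rounds of the previous iterations. *)
Definition averager_ok : Prop :=
  [/\ 0 < Gam I, 0 < alpha I < 1, 1 <= N%:R * Gam I,
      (forall k i w w',
         (forall j, reaches (edges I) (\sum_(l < k) rounds I l) (rounds I k) j i ->
            row j w = row j w') ->
         row i (averager I k w) = row i (averager I k w')) &
      (forall k w, dual_box (bnd I) (averager I k w) /\
         forall p, is_proj (bounded_consensus (bnd I)) w p ->
           enorm (averager I k w - p) <=
           N%:R * Gam I * alpha I ^+ rounds I k * enorm w)].

Definition C0_terms : nat -> R := fun k => alpha I ^+ rounds I k * k.+1%:R.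
Definition C0 : R := limn (series C0_terms).

(* start_i must lie where the gradient of f_i, used by the first step, exists. *)
Definition admissible : Prop :=
  [/\ problem_ok I,
      (forall i, fdom I i (start I i)),
      (exists xs ys, @optimal_pair _ I xs ys) /\ primal_value I = dual_value I,
      (0 < bnd I)%E /\
        (exists2 ys, @dual_optimal _ I ys & ((enorm ys)%:E <= bnd I)%E) &
      averager_ok /\ cvgn (series C0_terms)].

(* 'J g x is the transpose of the usual Jacobian: d(g)_x(h) = h *m 'J g x. *)
Definition dpda (gamma beta : R) (xi : nat -> primal I)
    (v y : nat -> 'M[R]_(N, m)) : Prop :=
  [/\ xi 0%N = start I, v 0%N = 0, y 0%N = 0 &
    forall k, let vc := gamma^-1 *: v k + y k in
    [/\ v k.+1 = gamma *: vc - gamma *: averager I k vc,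
        (forall i, is_prox (tau beta i) (rho I i)
           (xi k i - tau beta i *:
              (gradient (fsm I i) (xi k i)
               - row i (y k) *m ('J (gcon I i) (xi k i))^T))
           (xi k.+1 i)) &
        (forall i, is_proj (polar_cone (cone I) `&` dual_ball (bnd I))
           (row i (y k) - kappa gamma i *:
              (2 *: gcon I i (xi k.+1 i) - gcon I i (xi k i)
               + 2 *: row i (v k.+1) - row i (v k)))
           (row i (y k.+1)))]].

Definition infeasibility (ys : 'rV[R]_m) (xi : primal I) (y : 'M[R]_(N, m)) : R :=
  eucl_dist (@consensus R N m) y + enorm ys * eucl_dist (cone I) (- gsum xi).

Definition iterates_converge (xi : nat -> primal I)
    (y : nat -> 'M[R]_(N, m)) : Prop :=
  exists xs ys,
    [/\ optimal_pair xs ys,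
        (forall i, (fun k => xi k i) @ \oo --> xs i) &
        y @ \oo --> replicate N ys].

(* Stated in \bar R, so that finiteness of the objective at the averaged iterate
   is part of the claim; the last bound is a consequence of the others. *)
Definition rate_bounds (xs : primal I) (ys : 'rV[R]_m) (xi : nat -> primal I)
    (y : nat -> 'M[R]_(N, m)) (L : R) : Prop :=
  0 <= L /\ forall K : nat, (1 <= K)%N ->
    let xib : primal I := fun i => ergodic (fun k => xi k i) K in
    let F := infeasibility ys xib (ergodic y K) in
    let gap := (objective xib - objective xs)%E in
    let viol := enorm ys * eucl_dist (cone I) (- gsum xib) in
    [/\ F <= L / K%:R,
        (0 <= gap + viol%:E)%E,
        (gap + viol%:E <= (L / K%:R - F)%:E)%E &
        (`|gap| <= (L / K%:R)%:E)%E].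

Definition guarantees (Lam : primal I -> 'rV[R]_m -> R -> R -> R)
    (gamma beta : R) : Prop :=
  forall xi v y, dpda gamma beta xi v y ->
    iterates_converge xi y /\
    forall xs ys, optimal_pair xs ys ->
      rate_bounds xs ys xi y (Lam xs ys gamma beta).

Definition enough_rounds : Prop :=
  forall k : nat,
    ln (24 * N%:R * Gam I * k.+1%:R) / ln (alpha I)^-1 <= (rounds I k)%:R.

Definition affine_case : Prop :=
  (forall i, affine_map (gcon I i)) /\
  (forall (i : 'I_N) (beta beta' : R), 0 < beta -> 0 < beta' ->
     tau beta i = tau beta' i).

(* Norm of the component of [g_i(xs_i)]_i orthogonal to the consensus space, i.e.
   of the optimal multiplier of the constraint y_1 = ... = y_N. The constants
   hidden in the O(.) estimates depend on it: with the other data fixed, the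
   number of iterations needed for v^k to reach this size, hence any valid
   Lambda, is unbounded. *)
Definition consensus_multiplier (xs : primal I) : R :=
  eucl_dist (@consensus R N m) (gstack xs).

End Instance.

(* Main.v *)
Require Import Defs.
From HB Require Import structures.
From mathcomp Require Import all_boot all_order all_algebra.
From mathcomp Require Import all_classical all_reals all_analysis.
From mathcomp Require Import ring lra.
Import Order.TTheory GRing.Theory Num.Theory.
Import numFieldNormedType.Exports.
Import Defs.
Set Implicit Arguments.
Unset Strict Implicit.
Unset Printing Implicit Defensive.
Local Open Scope classical_set_scope.
Local Open Scope ring_scope.

(* DPDA-D is an inexact primal-dual iteration on the saddle function of
   sum_i (phi_i - <g_i, y_i>) + <v, y>, where v is the multiplier of the consensus
   constraint y_1 = ... = y_N. One iteration decreases a weighted squared distance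
   to any comparison point (lyap) by the duality gap at the new iterate, up to an
   averaging error that is eps_k = N Gam alpha^(q_k) times the norms of the
   iterates. If the dual iterates are bounded, these norms grow at most linearly
   in k. Otherwise a discrete Gronwall argument with factors 1 + 17 eps_k bounds
   them by induction, and this bound in turn keeps |y_i| below the beta for which
   the step-sizes tau_i are small enough. In both cases the errors are summable
   because sum_k (k + 1) eps_k = N Gam C0. Summing over k and choosing as
   comparison points the multipliers aligned with the two residuals of the
   averaged iterate gives the O(1/K) bounds. The step-sizes leave no slack in the
   primal increments, so convergence is obtained along a subsequence on which
   these increments vanish: its cluster point is a saddle point, and the Lyapunov
   function centred there tends to 0 along the whole sequence. *)

(** * Euclidean inner product of matrices *)

Section InnerProduct.
Variable R : realType.

(** The step-sizes are an exact budget. Half of [(tau beta i)^-1] pays for the curvature of the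
    smooth part ([Lf]), for that of [- <g_i, y_i>] (at most [beta * Lg] while [|y_i| <= beta]) and
    for the primal share of the coupling of [g] with [y] ([Cg]). Half of [(kappa gamma i)^-1] pays
    for the dual share of that coupling and, through the term in [gamma], for the coupling of [v]
    with [y]. A surplus remains only on the increments of [y] and [v]. Without a dual bound the
    argument looks circular, since [beta] must exceed iterates that depend on [beta]. The circle
    breaks because the initial Lyapunov value grows linearly in [beta], while the size of the dual
    iterates is controlled by its square root. Dual optima need not be unique: the bound [B]
    concerns one of them, whereas the rates are claimed at all. Hence the iterates are controlled
    around one saddle point, and the other comparison points are reached from there at a cost that
    does not depend on the iteration. *)

Definition mdot p q (A B : 'M[R]_(p, q)) : R := \sum_i \sum_j A i j * B i j.

Section Fixed.
Variables p q : nat.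
Implicit Types (A B C : 'M[R]_(p, q)) (a : R).

Lemma mdotC A B : mdot A B = mdot B A.
Proof. by apply: eq_bigr => i _; apply: eq_bigr => j _; rewrite mulrC. Qed.

Lemma mdotDl A B C : mdot (A + B) C = mdot A C + mdot B C.
Proof.
rewrite /mdot -big_split; apply: eq_bigr => i _; rewrite -big_split.
by apply: eq_bigr => j _; rewrite mxE mulrDl.
Qed.

Lemma mdotZl a A B : mdot (a *: A) B = a * mdot A B.
Proof.
rewrite /mdot mulr_sumr; apply: eq_bigr => i _; rewrite mulr_sumr.
by apply: eq_bigr => j _; rewrite mxE mulrA.
Qed.

Lemma mdotDr A B C : mdot A (B + C) = mdot A B + mdot A C.
Proof. by rewrite mdotC mdotDl !(mdotC A). Qed.

Lemma mdotZr a A B : mdot A (a *: B) = a * mdot A B.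
Proof. by rewrite mdotC mdotZl (mdotC A). Qed.

Lemma mdotNl A B : mdot (- A) B = - mdot A B.
Proof. by rewrite -scaleN1r mdotZl mulN1r. Qed.

Lemma mdotNr A B : mdot A (- B) = - mdot A B.
Proof. by rewrite -scaleN1r mdotZr mulN1r. Qed.

Lemma mdot0l A : mdot 0 A = 0.
Proof. by rewrite -(scale0r 0) mdotZl mul0r. Qed.

Lemma mdot0r A : mdot A 0 = 0.
Proof. by rewrite mdotC mdot0l. Qed.

Lemma mdotBl A B C : mdot (A - B) C = mdot A C - mdot B C.
Proof. by rewrite mdotDl mdotNl. Qed.

Lemma mdotBr A B C : mdot A (B - C) = mdot A B - mdot A C.
Proof. by rewrite mdotDr mdotNr. Qed.

Definition mdotDE := (mdotDl, mdotDr, mdotNl, mdotNr).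
Definition mdotE := (mdotDl, mdotDr, mdotNl, mdotNr, mdotZl, mdotZr, mdot0l, mdot0r).

Lemma mdot_suml (I : Type) (s : seq I) (F : I -> 'M[R]_(p, q)) A :
  mdot (\sum_(i <- s) F i) A = \sum_(i <- s) mdot (F i) A.
Proof.
by elim: s => [|i s IH]; rewrite ?big_nil ?mdot0l // !big_cons mdotDl IH.
Qed.

Lemma mdot_ge0 A : 0 <= mdot A A.
Proof. by do 2! apply: sumr_ge0 => ? _; rewrite -expr2 sqr_ge0. Qed.

Lemma enormE A : enorm A = Num.sqrt (mdot A A).
Proof.
by congr Num.sqrt; apply: eq_bigr => i _; apply: eq_bigr => j _; rewrite expr2.
Qed.

Lemma enorm_sqr A : enorm A ^+ 2 = mdot A A.
Proof. by rewrite enormE sqr_sqrtr // mdot_ge0. Qed.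

Lemma enorm_ge0 A : 0 <= enorm A.
Proof. by rewrite enormE sqrtr_ge0. Qed.

Lemma enorm0 : enorm (0 : 'M[R]_(p, q)) = 0.
Proof. by rewrite enormE mdot0l sqrtr0. Qed.

Lemma enormZ a A : enorm (a *: A) = `|a| * enorm A.
Proof.
by rewrite !enormE !mdotE mulrA -expr2 sqrtrM ?sqr_ge0 // sqrtr_sqr.
Qed.

Lemma enormN A : enorm (- A) = enorm A.
Proof. by rewrite -scaleN1r enormZ normrN1 mul1r. Qed.

Lemma enormC A B : enorm (A - B) = enorm (B - A).
Proof. by rewrite -enormN opprB. Qed.

Lemma coord_le_enorm A i j : `|A i j| <= enorm A.
Proof.
rewrite -sqrtr_sqr; apply: ler_wsqrtr.
rewrite (bigD1 i) //= (bigD1 j) //= -addrA lerDl addr_ge0 //.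
  by apply: sumr_ge0 => *; rewrite sqr_ge0.
by do 2! apply: sumr_ge0 => *; rewrite sqr_ge0.
Qed.

Lemma enorm_eq0 A : enorm A = 0 -> A = 0.
Proof.
move=> A0; apply/matrixP => i j; rewrite mxE; apply/eqP.
by rewrite -normr_le0 -A0 coord_le_enorm.
Qed.

Lemma cauchy_schwarz A B : mdot A B <= enorm A * enorm B.
Proof.
have [/enorm_eq0->|A0] := eqVneq (enorm A) 0; first by rewrite enorm0 mdot0l mul0r.
have [/enorm_eq0->|B0] := eqVneq (enorm B) 0; first by rewrite enorm0 mdot0r mulr0.
have a0 : 0 < enorm A by rewrite lt_def A0 enorm_ge0.
have b0 : 0 < enorm B by rewrite lt_def B0 enorm_ge0.
have := mdot_ge0 (enorm B *: A - enorm A *: B).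
rewrite !mdotE (mdotC B A) -!enorm_sqr => h.
rewrite -(ler_pM2l (mulr_gt0 a0 b0)); nra.
Qed.

Lemma cauchy_schwarzN A B : - (enorm A * enorm B) <= mdot A B.
Proof. by rewrite lerNl -mdotNl -(enormN A) cauchy_schwarz. Qed.

Lemma cauchy_schwarz_norm A B : `|mdot A B| <= enorm A * enorm B.
Proof. by rewrite ler_norml cauchy_schwarz cauchy_schwarzN. Qed.

Lemma enormD A B : enorm (A + B) <= enorm A + enorm B.
Proof.
have := cauchy_schwarz A B; have := enorm_ge0 A; have := enorm_ge0 B => b0 a0 cs.
rewrite -(@ler_pXn2r _ 2) ?nnegrE ?addr_ge0 ?enorm_ge0 //.
rewrite enorm_sqr !mdotE (mdotC B A) -!enorm_sqr; nra.
Qed.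

Lemma enormB A B : enorm (A - B) <= enorm A + enorm B.
Proof. by rewrite -(enormN B) enormD. Qed.

Lemma enorm_sqrB A B :
  enorm (A - B) ^+ 2 = enorm A ^+ 2 - 2 * mdot A B + enorm B ^+ 2.
Proof. rewrite !enorm_sqr !mdotE (mdotC B A); ring. Qed.

Lemma enorm_sqrD A B :
  enorm (A + B) ^+ 2 = enorm A ^+ 2 + 2 * mdot A B + enorm B ^+ 2.
Proof. rewrite !enorm_sqr !mdotE (mdotC B A); ring. Qed.

Lemma mdot_young A B a : 0 < a ->
  - mdot A B <= a / 2 * enorm A ^+ 2 + 1 / (2 * a) * enorm B ^+ 2.
Proof.
move=> a0; have := sqr_ge0 (a * enorm A - enorm B).
have := cauchy_schwarzN A B => cs h.
have -> : a / 2 * enorm A ^+ 2 + 1 / (2 * a) * enorm B ^+ 2 =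
  ((a * enorm A - enorm B) ^+ 2) / (2 * a) + enorm A * enorm B.
  by field; rewrite gt_eqF.
rewrite -[leLHS]add0r; apply: lerD; first by rewrite divr_ge0 // mulr_ge0 ?ltW.
by rewrite lerNl.
Qed.

End Fixed.

Lemma dotpE n (u v : 'rV[R]_n) : dotp u v = mdot u v.
Proof. by rewrite /mdot big_ord1. Qed.

Lemma mdot_rows p q (A B : 'M[R]_(p, q)) :
  mdot A B = \sum_i mdot (row i A) (row i B).
Proof.
apply: eq_bigr => i _; rewrite /mdot big_ord1.
by apply: eq_bigr => j _; rewrite !mxE.
Qed.

Lemma enorm_rows p q (A : 'M[R]_(p, q)) :
  enorm A ^+ 2 = \sum_i enorm (row i A) ^+ 2.
Proof. by rewrite enorm_sqr mdot_rows; apply: eq_bigr => i _; rewrite enorm_sqr. Qed.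

Lemma enorm_row_le p q (A : 'M[R]_(p, q)) i : enorm (row i A) <= enorm A.
Proof.
rewrite -(@ler_pXn2r _ 2) ?nnegrE ?enorm_ge0 // (enorm_rows A) (bigD1 i) //=.
by rewrite lerDl; apply: sumr_ge0 => *; rewrite sqr_ge0.
Qed.

Lemma enorm_le_rows p q (A : 'M[R]_(p, q)) (c : R) : 0 <= c ->
  (forall i, enorm (row i A) <= c) -> enorm A <= Num.sqrt p%:R * c.
Proof.
move=> c0 Ac; rewrite -(@ler_pXn2r _ 2) ?nnegrE ?mulr_ge0 ?sqrtr_ge0 ?enorm_ge0 //.
rewrite enorm_rows exprMn sqr_sqrtr ?ler0n //.
apply: (@le_trans _ _ (\sum_(i < p) c ^+ 2)); last first.
  by rewrite sumr_const card_ord mulr_natl.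
by apply: ler_sum => i _; rewrite ler_pXn2r ?nnegrE ?enorm_ge0.
Qed.

Lemma mdot_mulmx n m (d : 'rV[R]_n) (J : 'M[R]_(n, m)) (y : 'rV[R]_m) :
  mdot (d *m J) y = mdot d (y *m J^T).
Proof.
rewrite /mdot !big_ord1.
under eq_bigr => j _ do rewrite mxE mulr_suml.
rewrite exchange_big; apply: eq_bigr => i _ /=; rewrite mxE mulr_sumr.
by apply: eq_bigr => j _; rewrite mxE -mulrA (mulrC (J i j)).
Qed.

Lemma mulmx_mdot n m (x : 'rV[R]_n) (A : 'M[R]_(n, m)) j :
  (x *m A) 0 j = mdot x (col j A)^T.
Proof. by rewrite /mdot big_ord1 mxE; apply: eq_bigr => i _; rewrite !mxE. Qed.

Lemma enorm_mulmx_frob n m (x : 'rV[R]_n) (A : 'M[R]_(n, m)) :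
  enorm (x *m A) <= enorm x * enorm A.
Proof.
rewrite -(@ler_pXn2r _ 2) ?nnegrE ?mulr_ge0 ?enorm_ge0 // exprMn.
rewrite {1}/enorm sqr_sqrtr; last by do 2! apply: sumr_ge0 => *; rewrite sqr_ge0.
have -> : enorm A ^+ 2 = \sum_j enorm (col j A)^T ^+ 2.
  rewrite enorm_sqr /mdot exchange_big; apply: eq_bigr => j _.
  by rewrite enorm_sqr /mdot big_ord1; apply: eq_bigr => i _; rewrite !mxE.
rewrite big_ord1 mulr_sumr; apply: ler_sum => j _.
rewrite mulmx_mdot -exprMn -real_normK ?num_real //.
by rewrite ler_pXn2r ?nnegrE ?mulr_ge0 ?enorm_ge0 // cauchy_schwarz_norm.
Qed.

(** The Frobenius bound shows that the set defining [spectral_norm] is bounded above, as its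
    supremum requires; the inequality itself follows by normalizing [x]. *)
Lemma enorm_mulmx_le n m (x : 'rV[R]_n) (A : 'M[R]_(n, m)) :
  enorm (x *m A) <= spectral_norm A * enorm x.
Proof.
have [/enorm_eq0->|x0] := eqVneq (enorm x) 0.
  by rewrite mul0mx !enorm0 mulr0.
have xp : 0 < enorm x by rewrite lt_def x0 enorm_ge0.
rewrite -ler_pdivrMr //; apply: ub_le_sup.
  exists (enorm A) => _ [z /= z1 <-]; apply: le_trans (enorm_mulmx_frob z A) _.
  by rewrite -{2}(mul1r (enorm A)) ler_wpM2r ?enorm_ge0.
exists ((enorm x)^-1 *: x) => /=.
  by rewrite enormZ ger0_norm ?invr_ge0 ?enorm_ge0 // mulVf.
by rewrite -scalemxAl enormZ ger0_norm ?invr_ge0 ?enorm_ge0 // mulrC.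
Qed.

End InnerProduct.

(** * Limits along filters and projections *)

Section EntrywiseLimits.
Variables (R : realType).

(** Entrywise, so that limits of inner products and norms reduce to finite sums and products of real
    limits. The filter is left free because both ultrafilters on [nat] and [0^'+] occur. *)
Definition mx_lim (T : Type) (U : set_system T) p q (u : T -> 'M[R]_(p, q)) (A : 'M[R]_(p, q)) :=
  forall i j, (fun k => u k i j) @ U --> A i j.

(** Compactness gives a cluster point, and a cluster point of an ultrafilter is a limit. Working
    along one ultrafilter replaces repeated extraction of subsequences: all bounded sequences
    converge along it at once. *)
Lemma bounded_ultra_cvg (T : Type) (U : set_system T) (u : T -> R) (c : R) :
  UltraFilter U -> (forall k, `|u k| <= c) -> exists l : R, u @ U --> l.
Proof.
move=> UU uc; have := @segment_compact R (- c) c.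
have PU : ProperFilter U := @ultra_proper _ _ UU.
have uU : (u @ U) [set` `[- c, c]].
  by apply: nearW => k /=; rewrite in_itv /= -ler_norml.
move=> /(_ _ _ uU)[l [_ lc]]; exists l => B Bl.
have [//|UB] := in_ultra_setVsetC (u @^-1` B) UU.
by have [x [] //] := lc (~` B) B UB Bl.
Qed.

Lemma bounded_mx_lim (T : Type) (U : set_system T) p q (u : T -> 'M[R]_(p, q)) (c : R) :
  UltraFilter U -> (forall k, enorm (u k) <= c) -> exists A, mx_lim U u A.
Proof.
move=> UU uc.
have h (ij : 'I_p * 'I_q) : exists l : R, (fun k => u k ij.1 ij.2) @ U --> l.
  by apply: (@bounded_ultra_cvg _ _ _ c) => // k; apply: le_trans (uc k); exact: coord_le_enorm.
have [f fP] := choice h.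
by exists (\matrix_(i, j) f (i, j)) => i j; rewrite mxE; exact: (fP (i, j)).
Qed.

Section Filtered.
Variables (T : Type) (U : set_system T).
Context {FU : ProperFilter U}.

Lemma cvg_sumr (I : Type) (r : seq I) (f : I -> T -> R) (a : I -> R) :
  (forall i, f i @ U --> a i) ->
  (fun k => \sum_(i <- r) f i k) @ U --> \sum_(i <- r) a i.
Proof.
move=> fa; elim: r => [|i r IH].
  by rewrite big_nil; under eq_fun do rewrite big_nil; exact: cvg_cst.
by rewrite big_cons; under eq_fun do rewrite big_cons; apply: cvgD.
Qed.

Lemma mx_lim_cst p q (A : 'M[R]_(p, q)) : mx_lim U (fun=> A) A.
Proof. by move=> i j; exact: cvg_cst. Qed.

Lemma mx_limD p q (u w : T -> 'M[R]_(p, q)) A B :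
  mx_lim U u A -> mx_lim U w B -> mx_lim U (fun k => u k + w k) (A + B).
Proof.
move=> uA wB i j; rewrite mxE; under eq_fun do rewrite mxE.
by apply: cvgD; [exact: uA | exact: wB].
Qed.

Lemma mx_limZ p q (u : T -> 'M[R]_(p, q)) A (a : R) :
  mx_lim U u A -> mx_lim U (fun k => a *: u k) (a *: A).
Proof.
move=> uA i j; rewrite mxE; under eq_fun do rewrite mxE.
by apply: cvgMl_tmp; exact: uA.
Qed.

Lemma mx_limB p q (u w : T -> 'M[R]_(p, q)) A B :
  mx_lim U u A -> mx_lim U w B -> mx_lim U (fun k => u k - w k) (A - B).
Proof.
move=> uA wB; rewrite -scaleN1r.
under eq_fun do rewrite -scaleN1r.
by apply: mx_limD => //; exact: mx_limZ.
Qed.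

Lemma mx_lim_row p q (u : T -> 'M[R]_(p, q)) A i :
  mx_lim U u A -> mx_lim U (fun k => row i (u k)) (row i A).
Proof. by move=> uA i' j; rewrite mxE; under eq_fun do rewrite mxE; exact: uA. Qed.

Lemma cvg_mdot p q (u w : T -> 'M[R]_(p, q)) A B :
  mx_lim U u A -> mx_lim U w B -> (fun k => mdot (u k) (w k)) @ U --> mdot A B.
Proof.
move=> uA wB.
apply: cvg_sumr => i; apply: cvg_sumr => j.
by apply: cvgM; [exact: uA | exact: wB].
Qed.

Lemma cvg_enorm_sqr p q (u : T -> 'M[R]_(p, q)) A :
  mx_lim U u A -> (fun k => enorm (u k) ^+ 2) @ U --> enorm A ^+ 2.
Proof.
by move=> uA; rewrite enorm_sqr; under eq_fun do rewrite enorm_sqr; exact: cvg_mdot.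
Qed.

Lemma cvg_enorm p q (u : T -> 'M[R]_(p, q)) A :
  mx_lim U u A -> (fun k => enorm (u k)) @ U --> enorm A.
Proof.
move=> uA; rewrite enormE; under eq_fun do rewrite enormE.
by apply: continuous_cvg (cvg_mdot uA uA); exact: sqrt_continuous.
Qed.

Lemma cvg_enormB p q (u : T -> 'M[R]_(p, q)) A :
  mx_lim U u A -> (fun k => enorm (u k - A)) @ U --> (0 : R).
Proof.
move=> uA; rewrite -(@enorm0 R p q) -(subrr A).
by apply: cvg_enorm; apply: mx_limB => //; exact: mx_lim_cst.
Qed.

Lemma squeeze_mx_lim p q (u : T -> 'M[R]_(p, q)) A (b : T -> R) :
  (forall k, enorm (u k - A) <= b k) -> b @ U --> (0 : R) -> mx_lim U u A.
Proof.
move=> ub b0 i j; apply/cvgrPdist_lt => e e0.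
move/cvgrPdist_lt : b0 => /(_ _ e0); apply: filterS => k; rewrite sub0r normrN => bk.
have := coord_le_enorm (u k - A) i j; rewrite !mxE distrC => h.
by apply: le_lt_trans h (le_lt_trans (le_trans (ub k) (ler_norm _)) bk).
Qed.

Lemma mx_norm_le_enorm p q (A : 'M[R]_(p, q)) : `|A| <= enorm A.
Proof.
rewrite [`|A|]mx_normrE; apply: bigmax_le => [|ij _]; first exact: enorm_ge0.
exact: coord_le_enorm.
Qed.

Lemma cvg_enorm0 p q (u : T -> 'M[R]_(p, q)) A :
  (fun k => enorm (u k - A)) @ U --> (0 : R) -> u @ U --> A.
Proof.
move=> u0; apply/cvgrPdist_lt => e e0.
move/cvgrPdist_lt : u0 => /(_ _ e0); apply: filterS => k.
rewrite sub0r normrN ger0_norm ?enorm_ge0 // enormC => h.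
by apply: le_lt_trans h; exact: mx_norm_le_enorm.
Qed.

Lemma closed_mx_lim p q (S : set 'M[R]_(p, q)) (u : T -> 'M[R]_(p, q)) A :
  closed S -> (\forall k \near U, S (u k)) -> mx_lim U u A -> S A.
Proof.
move=> cS Su uA.
by apply: (closed_cvg S cS Su); apply: cvg_enorm0; exact: cvg_enormB.
Qed.

End Filtered.
End EntrywiseLimits.

Section Projection.
Variable R : realType.

Lemma inf_seq (S : set R) (c : R) : S !=set0 -> (forall x, S x -> c <= x) ->
  exists s : nat -> R, (forall k, S (s k)) /\ forall k, s k < inf S + k.+1%:R^-1.
Proof.
move=> S0 Sc.
have hS : has_inf S by split=> //; exists c.
have h (k : nat) : exists x, S x /\ x < inf S + k.+1%:R^-1.
  have e0 : 0 < (k.+1%:R^-1 : R) by rewrite invr_gt0.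
  by have [x Sx xl] := inf_adherent e0 hS; exists x.
by have [f fP] := choice h; exists f; split=> k; have [] := fP k.
Qed.

(** A minimizing sequence is bounded, so it converges along an ultrafilter finer than [\oo].
    Closedness is asked in the sequential form in which it is checked for both the cone and
    [bounded_consensus]. *)
Lemma proj_exists p q (S : set 'M[R]_(p, q)) (x : 'M[R]_(p, q)) : S !=set0 ->
  (forall (U : set_system nat) u A, UltraFilter U -> (forall k, S (u k)) -> mx_lim U u A -> S A) ->
  exists z, is_proj S x z.
Proof.
move=> S0 cS.
have dS0 : [set enorm (x - s) | s in S] !=set0.
  by case: S0 => s Ss; exists (enorm (x - s)); exists s.
have lb : forall r, [set enorm (x - s) | s in S] r -> 0 <= r.
  by move=> _ [s _ <-]; exact: enorm_ge0.
have [f [fS fl]] := inf_seq dS0 lb.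
have hs (k : nat) : exists s, S s /\ enorm (x - s) = f k.
  by have [s Ss <-] := fS k; exists s.
have [s sP] := choice hs.
have [U [UU oU]] := ultraFilterLemma (eventually_filter).
have sb k : enorm (s k) <= enorm x + (inf [set enorm (x - s) | s in S] + 1).
  rewrite -[s k](subKr x); apply: le_trans (enormB _ _) _; rewrite lerD2l.
  have [_ ->] := sP k; apply: le_trans (ltW (fl k)) _; rewrite lerD2l.
  by rewrite invf_le1 ?ler1n.
have [z zs] := bounded_mx_lim UU sb.
exists z; split; first by apply: (cS U s) => // k; have [] := sP k.
move=> t St; apply: (@le_trans _ _ (inf [set enorm (x - s) | s in S])); last first.
  by apply: ge_inf; [exists 0 | exists t].
have PU : ProperFilter U := @ultra_proper _ _ UU.
have c1 : (fun k => enorm (x - s k)) @ U --> enorm (x - z).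
  by apply: cvg_enorm; apply: mx_limB => //; exact: mx_lim_cst.
have c2 : (fun k => inf [set enorm (x - s) | s in S] + k.+1%:R^-1) @ U -->
          inf [set enorm (x - s) | s in S] + 0.
  apply: cvgD; first exact: cvg_cst.
  by move=> B /(@cvg_harmonic R) hB; exact: oU.
rewrite -[leRHS]addr0.
apply: ler_cvg_to c1 c2 _; apply: nearW => k.
by have [_ ->] := sP k; exact: ltW.
Qed.

Definition cvx_set p q (S : set 'M[R]_(p, q)) :=
  forall x y (t : R), S x -> S y -> 0 <= t -> t <= 1 -> S (t *: x + (1 - t) *: y).

(** Limit [s -> 0] of first-order arguments: the projection and prox inequalities come from moving a
    fraction [s] along a segment and discarding the term in [s]. *)
Lemma le_of_le_addM (a b c : R) : 
  (forall s : R, 0 < s -> s <= 1 -> a <= b + s * c) -> a <= b.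
Proof.
move=> h; apply/ler_addgt0Pr => e e0.
have c0 : 0 < 1 + `|c| by rewrite ltr_pwDl.
have s0 : 0 < Num.min 1 (e / (1 + `|c|)) by rewrite lt_min ltr01 divr_gt0.
have s1 : Num.min 1 (e / (1 + `|c|)) <= 1 by rewrite ge_min lexx.
apply: le_trans (h _ s0 s1) _; rewrite lerD2l.
have se : Num.min 1 (e / (1 + `|c|)) <= e / (1 + `|c|) by rewrite ge_min lexx orbT.
have cc : c <= 1 + `|c| by have := ler_norm c; lra.
apply: le_trans (ler_wpM2l (ltW s0) cc) _.
by rewrite -ler_pdivlMr.
Qed.

Lemma proj_ineq p q (S : set 'M[R]_(p, q)) x z s :
  cvx_set S -> is_proj S x z -> S s -> mdot (x - z) (s - z) <= 0.
Proof.
move=> cS [Sz zP] Ss.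
apply: (@le_of_le_addM _ _ (enorm (s - z) ^+ 2 / 2)) => t t0 t1; rewrite add0r.
have := zP _ (cS _ _ _ Ss Sz (ltW t0) t1).
have -> : x - (t *: s + (1 - t) *: z) = (x - z) - t *: (s - z).
  by rewrite scalerBr scalerBl scale1r !opprD !opprK; rewrite !addrA; congr (_ + _);
     rewrite addrAC.
rewrite -(@ler_pXn2r _ 2) ?nnegrE ?enorm_ge0 // (enorm_sqrB (x - z)) enormZ exprMn mdotZr.
rewrite real_normK ?num_real // => h.
have {h} : 0 <= t * (t * enorm (s - z) ^+ 2 - 2 * mdot (x - z) (s - z)) by lra.
by rewrite pmulr_rge0 //; lra.
Qed.

End Projection.

(** * Proximal and gradient inequalities *)

Section ExtendedValued.
Variables (R : realType) (n : nat) (rho : 'rV[R]_n -> \bar R).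
Hypotheses (rho_proper : proper_fun rho) (rho_convex : convex_efun rho).

Lemma edom_fineK x : edom rho x -> (fine (rho x))%:E = rho x.
Proof. by move=> xd; rewrite fineK // fin_real // (rho_proper.1 x). Qed.

Lemma edom_convex : cvx_set (edom rho).
Proof.
move=> x y t xd yd t0 t1; rewrite /edom /=.
apply: le_lt_trans (rho_convex x y t0 t1) _.
by rewrite -(edom_fineK xd) -(edom_fineK yd) -!EFinM -EFinD ltry.
Qed.

Lemma fine_convex x y t : edom rho x -> edom rho y -> 0 <= t -> t <= 1 ->
  fine (rho (t *: x + (1 - t) *: y)) <= t * fine (rho x) + (1 - t) * fine (rho y).
Proof.
move=> xd yd t0 t1; have := rho_convex x y t0 t1.
rewrite -(edom_fineK xd) -(edom_fineK yd) -(edom_fineK (edom_convex xd yd t0 t1)).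
by rewrite -!EFinM -EFinD lee_fin.
Qed.

Variables (t : R) (x z : 'rV[R]_n).
Hypotheses (t0 : 0 < t) (zP : is_prox t rho x z).

Lemma prox_edom : edom rho z.
Proof.
have [_ [u ud]] := rho_proper; have := zP u.
rewrite -(edom_fineK ud) -EFinM -EFinD /edom /=.
case: (rho z) => [r||] //=; first by rewrite ltry.
by rewrite gt0_muley ?lte_fin // addye // leye_eq.
Qed.

Lemma prox_ineq u : edom rho u ->
  t * (fine (rho z) - fine (rho u)) <= mdot (z - x) (u - z).
Proof.
move=> ud; have zd := prox_edom.
apply: (@le_of_le_addM _ _ _ (enorm (u - z) ^+ 2 / 2)) => s s0 s1.
have := zP (s *: u + (1 - s) *: z).
have wd := edom_convex ud zd (ltW s0) s1.
rewrite -(edom_fineK zd) -(edom_fineK wd) -!EFinM -!EFinD lee_fin.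
have -> : s *: u + (1 - s) *: z - x = (z - x) + s *: (u - z).
  by apply/matrixP => i j; rewrite !mxE; ring.
rewrite (enorm_sqrD (z - x)) enormZ exprMn mdotZr real_normK ?num_real // => h.
have fc := fine_convex ud zd (ltW s0) s1.
have {h fc} : 0 <= s * (mdot (z - x) (u - z) + s * (enorm (u - z) ^+ 2 / 2)
   - t * (fine (rho z) - fine (rho u))).
  have := ler_wpM2l (ltW t0) fc; lra.
by rewrite pmulr_rge0 // subr_ge0.
Qed.

End ExtendedValued.

Section GradientInequality.
Variable R : realType.

Lemma derive_quotient_le (V : normedModType R) (f : V -> R^o) x d (c : R) :
  derivable f x d -> (forall t, 0 < t -> t <= 1 -> f (t *: d + x) - f x <= t * c) ->
  'D_d f x <= c.
Proof.
move=> df fc.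
have h : (fun h : R => h^-1 *: ((f \o shift x) (h *: d) - f x)) @ 0^'+ --> 'D_d f x.
  by apply: cvg_dnbhs_at_right; exact: df.
apply: (cvgr_to_le h); near=> t.
have t0 : 0 < t by near: t; exact: nbhs_right_gt.
have t1 : t <= 1 by near: t; apply: nbhs_right_le; exact: ltr01.
rewrite /= -[_ *: _]/(_ * _) mulrC ler_pdivrMr // mulrC.
exact: fc.
Unshelve. all: by end_near.
Qed.

Lemma gradientE n (f : 'rV[R]_n -> R) x d :
  differentiable (f : 'rV[R]_n -> R^o) x ->
  mdot (gradient f x) d = 'D_d (f : 'rV[R]_n -> R^o) x.
Proof.
move=> df; rewrite deriveE // {2}(row_sum_delta d) linear_sum /mdot big_ord1.
by apply: eq_bigr => j _; rewrite linearZ /= mxE mulrC.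
Qed.

Lemma gradient_ineq n (f : 'rV[R]_n -> R) x u : convex_fun f ->
  differentiable (f : 'rV[R]_n -> R^o) x ->
  f x + mdot (gradient f x) (u - x) <= f u.
Proof.
move=> cf df; rewrite gradientE // -lerBrDl.
apply: derive_quotient_le => [|t t0 t1]; first exact: diff_derivable.
have := cf u x t (ltW t0) t1.
have -> : t *: u + (1 - t) *: x = t *: (u - x) + x.
  by apply/matrixP => i j; rewrite !mxE; ring.
lra.
Qed.

(** For [y] in the polar cone, [- <g, y>] is convex and this is its gradient inequality.
    [K]-convexity fixes the sign of the difference quotient paired with [- y], before the limit is
    taken. *)
Lemma jacobian_ineq n m (K : set 'rV[R]_m) (g : 'rV[R]_n -> 'rV[R]_m) x u y :
  cone_convex K g -> polar_cone K y -> differentiable g x ->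
  mdot (g u - g x) y <= mdot ((u - x) *m 'J g x) y.
Proof.
move=> cg yK dg.
rewrite -lerN2 -!mdotNr -deriveEjacobian //.
have dv : derivable g x (u - x) by exact: diff_derivable.
have h : (fun h : R => h^-1 *: ((g \o shift x) (h *: (u - x)) - g x)) @ 0^'+
     --> 'D_(u - x) g x.
  by apply: cvg_dnbhs_at_right; exact: dv.
have hm : mx_lim 0^'+ (fun h : R => h^-1 *: ((g \o shift x) (h *: (u - x)) - g x))
     ('D_(u - x) g x).
  move=> i j.
  apply: (@continuous_cvg _ _ _ _ _ _ (fun M : 'M[R]_(1, m) => M i j)) h.
  exact: coord_continuous.
have hc : mx_lim 0^'+ (fun _ : R => - y) (- y) by exact: mx_lim_cst.
apply: (cvgr_to_le (cvg_mdot hm hc)); near=> t.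
have t0 : 0 < t by near: t; exact: nbhs_right_gt.
have t1 : t <= 1 by near: t; apply: nbhs_right_le; exact: ltr01.
rewrite /= mdotZl mulrC ler_pdivrMr //.
have := yK _ (cg u x t (ltW t0) t1); rewrite dotpE.
have -> : t *: u + (1 - t) *: x = t *: (u - x) + x.
  by apply/matrixP => i j; rewrite !mxE; ring.
rewrite !(mdotC (- y)) !mdotE; lra.
Unshelve. all: by end_near.
Qed.

(* With constant c the estimate holds with L / 4 + c / 2 by going through the
   midpoint, and these constants decrease from L to the fixed point L / 2. *)
Lemma descent_ineq n (D : set 'rV[R]_n) (h : 'rV[R]_n -> R) (G : 'rV[R]_n -> 'rV[R]_n) (L : R) :
  cvx_set D -> 0 <= L ->
  (forall x u, D x -> D u -> h x + mdot (G x) (u - x) <= h u) ->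
  (forall x u d, D x -> D u -> mdot (G u - G x) d <= L * enorm (u - x) * enorm d) ->
  forall x u, D x -> D u ->
    h u <= h x + mdot (G x) (u - x) + L / 2 * enorm (u - x) ^+ 2.
Proof.
move=> cD L0 hG GL.
have step (k : nat) x u : D x -> D u ->
    h u <= h x + mdot (G x) (u - x) + (L / 2 + L / 2 * 2^-1 ^+ k) * enorm (u - x) ^+ 2.
  elim: k x u => [|k IH] x u xD uD.
    have := hG u x uD xD; have := GL x u (u - x) xD uD.
    by rewrite !mdotE expr0 mulr1 -splitr -mulrA -expr2; lra.
  have h0 : 0 <= (2^-1 : R) by rewrite invr_ge0.
  have h1 : (2^-1 : R) <= 1 by rewrite invf_le1 ?ler1n.
  pose m := 2^-1 *: u + (1 - 2^-1) *: x.
  have mD : D m by exact: cD.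
  have e1 : m - x = 2^-1 *: (u - x) by apply/matrixP => i j; rewrite !mxE; ring.
  have e2 : u - m = 2^-1 *: (u - x) by apply/matrixP => i j; rewrite !mxE; field.
  have := IH _ _ xD mD; have := IH _ _ mD uD; have := GL x m (u - m) xD mD.
  rewrite e1 e2 enormZ ger0_norm // mdotZr !mdotDl mdotNl !mdotZr !exprMn (exprS _ k).
  set a := enorm _; set b := mdot (G m) _; set c := mdot (G x) _; set p := 2^-1 ^+ k.
  by move=> ? ? ?; lra.
move=> x u xD uD; apply: (@le_of_le_addM _ _ _ (L / 2 * enorm (u - x) ^+ 2)) => s s0 _.
pose k := Num.bound s^-1.
have := step k x u xD uD.
have ps : 2^-1 ^+ k <= s.
  rewrite exprVn -[s]invrK lef_pV2 ?posrE ?invr_gt0 ?exprn_gt0 //.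
  have : s^-1 <= k%:R by apply/ltW/archi_boundP; rewrite invr_ge0 ltW.
  move=> h1; apply: le_trans h1 _; rewrite -natrX ler_nat.
  by apply: ltnW; exact: ltn_expl.
have e0 : 0 <= L / 2 * enorm (u - x) ^+ 2 by rewrite mulr_ge0 ?sqr_ge0 // divr_ge0.
have := ler_wpM2r e0 ps; lra.
Qed.

End GradientInequality.

(* Rewriting and lra compare terms up to conversion, which does not terminate in
   practice on derivatives: the vectors built from them are made abstract first. *)
Ltac gen_vectors := repeat match goal with
  | |- context [@gradient ?R ?n ?f ?x] => generalize (@gradient R n f x)
  | |- context [@mulmx ?R ?m ?n ?p ?A ?B] => generalize (@mulmx R m n p A B)
  | |- context [@gcon ?R ?P ?i ?x] => generalize (@gcon R P i x)
  | |- context [@fsm ?R ?P ?i ?x] => generalize (@fsm R P i x)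
  | |- context [@rho ?R ?P ?i ?x] => generalize (@rho R P i x)
  | |- context [@Lf ?R ?P ?i] => generalize (@Lf R P i)
  | |- context [@Cg ?R ?P ?i] => generalize (@Cg R P i)
  | |- context [@Lg ?R ?P ?i] => generalize (@Lg R P i)
  end.

(** * Inequalities at a single node *)

Section Node.
Variables (R : realType) (P : problem R).
Hypothesis P_ok : problem_ok P.
Local Notation N := (nodes P).
Local Notation m := (cdim P).

Lemma Lf_ge0 i : 0 <= Lf P i. Proof. by case: P_ok => _ _ /(_ i)[]. Qed.
Lemma Cg_ge0 i : 0 <= Cg P i. Proof. by case: P_ok => _ _ _ /(_ i)[[]]. Qed.
Lemma Lg_ge0 i : 0 <= Lg P i. Proof. by case: P_ok => _ _ _ /(_ i)[[]]. Qed.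

Definition phi i (x : 'rV[R]_(dim i)) : R := fine (rho P i x) + fsm P i x.

Lemma rho_proper i : proper_fun (rho P i). Proof. by case: P_ok => _ /(_ i)[]. Qed.
Lemma rho_convex i : convex_efun (rho P i). Proof. by case: P_ok => _ /(_ i)[]. Qed.

Lemma edom_fdom i (x : 'rV[R]_(dim i)) : edom (rho P i) x -> fdom P i x.
Proof. by case: P_ok => _ _ /(_ i)[_ _ [_ sub] _ _] _ /sub. Qed.

Lemma fsm_gradient_ineq (i : 'I_N) (x u : 'rV[R]_(dim i)) : fdom P i x ->
  fsm P i x + mdot (gradient (fsm P i) x) (u - x) <= fsm P i u.
Proof.
case: P_ok => _ _ /(_ i)[_ cf _ df _] _ xd; apply: gradient_ineq => //.
exact: df.
Qed.

Lemma gradient_lip (i : 'I_N) (x u d : 'rV[R]_(dim i)) : fdom P i x -> fdom P i u ->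
  mdot (gradient (fsm P i) u - gradient (fsm P i) x) d <= Lf P i * enorm (u - x) * enorm d.
Proof.
case: P_ok => _ _ /(_ i)[_ _ _ _ lf] _ xd ud.
by apply: le_trans (cauchy_schwarz _ _) _; rewrite ler_wpM2r ?enorm_ge0 ?lf.
Qed.

Lemma fsm_descent (i : 'I_N) (x u : 'rV[R]_(dim i)) : edom (rho P i) x -> edom (rho P i) u ->
  fsm P i u <= fsm P i x + mdot (gradient (fsm P i) x) (u - x)
               + Lf P i / 2 * enorm (u - x) ^+ 2.
Proof.
apply: descent_ineq => [||a b /edom_fdom + _|a b d /edom_fdom + /edom_fdom].
- by apply: edom_convex; [exact: rho_proper | exact: rho_convex].
- exact: Lf_ge0.
- exact: fsm_gradient_ineq.
- exact: gradient_lip.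
Qed.

(** Gradient inequality at [u] combined with the Lipschitz bound. Since [fdom] need not be convex,
    the midpoint argument behind the constant [Lf / 2] is confined to the domain of [rho]; this form
    also covers points of [fdom] outside it. *)
Lemma fsm_descent_weak (i : 'I_N) (x u : 'rV[R]_(dim i)) : fdom P i x -> fdom P i u ->
  fsm P i u <= fsm P i x + mdot (gradient (fsm P i) x) (u - x)
               + Lf P i * enorm (u - x) ^+ 2.
Proof.
move=> xd ud; have := fsm_gradient_ineq x ud; have := gradient_lip (u - x) xd ud.
by gen_vectors => L f1 f2 G1 G2; rewrite -mulrA -expr2 !mdotDE; lra.
Qed.

Lemma gcon_lip (i : 'I_N) (x u : 'rV[R]_(dim i)) (y : 'rV[R]_m) :
  mdot (gcon P i x - gcon P i u) y <= Cg P i * enorm (x - u) * enorm y.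
Proof.
case: P_ok => _ _ _ /(_ i)[_ _ lg _ _].
by apply: le_trans (cauchy_schwarz _ _) _; rewrite ler_wpM2r ?enorm_ge0 ?lg.
Qed.

Lemma gcon_jacobian_ineq (i : 'I_N) (x u : 'rV[R]_(dim i)) (y : 'rV[R]_m) : polar_cone (cone P) y ->
  mdot (gcon P i u - gcon P i x) y <= mdot (u - x) (y *m ('J (gcon P i) x)^T).
Proof.
case: P_ok => _ _ _ /(_ i)[_ cg _ dg _] yK; rewrite -mdot_mulmx.
exact: jacobian_ineq cg yK (dg x).
Qed.

(** [descent_ineq] on the whole space for the convex function [- <g_i, y>], whose gradient is
    Lipschitz with constant [Lg * |y|]. Through this constant the size of the dual iterates enters
    the step-size condition. *)
Lemma gcon_descent (i : 'I_N) (x u : 'rV[R]_(dim i)) (y : 'rV[R]_m) :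
  polar_cone (cone P) y ->
  mdot (u - x) (y *m ('J (gcon P i) x)^T) - Lg P i * enorm y / 2 * enorm (u - x) ^+ 2
    <= mdot (gcon P i u - gcon P i x) y.
Proof.
move=> yK; have [_ _ _ /(_ i)[_ _ _ _ lJ]] := P_ok.
have h1 (a b : 'rV[R]_(dim i)) : setT a -> setT b -> - mdot (gcon P i a) y +
    mdot (- (y *m ('J (gcon P i) a)^T)) (b - a) <= - mdot (gcon P i b) y.
  move=> _ _; have := gcon_jacobian_ineq a b yK.
  by gen_vectors => g1 g2 J; rewrite (mdotC (- J)) mdotNr !mdotBl; lra.
have h2 (a b d : 'rV[R]_(dim i)) : setT a -> setT b ->
    mdot (- (y *m ('J (gcon P i) b)^T) - - (y *m ('J (gcon P i) a)^T)) d <=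
    Lg P i * enorm y * enorm (b - a) * enorm d.
  move=> _ _; move: (lJ a b).
  move: ('J (gcon P i) a) ('J (gcon P i) b) => Ja Jb hJ.
  have -> : mdot (- (y *m Jb^T) - - (y *m Ja^T)) d = mdot (d *m (Ja - Jb)) y.
    by rewrite mulmxBr !mdotBl !mdot_mulmx !mdotNl !(mdotC _ d); ring.
  apply: le_trans (cauchy_schwarz _ _) _.
  have := ler_wpM2r (enorm_ge0 d) hJ; have := enorm_mulmx_le d (Ja - Jb).
  rewrite (enormC b) => h3 h4; have := ler_wpM2r (enorm_ge0 y) (le_trans h3 h4); lra.
have L0 : 0 <= Lg P i * enorm y by rewrite mulr_ge0 ?Lg_ge0 ?enorm_ge0.
have := descent_ineq (fun _ _ _ _ _ _ _ => I) L0 h1 h2 (x := x) (u := u) I I.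
by gen_vectors => L g1 g2 J; rewrite (mdotC (- J)) mdotNr !mdotBl; lra.
Qed.

Lemma enorm_three_points n (x z u : 'rV[R]_n) :
  mdot (z - x) (u - z) =
  2^-1 * (enorm (u - x) ^+ 2 - enorm (u - z) ^+ 2 - enorm (z - x) ^+ 2).
Proof.
have -> : u - x = (u - z) + (z - x) by rewrite addrA subrK.
rewrite enorm_sqrD (mdotC (u - z)); lra.
Qed.

(** Bounds the price of a start outside the domain of [rho] by problem data. The prox inequality is
    combined with first-order optimality of [xs]; no Jacobian appears in the prox step because the
    initial dual iterate is 0. *)
Lemma first_step_bound (i : 'I_N) (t : R) (x z xs : 'rV[R]_(dim i)) (ys : 'rV[R]_m) :
  0 < t -> is_prox t (rho P i) (x - t *: gradient (fsm P i) x) z ->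
  fdom P i x -> edom (rho P i) xs -> Lf P i <= t^-1 -> Cg P i <= t^-1 ->
  (forall u, edom (rho P i) u ->
     phi xs - mdot (gcon P i xs) ys <= phi u - mdot (gcon P i u) ys) ->
  Lf P i * enorm (z - x) ^+ 2 <=
    3 * (Lf P i * enorm (xs - x) ^+ 2) + 2 * (Cg P i * enorm ys ^+ 2).
Proof.
move=> t0 zP xd xsd Lt Ct xsP.
have zd : edom (rho P i) z by exact (prox_edom (rho_proper i) t0 zP).
(* First-order optimality of [xs] along the segment towards [u]: the smooth remainder is quadratic
   in [s] and vanishes after division, whereas the constraint is only used as a Lipschitz map and
   leaves the term in [Cg]. *)
have opt u : edom (rho P i) u -> fine (rho P i xs) - fine (rho P i u) <=
    mdot (gradient (fsm P i) xs) (u - xs) + Cg P i * enorm (u - xs) * enorm ys.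
  move=> ud; apply: (@le_of_le_addM _ _ _ (Lf P i * enorm (u - xs) ^+ 2)) => s s0 s1.
  pose w := s *: u + (1 - s) *: xs.
  have wd : edom (rho P i) w.
    by apply: edom_convex => //; [exact: rho_proper|exact: rho_convex|exact: ltW].
  have wE : w - xs = s *: (u - xs) by apply/matrixP => a b; rewrite !mxE; ring.
  have h1 := xsP _ wd.
  have h2 := fsm_descent_weak (edom_fdom xsd) (edom_fdom wd).
  have h3 := fine_convex (rho_proper i) (@rho_convex i) ud xsd (ltW s0) s1.
  have h4 := gcon_lip xs w ys; rewrite enormC in h4.
  move: h1 h2 h3 h4; rewrite -/w /phi wE enormZ gtr0_norm // exprMn.
  move: (fine (rho P i w)) (fine (rho P i u)) (fine (rho P i xs)) => rw ru rxs.
  gen_vectors => C L f1 f2 g1 g2 G; rewrite mdotZr mdotBl => h1 h2 h3 h4.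
  rewrite -(ler_pM2l s0); lra.
have := prox_ineq (rho_proper i) (@rho_convex i) t0 zP xsd.
have := opt _ zd; have := enorm_three_points x z xs.
have := gradient_lip (xs - z) (edom_fdom xsd) xd.
move: (fine (rho P i z)) (fine (rho P i xs)) => rz rxs.
have tL : t * Lf P i <= 1 by rewrite mulrC -ler_pdivlMr // div1r.
have tC : t * Cg P i <= 1 by rewrite mulrC -ler_pdivlMr // div1r.
have L0 := Lf_ge0 i; have C0 := Cg_ge0 i.
move: tL tC L0 C0; move: (gradient _ xs) (gradient _ x) => G1 G2.
gen_vectors => C L tL tC L0 C0.
have e1 : (z - (x - t *: G2) : 'rV_(dim i)) = (z - x) + t *: G2.
  by rewrite opprB addrA addrAC.
rewrite e1 (mdotDl (z - x)) mdotZl => hl -> hopt hp.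
rewrite (enormC xs z) in hl hp *.
have hm : mdot G1 (z - xs) = - mdot G1 (xs - z) by rewrite -mdotNr opprB.
have hd : mdot (G2 - G1) (xs - z) = mdot G2 (xs - z) - mdot G1 (xs - z) by rewrite mdotBl.
move: hl hopt hp; rewrite hm hd {hm hd}.
rewrite (enormC x xs).
move: (mdot G1 _) (mdot G2 _) => p1 p2.
have a0 := enorm_ge0 (z - x); have b0 := enorm_ge0 (z - xs).
have c0 := enorm_ge0 (xs - x); have y0 := enorm_ge0 ys.
move: a0 b0 c0 y0; move: (enorm (z - x)) (enorm (z - xs)) (enorm (xs - x)) (enorm ys).
move=> a b c y a0 b0 c0 y0 hl hopt hp.
have t0' := ltW t0.
have h1 : a ^+ 2 <= c ^+ 2 - b ^+ 2 + 2 * (t * L * c + t * C * y) * b.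
  have := ler_wpM2l t0' hl; have := ler_wpM2l t0' hopt; lra.
(* Completing the square in [b], the unknown distance from [z] to [xs], eliminates it. *)
have h2 : a ^+ 2 <= c ^+ 2 + (t * L * c + t * C * y) ^+ 2.
  have := sqr_ge0 (t * L * c + t * C * y - b); lra.
have l0 : 0 <= t * L by rewrite mulr_ge0.
have e0 : 0 <= t * C by rewrite mulr_ge0.
have h3 : (t * L * c) ^+ 2 <= c ^+ 2.
  rewrite exprMn ler_piMl ?sqr_ge0 // expr_le1 //.
have h4 : a ^+ 2 <= 3 * c ^+ 2 + 2 * (t * C * y) ^+ 2.
  have := sqr_ge0 (t * L * c - t * C * y); lra.
have h5 : L * (t * C * y) ^+ 2 <= C * y ^+ 2.
  have -> : L * (t * C * y) ^+ 2 = (t * L) * (t * C) * (C * y ^+ 2) by ring.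
  rewrite ler_piMl ?mulr_ge0 ?sqr_ge0 // mulr_ile1 //.
have := ler_wpM2l L0 h4; lra.
Qed.

Variable (i : 'I_N).
Variables (t : R) (x z : 'rV[R]_(dim i)) (y : 'rV[R]_m).
Hypotheses (t0 : 0 < t)
  (zP : is_prox t (rho P i)
     (x - t *: (gradient (fsm P i) x - y *m ('J (gcon P i) x)^T)) z).

Lemma node_edom : edom (rho P i) z.
Proof. exact (prox_edom (rho_proper i) t0 zP). Qed.

(** [c] is the excess curvature of the smooth part over [Lf]: 0 in general, [Lf] at the first step.
    The step-size condition absorbs [Lf + beta * Lg] exactly and leaves [Cg / 2] of the squared
    increment for the coupling with the dual step. *)
Lemma node_ineq (beta c : R) (u : 'rV[R]_(dim i)) :
  fdom P i x -> edom (rho P i) u -> polar_cone (cone P) y -> enorm y <= beta ->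
  Lf P i + beta * Lg P i + Cg P i <= t^-1 ->
  fsm P i z <= fsm P i x + mdot (gradient (fsm P i) x) (z - x)
               + (c + Lf P i) / 2 * enorm (z - x) ^+ 2 ->
  phi z - mdot (gcon P i z) y <= phi u - mdot (gcon P i u) y
    + t^-1 / 2 * (enorm (u - x) ^+ 2 - enorm (u - z) ^+ 2)
    - Cg P i / 2 * enorm (z - x) ^+ 2 + c / 2 * enorm (z - x) ^+ 2.
Proof.
move=> xd ud yK yb tt fz.
have := prox_ineq (rho_proper i) (@rho_convex i) t0 zP ud.
have := enorm_three_points x z u.
have := fsm_gradient_ineq u xd.
have := gcon_descent x z yK; have := gcon_jacobian_ineq x u yK.
move: fz; set G := gradient _ x; set J := y *m _; clearbody G J => fz.
have e1 : (z - (x - t *: (G - J)) : 'rV_(dim i)) = (z - x) + t *: (G - J).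
  by rewrite opprB addrA addrAC.
have e2 : (u - x : 'rV_(dim i)) = (u - z) + (z - x) by rewrite addrA subrK.
rewrite e1 (mdotDl (z - x)) mdotZl e2 /phi => hj hd hg -> hp.
have {}hp : fine (rho P i z) - fine (rho P i u) <=
  t^-1 * (2^-1 * (enorm ((u - z) + (z - x)) ^+ 2 - enorm (u - z) ^+ 2 - enorm (z - x) ^+ 2))
  + mdot (G - J) (u - z).
  by rewrite -(ler_pM2l t0) [leRHS]mulrDr mulVKf ?gt_eqF.
have hb : 0 <= enorm (z - x) ^+ 2 by exact: sqr_ge0.
have ht := ler_wpM2r hb tt.
have hy := ler_wpM2r hb (ler_wpM2l (Lg_ge0 i) yb).
move: hj hd hg fz hp ht hy; gen_vectors => C1 C2 C3 r1 r2 f1 f2 f3 g1 g2 g3.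
rewrite !mdotDE !(mdotC _ J); lra.
Qed.

End Node.

(** * One iteration *)

Section Sets.
Variable R : realType.

Lemma polar_convex n (K : set 'rV[R]_n) : cvx_set (polar_cone K).
Proof.
move=> x y t xK yK t0 t1 z zK; have := xK z zK; have := yK z zK.
rewrite !dotpE !mdotNl !mdotDl !mdotZl => h1 h2.
have t1' : 0 <= 1 - t by rewrite subr_ge0.
have := mulr_ge0 t0 h2; have := mulr_ge0 t1' h1; lra.
Qed.

Lemma dual_ball_finE n (b : R) (x : 'rV[R]_n) :
  dual_ball b%:E x = (enorm x <= 2 * b) :> Prop.
Proof. by rewrite /dual_ball /= -EFinM lee_fin. Qed.

Lemma dual_ball_pinfty n (x : 'rV[R]_n) : dual_ball +oo%E x.
Proof. by rewrite /dual_ball /= gt0_muley ?lte_fin // leey. Qed.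

Lemma dual_ball_convex n (B : \bar R) : (0 < B)%E -> cvx_set (@dual_ball R n B).
Proof.
case: B => [b||//] b0; last by move=> *; exact: dual_ball_pinfty.
move=> x y t; rewrite !dual_ball_finE => xb yb t0 t1.
have t1' : 0 <= 1 - t by rewrite subr_ge0.
apply: le_trans (enormD _ _) _; rewrite !enormZ !ger0_norm //.
have := ler_wpM2l t0 xb; have := ler_wpM2l t1' yb; lra.
Qed.

Lemma dual_ball0 n (B : \bar R) : (0 < B)%E -> @dual_ball R n B 0.
Proof.
case: B => [b||//] b0; last exact: dual_ball_pinfty.
by rewrite dual_ball_finE enorm0; move: b0; rewrite lte_fin => b0; lra.
Qed.

Lemma dual_ball_lim n (B : \bar R) (U : set_system nat) (u : nat -> 'rV[R]_n) A :
  (0 < B)%E -> ProperFilter U -> (\forall k \near U, dual_ball B (u k)) -> mx_lim U u A -> dual_ball B A.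
Proof.
case: B => [b||//] b0 PU ub uA; last exact: dual_ball_pinfty.
rewrite dual_ball_finE; apply: (cvgr_to_le (cvg_enorm uA)).
by apply: filterS ub => k; rewrite dual_ball_finE.
Qed.

Lemma consensus_rows N m (A : 'M[R]_(N, m)) i j : consensus A -> row i A = row j A.
Proof. by case=> y Ay; rewrite !Ay. Qed.

Lemma rows_consensus N m (A : 'M[R]_(N, m)) (i0 : 'I_N) :
  (forall i, row i A = row i0 A) -> consensus A.
Proof. by move=> h; exists (row i0 A). Qed.

Lemma consensus_lin N m (A B : 'M[R]_(N, m)) (s t : R) :
  consensus A -> consensus B -> consensus (s *: A + t *: B).
Proof. by move=> [a Aa] [b Bb]; exists (s *: a + t *: b) => i; rewrite !linearD !linearZ /= Aa Bb. Qed.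

Lemma consensusB N m (A B : 'M[R]_(N, m)) :
  consensus A -> consensus B -> consensus (A - B).
Proof. by move=> cA cB; rewrite -(scale1r A) -scaleN1r; exact: consensus_lin. Qed.

Lemma bounded_consensus_convex N m (B : \bar R) : (0 < B)%E ->
  cvx_set (@bounded_consensus R N m B).
Proof.
move=> B0 x y t [xc xb] [yc yb] t0 t1; split; first exact: consensus_lin.
by move=> i; rewrite linearD !linearZ /=; exact: dual_ball_convex.
Qed.

Lemma bounded_consensus_lim N m (B : \bar R) (U : set_system nat) (u : nat -> 'M[R]_(N, m)) A :
  (0 < N)%N -> (0 < B)%E -> ProperFilter U -> (forall k, bounded_consensus B (u k)) ->
  mx_lim U u A -> bounded_consensus B A.
Proof.
move=> N0 B0 PU uC uA; split.
  apply: (@rows_consensus _ _ _ (Ordinal N0)) => i; apply/rowP => j; rewrite !mxE.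
  have h := uA i j; have h' := uA (Ordinal N0) j.
  have e : (fun k => u k (Ordinal N0) j) = (fun k => u k i j).
    apply/funext => k; have := consensus_rows (Ordinal N0) i (uC k).1.
    by move=> /rowP /(_ j); rewrite !mxE.
  by rewrite e in h'; exact: (cvg_unique _ h h').
move=> i; apply: (@dual_ball_lim _ _ U (fun k => row i (u k)) (row i A)) => //.
  by apply: nearW => k; exact: (uC k).2.
exact: mx_lim_row.
Qed.

Lemma bounded_consensus_proj N m (B : \bar R) (w : 'M[R]_(N, m)) :
  (0 < N)%N -> (0 < B)%E -> exists p, is_proj (bounded_consensus B) w p.
Proof.
move=> N0 B0; apply: proj_exists; last first.
  by move=> U u A UU uC; apply: bounded_consensus_lim => //; exact: ultra_proper.
exists 0; split; first by exists 0 => i; rewrite linear0.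
by move=> i; rewrite linear0; exact: dual_ball0.
Qed.

End Sets.

Section Run.
Variables (R : realType) (I : instance R).
Hypothesis I_ok : admissible I.
Local Notation N := (nodes I).
Local Notation m := (cdim I).
Local Notation Ct := (@bounded_consensus R N m (bnd I)).

Let P_ok : problem_ok I. Proof. by case: I_ok. Qed.

Lemma nodes_gt0 : (0 < N)%N.
Proof.
case: I_ok => _ _ _ _ [[G0 _ + _ _] _].
by case: (nodes I) => //; rewrite mul0r ler10.
Qed.

Lemma bnd_gt0 : (0 < bnd I)%E. Proof. by case: I_ok => _ _ _ []. Qed.

Definition Phi (x : primal I) : R := \sum_i phi (x i).

Lemma row_gstack (x : primal I) i : row i (gstack x) = gcon I i (x i).
Proof. by apply/rowP => j; rewrite !mxE. Qed.

Lemma mdot_gstack (x : primal I) (A : 'M[R]_(N, m)) :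
  mdot (gstack x) A = \sum_i mdot (gcon I i (x i)) (row i A).
Proof. by rewrite mdot_rows; apply: eq_bigr => i _; rewrite row_gstack. Qed.

Lemma gstack_coupling (a b : primal I) (D : 'M[R]_(N, m)) :
  - mdot (gstack a - gstack b) D <=
  \sum_i Cg I i / 2 * enorm (a i - b i) ^+ 2 + \sum_i Cg I i / 2 * enorm (row i D) ^+ 2.
Proof.
rewrite mdotBl !mdot_gstack -sumrB -sumrN -big_split /=; apply: ler_sum => i _.
have := gcon_lip P_ok (a i) (b i) (- row i D); rewrite mdotNr enormN mdotBl.
have := mulr_ge0 (Cg_ge0 P_ok i) (sqr_ge0 (enorm (a i - b i) - enorm (row i D))).
by gen_vectors => C g1 g2 ? ?; lra.
Qed.

(** The last clause puts [vv] in the normal cone of [bounded_consensus] at [yy], so that the support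
    function of this set at [vv] equals [<vv, yy>]. Optimality is not asked: the rates test points
    that are not saddle points. *)
Definition comparator (u : primal I) (vv yy : 'M[R]_(N, m)) : Prop :=
  [/\ forall i, edom (rho I i) (u i), Ct yy, forall i, polar_cone (cone I) (row i yy) &
      forall z, Ct z -> mdot vv (z - yy) <= 0].

Variables (gamma beta : R).
Hypotheses (gamma0 : 0 < gamma) (beta0 : 0 <= beta).

Lemma tauV_gt0 (i : 'I_N) : 0 < (tau beta i : R)^-1.
Proof.
rewrite /tau invrK; have := Cg_ge0 P_ok i => C0.
by apply: ltr_pwDl => //; rewrite lt_max ltr01.
Qed.

Lemma tauVE (i : 'I_N) : (tau beta i : R)^-1 = Num.max 1 (Lf I i + beta * Lg I i) + Cg I i.
Proof. by rewrite /tau invrK. Qed.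

Lemma kappaVE (i : 'I_N) : (kappa gamma i : R)^-1 = Cg I i + 5 * gamma / 2.
Proof. by rewrite /kappa invrK. Qed.

Lemma kappa_gt0 (i : 'I_N) : 0 < (kappa gamma i : R).
Proof.
by rewrite /kappa invr_gt0; apply: ltr_wpDl; [exact: Cg_ge0 | rewrite divr_gt0 // mulr_gt0].
Qed.

Variables (xi : nat -> primal I) (v y : nat -> 'M[R]_(N, m)).
Hypothesis run : dpda gamma beta xi v y.

Definition wk k := gamma^-1 *: v k + y k.
Definition eps k : R := N%:R * Gam I * alpha I ^+ rounds I k.
Definition eta k : R := eps k * enorm (wk k).
(** Equal to [gamma *: wk k - (vv + gamma *: yy)], the rescaled deviation of the averager's input
    from its value at the comparison point. *)
Definition xk (vv yy : 'M[R]_(N, m)) k := v k - vv + gamma *: (y k - yy).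
Definition Err vv yy k : R := eta k * (enorm (xk vv yy k) + gamma * eta k).

Lemma eps_ge0 k : 0 <= eps k.
Proof.
case: I_ok => _ _ _ _ [[G0 /andP[a0 _] _ _ _] _].
by rewrite /eps !mulr_ge0 ?exprn_ge0 // ltW.
Qed.

Lemma eta_ge0 k : 0 <= eta k.
Proof. by rewrite mulr_ge0 ?eps_ge0 ?enorm_ge0. Qed.

(** By Moreau's identity the update of [v] is an inexact prox step for the support function of
    [bounded_consensus]. In this form the increment of [v] measures how far [y k] is from its
    average, which [cluster_averaging] exploits. *)
Lemma v_step k : v k.+1 - v k = gamma *: (y k - averager I k (wk k)).
Proof.
have [_ _ _ /(_ k)[-> _ _]] := run; rewrite -/(wk k).
move: (averager I k (wk k)) => r; rewrite /wk scalerDr scalerA mulfV ?gt_eqF // scale1r.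
by rewrite scalerBr; apply/matrixP => a b; rewrite !mxE; ring.
Qed.

Lemma averager_proj k : exists p, is_proj Ct (wk k) p /\
  enorm (averager I k (wk k) - p) <= eta k.
Proof.
have [p pP] := bounded_consensus_proj (wk k) nodes_gt0 bnd_gt0.
case: I_ok => _ _ _ _ [[_ _ _ _ /(_ k (wk k))[_ /(_ p pP) h]] _].
by exists p.
Qed.

(* The two orthogonality relations make the cross term of |X - gamma Y|^2
   favourable, so that this norm is at most |X + gamma Y| = |xk|. *)
Lemma averaging_ineq u vv yy k : comparator u vv yy ->
  - Err vv yy k <= mdot (averager I k (wk k) - yy) (v k.+1 - vv).
Proof.
move=> [_ yC _ vyP]; have [p [pP pe]] := averager_proj k.
have := proj_ineq (bounded_consensus_convex bnd_gt0) pP yC.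
have := vyP _ pP.1.
have -> : v k.+1 = v k + gamma *: (y k - averager I k (wk k)) by rewrite -v_step addrC subrK.
rewrite /Err; have := eta_ge0 k; move: (eta k) pe => e pe e0.
move: (averager I k (wk k)) pe => r pe h1 h2.
pose X := gamma *: (wk k - p) - vv; pose Y := p - yy; pose d := p - r.
have -> : r - yy = Y - d by apply/matrixP => a b; rewrite !mxE; ring.
have wE : gamma *: wk k = v k + gamma *: y k.
  by rewrite /wk scalerDr scalerA mulfV ?gt_eqF // scale1r.
have -> : v k + gamma *: (y k - r) - vv = X + gamma *: d.
  by rewrite /X /d !scalerBr wE; apply/matrixP => a b; rewrite !mxE; ring.
have xE : xk vv yy k = X + gamma *: Y.
  by rewrite /X /Y /xk !scalerBr wE; apply/matrixP => a b; rewrite !mxE; ring.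
have XY : 0 <= mdot X Y.
  rewrite /X mdotBl mdotZl; apply: addr_ge0; last by rewrite oppr_ge0.
  by rewrite mulr_ge0 ?(ltW gamma0) // -oppr_le0 -mdotNr opprB.
have de : enorm d <= e by rewrite /d enormC.
clearbody X Y d.
have nXY : enorm (gamma *: Y - X) <= enorm (xk vv yy k).
  rewrite -(@ler_pXn2r _ 2) ?nnegrE ?enorm_ge0 // xE enorm_sqrB enorm_sqrD.
  rewrite !(mdotC _ X) !mdotZr; have := mulr_ge0 (ltW gamma0) XY; lra.
have := cauchy_schwarzN d (gamma *: Y - X).
have -> : mdot (Y - d) (X + gamma *: d) =
    mdot X Y + mdot d (gamma *: Y - X) - gamma * enorm d ^+ 2.
  rewrite enorm_sqr !mdotBl !mdotDr !mdotNr !mdotZr (mdotC Y X) (mdotC Y d); ring.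
have d0 := enorm_ge0 d; have n0 := enorm_ge0 (gamma *: Y - X).
have h3 : enorm d * enorm (gamma *: Y - X) <= e * enorm (xk vv yy k) by exact: ler_pM.
have h4 : enorm d ^+ 2 <= e ^+ 2 by rewrite ler_pXn2r.
have := ler_wpM2l (ltW gamma0) h4; lra.
Qed.

End Run.

(** * The Lyapunov inequality *)

Section Step.
Variables (R : realType) (I : instance R).
Hypothesis I_ok : admissible I.
Local Notation N := (nodes I).
Local Notation m := (cdim I).
Local Notation Y := (polar_cone (cone I) `&` @dual_ball R m (bnd I)).

Let P_ok : problem_ok I. Proof. by case: I_ok. Qed.

Variables (gamma beta : R).
Hypotheses (gamma0 : 0 < gamma) (beta0 : 0 <= beta).
Variables (xi : nat -> primal I) (v y : nat -> 'M[R]_(N, m)).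
Hypothesis run : dpda gamma beta xi v y.
Local Notation Err := (@Err R I gamma v y).
Local Notation Gs k := (gstack (xi k)).

Definition qdiff (u : primal I) (vv : 'M[R]_(N, m)) k := Gs k - gstack u + (v k - vv).

(** The last term is not a square: it is what the extrapolations of [g] and [v] in the dual step
    leave behind, and it telescopes. [lyap_ge] shows that the squares dominate it. *)
Definition lyap (u : primal I) (vv yy : 'M[R]_(N, m)) k : R :=
  \sum_i (tau beta i)^-1 / 2 * enorm (xi k i - u i) ^+ 2
  + 1 / (2 * gamma) * enorm (v k - vv) ^+ 2
  + \sum_i (kappa gamma i)^-1 / 2 * enorm (row i (y k - yy)) ^+ 2
  + mdot (qdiff u vv k) (y k - yy).

(** Primal-dual gap of [Phi x - <g(x) + v, y> + sigma(v)], with [sigma] the support function of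
    [bounded_consensus], between the new iterate and a comparator, for which [sigma(vv) = <vv, yy>].
    The nonnegative, possibly infinite term [sigma(v k.+1) - <v k.+1, yy>] is left out. *)
Definition gap (u : primal I) (vv yy : 'M[R]_(N, m)) k : R :=
  Phi (xi k.+1) - mdot (Gs k.+1) yy - (Phi u - mdot (gstack u) yy)
  + mdot (gstack u + vv) (y k.+1 - yy).

(* start need not lie in the domain of rho: at the first step only the descent
   estimate with constant Lf instead of Lf / 2 is available. *)
Definition start_defect : R :=
  \sum_i Lf I i / 2 * enorm (xi 1%N i - xi 0%N i) ^+ 2.

Lemma xi_edom k i : edom (rho I i) (xi k.+1 i).
Proof.
have [_ _ _ /(_ k)[_ /(_ i) zP _]] := run.
apply: (node_edom P_ok _ zP); by rewrite -invr_gt0; exact: tauV_gt0.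
Qed.

Lemma xi_fdom k i : fdom I i (xi k i).
Proof.
case: k => [|k]; last by apply: edom_fdom => //; exact: xi_edom.
by have [-> _ _ _] := run; case: I_ok.
Qed.

Lemma y_proj k i : Y (row i (y k)).
Proof.
case: k => [|k]; last by have [_ _ _ /(_ k)[_ _ /(_ i)[]]] := run.
have [_ _ -> _] := run; rewrite linear0; split; last exact: dual_ball0 (bnd_gt0 I_ok).
by move=> z zK; rewrite dotpE oppr0 mdot0l.
Qed.

Lemma node_step k i u : edom (rho I i) u -> enorm (row i (y k)) <= beta ->
  phi (xi k.+1 i) - mdot (gcon I i (xi k.+1 i)) (row i (y k)) <=
  phi u - mdot (gcon I i u) (row i (y k))
   + (tau beta i)^-1 / 2 * (enorm (xi k i - u) ^+ 2 - enorm (xi k.+1 i - u) ^+ 2)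
   - Cg I i / 2 * enorm (xi k.+1 i - xi k i) ^+ 2
   + (if k == 0%N then Lf I i / 2 * enorm (xi 1%N i - xi 0%N i) ^+ 2 else 0).
Proof.
move=> ud yb; have [_ _ _ /(_ k)[_ /(_ i) zP _]] := run.
have t0 : 0 < tau beta i by rewrite -invr_gt0; exact: tauV_gt0.
have tt : Lf I i + beta * Lg I i + Cg I i <= (tau beta i)^-1.
  by rewrite tauVE lerD2r le_max lexx orbT.
have yK : polar_cone (cone I) (row i (y k)) by have [] := y_proj k i.
have := node_ineq P_ok t0 zP (c := if k == 0%N then Lf I i else 0) (xi_fdom k i) ud yK yb tt.
rewrite (enormC u) (enormC u) => h; apply: le_trans (h _) _; last first.
  by case: eqP => [->|_] //; rewrite mul0r mul0r.
case: k {h yK yb zP} => [|k] /=.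
  have -> : (Lf I i + Lf I i) / 2 = Lf I i by move: (Lf I i) => L; lra.
  by apply: fsm_descent_weak => //; exact: xi_fdom.
by rewrite add0r; apply: fsm_descent => //; exact: xi_edom.
Qed.

Lemma primal_step k (u : primal I) : (forall i, edom (rho I i) (u i)) ->
  (forall i, enorm (row i (y k)) <= beta) ->
  Phi (xi k.+1) - mdot (Gs k.+1) (y k) <= Phi u - mdot (gstack u) (y k)
   + (\sum_i (tau beta i)^-1 / 2 * enorm (xi k i - u i) ^+ 2
      - \sum_i (tau beta i)^-1 / 2 * enorm (xi k.+1 i - u i) ^+ 2)
   - \sum_i Cg I i / 2 * enorm (xi k.+1 i - xi k i) ^+ 2
   + (if k == 0%N then start_defect else 0).
Proof.
move=> ud yb.
have -> : (if k == 0%N then start_defect else 0) =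
   \sum_i (if k == 0%N then Lf I i / 2 * enorm (xi 1%N i - xi 0%N i) ^+ 2 else 0).
  by case: eqP => _ //; rewrite big1.
rewrite !mdot_gstack /Phi -!sumrB -big_split -sumrB -big_split /=; apply: ler_sum => i _.
by rewrite -mulrBr; exact: node_step.
Qed.

Lemma dual_step k (yy : 'M[R]_(N, m)) : (forall i, Y (row i yy)) ->
  mdot (2 *: Gs k.+1 - Gs k + 2 *: v k.+1 - v k) (y k.+1 - yy) <=
    \sum_i (kappa gamma i)^-1 / 2 * enorm (row i (y k - yy)) ^+ 2
    - \sum_i (kappa gamma i)^-1 / 2 * enorm (row i (y k.+1 - yy)) ^+ 2
    - \sum_i (kappa gamma i)^-1 / 2 * enorm (row i (y k.+1 - y k)) ^+ 2.
Proof.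
move=> yyY; rewrite mdot_rows -!sumrB; apply: ler_sum => i _.
have [_ _ _ /(_ k)[_ _ /(_ i) pP]] := run.
have cY : cvx_set Y.
  move=> a b t [aK aB] [bK bB] t0 t1; split; first exact: polar_convex.
  by apply: dual_ball_convex => //; exact: bnd_gt0.
have := proj_ineq cY pP (yyY i).
have -> : row i (2 *: Gs k.+1 - Gs k + 2 *: v k.+1 - v k) =
  2 *: gcon I i (xi k.+1 i) - gcon I i (xi k i) + 2 *: row i (v k.+1) - row i (v k).
  by apply/rowP => j; rewrite !mxE.
move: (_ - row i (v k)) => s.
have k0 := kappa_gt0 I_ok gamma0 i.
have -> : row i (y k.+1 - yy) = row i (y k.+1) - row i yy by rewrite linearB.
have -> : row i (y k.+1 - y k) = row i (y k.+1) - row i (y k) by rewrite linearB.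
have -> : row i (y k - yy) = row i (y k) - row i yy by rewrite linearB.
move: (row i (y k.+1)) (row i (y k)) (row i yy) => a b c h.
have tp := enorm_three_points c a b.
rewrite -(ler_pM2l k0) !mulrBr !mulrA !mulfV ?gt_eqF // !mul1r.
move: h tp; rewrite (enormC b a) (enormC b c) (enormC c) => h tp; move: h tp.
have -> : mdot (b - kappa gamma i *: s - a) (c - a) =
    kappa gamma i * mdot s (a - c) - mdot (a - c) (b - a).
  by rewrite !mdotBl !mdotBr !mdotZl (mdotC b a) (mdotC c a) (mdotC c b); ring.
move: (kappa gamma i * _) => K h tp; rewrite tp in h; rewrite -!mulrA -!expr2; lra.
Qed.

Lemma comparator_dual u vv yy : comparator u vv yy -> forall i, Y (row i yy).
Proof. by move=> [_ [_ yB] yK _] i; split; [exact: yK | exact: yB]. Qed.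

Lemma weighted_row_sum (D : 'M[R]_(N, m)) :
  \sum_i (kappa gamma i)^-1 / 2 * enorm (row i D) ^+ 2 =
  \sum_i Cg I i / 2 * enorm (row i D) ^+ 2 + 5 / 4 * gamma * enorm D ^+ 2.
Proof.
rewrite enorm_rows mulr_sumr -big_split /=; apply: eq_bigr => i _.
by rewrite kappaVE; move: (Cg I i) => C; lra.
Qed.

Lemma cross_young (A B : 'M[R]_(N, m)) :
  - mdot A B <= 1 / (4 * gamma) * enorm A ^+ 2 + gamma * enorm B ^+ 2.
Proof.
have g2 : 0 < (2 * gamma)^-1 by rewrite invr_gt0 mulr_gt0.
have := mdot_young A B g2.
have -> : (2 * gamma)^-1 / 2 = 1 / (4 * gamma) by field; rewrite gt_eqF.
by have -> : 1 / (2 / (2 * gamma)) = gamma by field; rewrite gt_eqF.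
Qed.

(** The prox step in [v] provides the squared increment of [v] over [2 gamma], the dual step
    [5/4 gamma] times that of [y]. [cross_young] spends [1/4] over [gamma] and [gamma] of them, and
    the rest stays on the left. The [Cg / 2] parts of the primal and dual steps are used up by
    [gstack_coupling]. *)
Lemma lyapunov_step k u vv yy : comparator u vv yy ->
  (forall i, enorm (row i (y k)) <= beta) ->
  gap u vv yy k
  + (gamma / 4 * enorm (y k.+1 - y k) ^+ 2
     + 1 / (4 * gamma) * enorm (v k.+1 - v k) ^+ 2)
  <= lyap u vv yy k - lyap u vv yy k.+1 + Err vv yy k
     + (if k == 0%N then start_defect else 0).
Proof.
move=> cmp yb; have [ud _ _ _] := cmp.
have hA := primal_step ud yb.
have hB := dual_step k (comparator_dual cmp).
have hD := averaging_ineq I_ok gamma0 run k cmp.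
have hG := gstack_coupling I_ok (xi k.+1) (xi k) (y k.+1 - y k).
have hV := cross_young (v k.+1 - v k) (y k.+1 - y k).
have hC : mdot (averager I k (wk gamma v y k) - y k) (v k.+1 - vv) =
   1 / (2 * gamma) * enorm (v k - vv) ^+ 2 - 1 / (2 * gamma) * enorm (v k.+1 - vv) ^+ 2
   - 1 / (2 * gamma) * enorm (v k.+1 - v k) ^+ 2.
  have vs := v_step gamma0 run k.
  have -> : averager I k (wk gamma v y k) - y k = - (gamma^-1 *: (v k.+1 - v k)).
    by rewrite vs scalerA mulVf ?gt_eqF // scale1r opprB.
  have -> : v k - vv = (v k.+1 - vv) - (v k.+1 - v k) by apply/matrixP => a b; rewrite !mxE; ring.
  rewrite (enorm_sqrB (v k.+1 - vv)) mdotNl mdotZl (mdotC (v k.+1 - v k)); field.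
  by rewrite gt_eqF.
have vh : 1 / (2 * gamma) = 2 * (1 / (4 * gamma)) by field; rewrite gt_eqF.
rewrite /gap /lyap /qdiff; move: hA hB hD hG hV hC; rewrite !weighted_row_sum vh.
move: (Err _ _ k) (if k == 0%N then _ else _) => E X0.
move: (averager I k _) (Gs k.+1) (Gs k) (gstack u) (v k.+1) (v k) (y k.+1) (y k).
move: (Phi (xi k.+1)) (Phi u).
move: (\sum_i _ * enorm (xi k i - u i) ^+ 2) (\sum_i _ * enorm (xi k.+1 i - u i) ^+ 2).
move: (\sum_i _ * enorm (xi k.+1 i - xi k i) ^+ 2).
move=> S1 S2 S3 P1 P2 r G1 G0 Gu v1 v0 y1 y0.
move: (\sum_i _ * enorm (row i (y1 - y0)) ^+ 2) (\sum_i _ * enorm (row i (y1 - yy)) ^+ 2).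
move: (\sum_i _ * enorm (row i (y0 - yy)) ^+ 2) => T1 T2 T3.
move: (1 / (4 * gamma)) => g4.
move: (enorm (v1 - v0) ^+ 2) (enorm (v1 - vv) ^+ 2) (enorm (v0 - vv) ^+ 2) => e1 e2 e3.
move: (enorm (y1 - y0) ^+ 2) (enorm (y1 - yy) ^+ 2) (enorm (y0 - yy) ^+ 2) => e4 e5 e6.
rewrite !mdotDE !mdotZl !(mdotC yy) !(mdotC y0); lra.
Qed.

End Step.

(** * Saddle points and the size of the Lyapunov function *)

Section LyapunovBounds.
Variables (R : realType) (I : instance R).
Hypothesis I_ok : admissible I.
Local Notation N := (nodes I).
Local Notation m := (cdim I).
Local Notation Y := (polar_cone (cone I) `&` @dual_ball R m (bnd I)).

Let P_ok : problem_ok I. Proof. by case: I_ok. Qed.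

Variables (gamma beta : R).
Hypotheses (gamma0 : 0 < gamma) (beta0 : 0 <= beta).
Variables (xi : nat -> primal I) (v y : nat -> 'M[R]_(N, m)).
Hypothesis run : dpda gamma beta xi v y.
Local Notation lyap := (@lyap R I gamma beta xi v y).
Local Notation gap := (@gap R I xi y).

(** Optimality in [v] (inside [comparator]), node by node in [xi], and in [y] over [Y]. Written as
    inequalities so that cluster points inherit them by passage to the limit. *)
Definition saddle (u : primal I) (vv yy : 'M[R]_(N, m)) : Prop :=
  [/\ comparator u vv yy,
      (forall i x, edom (rho I i) x ->
         phi (u i) - mdot (gcon I i (u i)) (row i yy) <=
         phi x - mdot (gcon I i x) (row i yy)) &
      (forall z, (forall i, Y (row i z)) -> 0 <= mdot (gstack u + vv) (z - yy))].

Lemma gap_ge0 u vv yy k : saddle u vv yy -> 0 <= gap u vv yy k.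
Proof.
move=> [_ h1 h2]; apply: addr_ge0; last by apply: h2; exact: y_proj run _.
rewrite subr_ge0 !mdot_gstack /Phi -!sumrB; apply: ler_sum => i _; apply: h1.
exact: (xi_edom I_ok run).
Qed.

(** The cross term is absorbed with the same two Young inequalities as in [lyapunov_step]. The 1
    inside the maximum defining [tau] guarantees the coefficient [1/2] of the primal distance, even
    where [Lf] and [Lg] vanish. *)
Lemma lyap_ge u vv yy k :
  \sum_i 2^-1 * enorm (xi k i - u i) ^+ 2 + 1 / (4 * gamma) * enorm (v k - vv) ^+ 2
  + gamma / 4 * enorm (y k - yy) ^+ 2 <= lyap u vv yy k.
Proof.
have hG := gstack_coupling I_ok (xi k) u (y k - yy).
have hV := cross_young gamma0 (v k - vv) (y k - yy).
have vh : 1 / (2 * gamma) = 2 * (1 / (4 * gamma)) by field; rewrite gt_eqF.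
rewrite /(lyap _ _ _ _) /qdiff weighted_row_sum vh mdotDl.
have hT : \sum_i 2^-1 * enorm (xi k i - u i) ^+ 2 +
   \sum_i Cg I i / 2 * enorm (xi k i - u i) ^+ 2 <=
   \sum_i (tau beta i)^-1 / 2 * enorm (xi k i - u i) ^+ 2.
  rewrite -big_split; apply: ler_sum => i _ /=; rewrite -mulrDl ler_wpM2r ?sqr_ge0 //.
  have : 1 <= Num.max 1 (Lf I i + beta * Lg I i) by rewrite le_max lexx.
  by rewrite tauVE; move: (Num.max _ _) (Cg I i) => a C; lra.
move: hG hV hT.
move: (\sum_i _ * enorm (xi k i - u i) ^+ 2) (\sum_i _ * enorm (xi k i - u i) ^+ 2).
move: (\sum_i (tau beta i)^-1 / 2 * _) (\sum_i _ * enorm (row i _) ^+ 2).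
move: (mdot _ (y k - yy)) (mdot _ (y k - yy)) (1 / (4 * gamma)).
move: (enorm _ ^+ 2) (enorm _ ^+ 2) => a b c d e f g h i; lra.
Qed.

Lemma lyap_ge0 u vv yy k : 0 <= lyap u vv yy k.
Proof.
apply: le_trans (lyap_ge u vv yy k); rewrite !addr_ge0 //.
- by apply: sumr_ge0 => i _; rewrite mulr_ge0 ?sqr_ge0.
- by rewrite mulr_ge0 ?sqr_ge0 // divr_ge0 // mulr_ge0 // ltW.
- by rewrite mulr_ge0 ?sqr_ge0 // divr_ge0 // ltW.
Qed.

Lemma v_le_lyap u vv yy k : enorm (v k - vv) ^+ 2 <= 4 * gamma * lyap u vv yy k.
Proof.
have := lyap_ge u vv yy k.
have s0 : 0 <= \sum_i 2^-1 * enorm (xi k i - u i) ^+ 2.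
  by apply: sumr_ge0 => i _; rewrite mulr_ge0 ?sqr_ge0.
have y0 : 0 <= gamma / 4 * enorm (y k - yy) ^+ 2.
  by rewrite mulr_ge0 ?sqr_ge0 // divr_ge0 // ltW.
move=> h; have {}h : 1 / (4 * gamma) * enorm (v k - vv) ^+ 2 <= lyap u vv yy k by lra.
by move: h; rewrite mul1r mulrC ler_pdivrMr ?mulr_gt0 // mulrC.
Qed.

Lemma y_le_lyap u vv yy k : gamma * enorm (y k - yy) ^+ 2 <= 4 * lyap u vv yy k.
Proof.
have := lyap_ge u vv yy k.
have s0 : 0 <= \sum_i 2^-1 * enorm (xi k i - u i) ^+ 2.
  by apply: sumr_ge0 => i _; rewrite mulr_ge0 ?sqr_ge0.
have v0 : 0 <= 1 / (4 * gamma) * enorm (v k - vv) ^+ 2.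
  by rewrite mulr_ge0 ?sqr_ge0 // divr_ge0 // mulr_ge0 // ltW.
lra.
Qed.

Lemma xi_le_lyap u vv yy k i : enorm (xi k i - u i) ^+ 2 <= 2 * lyap u vv yy k.
Proof.
have := lyap_ge u vv yy k.
have y0 : 0 <= gamma / 4 * enorm (y k - yy) ^+ 2.
  by rewrite mulr_ge0 ?sqr_ge0 // divr_ge0 // ltW.
have v0 : 0 <= 1 / (4 * gamma) * enorm (v k - vv) ^+ 2.
  by rewrite mulr_ge0 ?sqr_ge0 // divr_ge0 // mulr_ge0 // ltW.
rewrite (bigD1 i) //=; set s := \sum_(_ | _) _.
have s0 : 0 <= s by apply: sumr_ge0 => j _; rewrite mulr_ge0 ?sqr_ge0.
lra.
Qed.

Lemma xk_le_lyap u vv yy k : enorm (xk gamma v y vv yy k) ^+ 2 <= 8 * gamma * lyap u vv yy k.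
Proof.
have := lyap_ge u vv yy k.
have s0 : 0 <= \sum_i 2^-1 * enorm (xi k i - u i) ^+ 2.
  by apply: sumr_ge0 => i _; rewrite mulr_ge0 ?sqr_ge0.
rewrite /xk; move: (v k - vv) (y k - yy) (lyap _ _ _ _) => a b L h.
have {}h : 1 / (4 * gamma) * enorm a ^+ 2 + gamma / 4 * enorm b ^+ 2 <= L by lra.
have h2 : enorm (a + gamma *: b) ^+ 2 <= 2 * enorm a ^+ 2 + 2 * enorm (gamma *: b) ^+ 2.
  have := sqr_ge0 (enorm (a - gamma *: b)); rewrite enorm_sqrB enorm_sqrD; lra.
apply: le_trans h2 _; rewrite enormZ gtr0_norm // exprMn.
have := ler_wpM2l (ltW gamma0) h; rewrite mulrDr.
have -> : gamma * (1 / (4 * gamma) * enorm a ^+ 2) = enorm a ^+ 2 / 4.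
  by field; rewrite gt_eqF.
lra.
Qed.

Lemma lyap_start u vv yy : lyap u vv yy 0 <=
  \sum_i (1 + Lf I i + Cg I i + beta * Lg I i) * enorm (u i - start I i) ^+ 2
  + gamma^-1 * enorm vv ^+ 2
  + \sum_i (Cg I i + 9 / 4 * gamma) * enorm (row i yy) ^+ 2.
Proof.
have [x0 v0 y0 _] := run.
have hG := gstack_coupling I_ok (start I) u yy.
have hV := cross_young gamma0 (- vv) yy.
have vh : 1 / (2 * gamma) = 2 * (1 / (4 * gamma)) by field; rewrite gt_eqF.
have vh' : gamma^-1 = 4 * (1 / (4 * gamma)) by field; rewrite gt_eqF.
rewrite /(lyap _ _ _ _) /qdiff x0 v0 y0 !sub0r enormN weighted_row_sum vh vh' enormN mdotNr mdotDl.
have hT : \sum_i (tau beta i)^-1 / 2 * enorm (start I i - u i) ^+ 2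
   + \sum_i Cg I i / 2 * enorm (start I i - u i) ^+ 2 <=
   \sum_i (1 + Lf I i + Cg I i + beta * Lg I i) * enorm (u i - start I i) ^+ 2.
  rewrite -big_split; apply: ler_sum => i _ /=; rewrite -mulrDl enormC ler_wpM2r ?sqr_ge0 //.
  have L0 := Lf_ge0 P_ok i; have B0 := mulr_ge0 beta0 (Lg_ge0 P_ok i).
  have : Num.max 1 (Lf I i + beta * Lg I i) <= 1 + (Lf I i + beta * Lg I i).
    by rewrite ge_max lerDl addr_ge0 //= lerDr.
  by rewrite tauVE; move: (Num.max _ _) (Cg I i) L0 B0; gen_vectors => L G a C; lra.
have hY : \sum_i Cg I i / 2 * enorm (row i (- yy)) ^+ 2 +
   \sum_i Cg I i / 2 * enorm (row i yy) ^+ 2 + 9 / 4 * gamma * enorm yy ^+ 2 =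
   \sum_i (Cg I i + 9 / 4 * gamma) * enorm (row i yy) ^+ 2.
  rewrite enorm_rows mulr_sumr -!big_split; apply: eq_bigr => i _ /=.
  by rewrite linearN /= enormN; move: (Cg I i) => C; lra.
rewrite -hY; move: hG hV hT; rewrite enormN.
have v0' : 0 <= 1 / (4 * gamma) * enorm vv ^+ 2.
  by rewrite mulr_ge0 ?sqr_ge0 // divr_ge0 // mulr_ge0 // ltW.
move: v0'; move: (1 / (4 * gamma)) (enorm vv ^+ 2) (enorm yy ^+ 2) => g4 V2 Y2.
move: (mdot _ yy) (mdot _ yy) => a b.
move: (\sum_i _ * enorm (row i yy) ^+ 2) (\sum_i _ * enorm (row i (- yy)) ^+ 2) => S1 S2.
move: (\sum_i _ * enorm (start I i - u i) ^+ 2) (\sum_i _ * enorm (start I i - u i) ^+ 2) => S3 S4.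
move: (\sum_i (1 + _ + _ + _) * _) => S5; lra.
Qed.

Lemma start_defect_le u vv yy : saddle u vv yy ->
  start_defect xi <= 3 / 2 * (\sum_i Lf I i * enorm (u i - start I i) ^+ 2)
   + \sum_i Cg I i * enorm (row i yy) ^+ 2.
Proof.
move=> [[ud _ _ _] h _]; rewrite mulr_sumr -big_split; apply: ler_sum => i _ /=.
have [x0 _ y0 /(_ 0%N)[_ /(_ i) zP _]] := run; rewrite x0 y0 linear0 mul0mx subr0 in zP.
have t0 : 0 < tau beta i by rewrite -invr_gt0; exact: tauV_gt0.
have L0 := Lf_ge0 P_ok i; have C0 := Cg_ge0 P_ok i; have G0 := Lg_ge0 P_ok i.
have hL : Lf I i <= (tau beta i)^-1.
  rewrite tauVE; apply: (@le_trans _ _ (Lf I i + beta * Lg I i)).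
    by rewrite lerDl mulr_ge0.
  by apply: ler_wpDr => //; rewrite le_max lexx orbT.
have hC : Cg I i <= (tau beta i)^-1.
  by rewrite tauVE lerDr le_max ler01.
have sd : fdom I i (start I i) by case: I_ok.
have := first_step_bound P_ok t0 zP sd (ud i) hL hC (h i); rewrite x0.
by gen_vectors => C L; lra.
Qed.

End LyapunovBounds.

(** * Cones, consensus and saddle points *)

Section Distances.
Variable R : realType.

Lemma eucl_dist_proj p q (S : set 'M[R]_(p, q)) x z :
  is_proj S x z -> eucl_dist S x = enorm (x - z).
Proof.
move=> [Sz zP]; apply/eqP; rewrite eq_le; apply/andP; split.
  by apply: ge_inf; [exists 0 => _ [s _ <-]; exact: enorm_ge0 | exists z].
by apply: lb_le_inf; [exists (enorm (x - z)); exists z | move=> _ [s Ss <-]; exact: zP].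
Qed.

(** [a] is the inverse norm, or 0 when [A = 0]; asking for norm at most 1 covers both cases. *)
Lemma unit_vector p q (A : 'M[R]_(p, q)) :
  exists a : R, [/\ 0 <= a, enorm (a *: A) <= 1 & a * enorm A ^+ 2 = enorm A].
Proof.
have [/enorm_eq0->|A0] := eqVneq (enorm A) 0.
  by exists 0; rewrite scale0r enorm0 ler01 mul0r.
exists (enorm A)^-1; have A1 : 0 <= (enorm A)^-1 by rewrite invr_ge0 enorm_ge0.
by rewrite enormZ ger0_norm // mulVf // expr2 mulKf.
Qed.

Section Cone.
Variables (n : nat) (K : set 'rV[R]_n).
Hypotheses (K_closed : closed K) (K_cone : convex_cone K).

Lemma cone_convex_set : cvx_set K.
Proof.
case: K_cone => _ KD KZ x y t xK yK t0 t1.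
by apply: KD; apply: KZ => //; rewrite subr_ge0.
Qed.

(** Moreau decomposition. The projection inequality tested at [z + k] gives polarity, and tested at
    [z + z] and 0 gives orthogonality. *)
Lemma cone_proj x : exists z,
  [/\ is_proj K x z, polar_cone K (x - z) & mdot (x - z) z = 0].
Proof.
have [K0 KD KZ] := K_cone.
have [z zP] : exists z, is_proj K x z.
  apply: proj_exists; first by exists 0.
  move=> U u A UU uK uA; have PU : ProperFilter U := @ultra_proper _ _ UU.
  by apply: (closed_mx_lim K_closed _ uA); exact: nearW.
have zK := zP.1; exists z; split=> //.
- move=> k kK; rewrite dotpE mdotNl oppr_ge0.
  have := proj_ineq cone_convex_set zP (KD _ _ zK kK).
  by have -> : z + k - z = k by rewrite addrC addKr.
- have h1 := proj_ineq cone_convex_set zP (KD _ _ zK zK).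
  have h2 := proj_ineq cone_convex_set zP K0.
  move: h1 h2; rewrite addrK sub0r mdotNr => h1 h2.
  by apply/eqP; rewrite eq_le h1 -oppr_le0 h2.
Qed.

Lemma polarP y k : polar_cone K y -> K k -> mdot y k <= 0.
Proof. by move=> yK kK; have := yK k kK; rewrite dotpE mdotNl oppr_ge0. Qed.

Lemma polar_dist y x : polar_cone K y -> mdot y x <= enorm y * eucl_dist K x.
Proof.
move=> yK; have [z [zP _ _]] := cone_proj x; rewrite (eucl_dist_proj zP).
have := cauchy_schwarz y (x - z); have := polarP yK zP.1.
rewrite mdotBr; lra.
Qed.

Lemma dist_direction x : exists d,
  [/\ polar_cone K d, enorm d <= 1 & mdot d x = eucl_dist K x].
Proof.
have [z [zP zK z0]] := cone_proj x; rewrite (eucl_dist_proj zP).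
have [a [a0 a1 aE]] := unit_vector (x - z).
exists (a *: (x - z)); split=> //.
  move=> k kK; have := zK k kK; rewrite !dotpE !mdotNl mdotZl => h.
  by rewrite -mulrN mulr_ge0.
by rewrite mdotZl -aE enorm_sqr [in RHS]mdotBr z0 subr0.
Qed.

(** Testing with the polar component of [x] forces that component to vanish. *)
Lemma bipolar x : (forall y, polar_cone K y -> mdot y x <= 0) -> K x.
Proof.
move=> h; have [z [zP zK z0]] := cone_proj x.
have h1 : enorm (x - z) ^+ 2 <= 0 by rewrite enorm_sqr mdotBr z0 subr0; exact: h.
have : enorm (x - z) = 0.
  by apply/eqP; rewrite -sqrf_eq0 eq_le h1 sqr_ge0.
by move=> /enorm_eq0/eqP; rewrite subr_eq0 => /eqP ->; exact: zP.1.
Qed.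

Lemma polar_scale y (a : R) : 0 <= a -> polar_cone K y -> polar_cone K (a *: y).
Proof.
move=> a0 yK k kK; have := yK k kK; rewrite !dotpE !mdotNl mdotZl => h.
by rewrite -mulrN mulr_ge0.
Qed.

Lemma polar_add y y' : polar_cone K y -> polar_cone K y' -> polar_cone K (y + y').
Proof.
move=> yK yK' k kK; have := yK k kK; have := yK' k kK.
by rewrite !dotpE !mdotNl mdotDl => h1 h2; lra.
Qed.

End Cone.

Section Consensus.
Variables N m : nat.
Hypothesis N0 : (0 < N)%N.
Implicit Types A : 'M[R]_(N, m).

Definition row_sum A : 'rV[R]_m := \sum_i row i A.
Definition average A : 'M[R]_(N, m) := replicate N (N%:R^-1 *: row_sum A).

Lemma row_replicate (y : 'rV[R]_m) (i : 'I_N) : row i (replicate N y) = y.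
Proof. by apply/rowP => j; rewrite !mxE. Qed.

Lemma replicate_consensus (y : 'rV[R]_m) : consensus (replicate N y).
Proof. by exists y => i; rewrite row_replicate. Qed.

Lemma consensusE A : consensus A -> exists y, A = replicate N y.
Proof.
by case=> y Ay; exists y; apply/row_matrixP => i; rewrite row_replicate Ay.
Qed.

Lemma mdot_replicate A (y : 'rV[R]_m) : mdot A (replicate N y) = mdot (row_sum A) y.
Proof. by rewrite mdot_rows mdot_suml; apply: eq_bigr => i _; rewrite row_replicate. Qed.

Lemma row_sum_replicate (y : 'rV[R]_m) : row_sum (replicate N y) = N%:R *: y.
Proof.
by rewrite /row_sum; under eq_bigr do rewrite row_replicate; rewrite sumr_const card_ord scaler_nat.
Qed.

Lemma row_sumB A B : row_sum (A - B) = row_sum A - row_sum B.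
Proof. by rewrite /row_sum -sumrB; apply: eq_bigr => i _; rewrite linearB. Qed.

Lemma average_orth A C : consensus C -> mdot (A - average A) C = 0.
Proof.
move=> /consensusE[y ->]; rewrite mdot_replicate row_sumB row_sum_replicate scalerA.
by rewrite mulfV ?pnatr_eq0 -?lt0n // scale1r subrr mdot0l.
Qed.

Lemma average_proj A : is_proj (@consensus R N m) A (average A).
Proof.
split; first exact: replicate_consensus.
move=> s sC; rewrite -(@ler_pXn2r _ 2) ?nnegrE ?enorm_ge0 //.
have -> : A - s = (A - average A) + (average A - s) by rewrite addrA subrK.
rewrite (enorm_sqrD (A - average A)) average_orth ?mulr0 ?addr0 ?lerDl ?sqr_ge0 //.
by apply: consensusB => //; exact: replicate_consensus.
Qed.

Lemma consensus_direction A : exists d,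
  [/\ forall C, consensus C -> mdot d C = 0, enorm d <= 1 & mdot d A = eucl_dist (@consensus R N m) A].
Proof.
rewrite (eucl_dist_proj (average_proj A)).
have [a [a0 a1 aE]] := unit_vector (A - average A).
exists (a *: (A - average A)); split=> //.
  by move=> C CC; rewrite mdotZl average_orth // mulr0.
have h : mdot (A - average A) (average A) = 0.
  by apply: average_orth; exact: replicate_consensus.
by rewrite mdotZl -aE enorm_sqr [in RHS]mdotBr h subr0.
Qed.

End Consensus.
End Distances.

(** * Optimal pairs and the duality gap *)

Section OptimalPairs.
Variables (R : realType) (I : instance R).
Hypothesis I_ok : admissible I.
Local Notation m := (cdim I).

Let P_ok : problem_ok I. Proof. by case: I_ok. Qed.
Let zero_gap : primal_value I = dual_value I. Proof. by case: I_ok => _ _ []. Qed.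

Lemma objective_fin (x : primal I) : (forall i, edom (rho I i) (x i)) ->
  objective x = (Phi x)%:E.
Proof.
move=> xd; rewrite /objective /Phi -sumEFin; apply: eq_bigr => i _.
by rewrite EFinD edom_fineK //; exact: rho_proper.
Qed.

Lemma objective_edom (x : primal I) : (objective x < +oo)%E ->
  forall i, edom (rho I i) (x i).
Proof.
move=> xo i; rewrite /edom /= ltey; apply/eqP => ri; move: xo.
suff -> : objective x = +oo%E by rewrite ltxx.
apply/esum_eqyP => [j _|].
  rewrite gt_eqF //; have [h _] := rho_proper P_ok j.
  by case: (rho I j (x j)) (h (x j)) => [r _|_|//]; [rewrite -EFinD ltNyr | rewrite addye].
by exists i; rewrite mem_index_enum ri addye.
Qed.

Lemma dual_function_le (ys : 'rV[R]_m) (x : primal I) : (forall i, edom (rho I i) (x i)) ->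
  (dual_function ys <= (Phi x - mdot (gsum x) ys)%:E)%E.
Proof.
move=> xd; apply: ereal_inf_lbound; exists x => //.
by rewrite objective_fin // dotpE EFinB.
Qed.

Lemma dom_point : exists x : primal I, forall i, edom (rho I i) (x i).
Proof.
have h i : exists x, edom (rho I i) x by have [_] := rho_proper P_ok i.
by exists (fun i => projT1 (cid (h i))) => i; exact: (projT2 (cid (h i))).
Qed.

(** The zero gap gives [objective xs = dual_function ys]. Evaluating the dual function at a domain
    point yields finiteness, and at [xs] itself complementarity. *)
Lemma optimal_pair_facts (xs : primal I) ys : optimal_pair xs ys ->
  [/\ forall i, edom (rho I i) (xs i),
      forall x, (forall i, edom (rho I i) (x i)) -> Phi xs <= Phi x - mdot (gsum x) ys,
      mdot (gsum xs) ys = 0, cone I (- gsum xs) & polar_cone (cone I) ys].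
Proof.
move=> [[xf xo] [yK yo]].
have oE : objective xs = dual_function ys by rewrite xo yo zero_gap.
have [x0 x0d] := dom_point.
have xd : forall i, edom (rho I i) (xs i).
  by apply: objective_edom; rewrite oE; apply: le_lt_trans (dual_function_le ys x0d) _; rewrite ltry.
have h x : (forall i, edom (rho I i) (x i)) -> Phi xs <= Phi x - mdot (gsum x) ys.
  by move=> /(dual_function_le ys); rewrite -oE objective_fin // lee_fin.
split=> //; have := h _ xd; have := polarP yK xf.
by rewrite mdotNr (mdotC ys) => h1 h2; apply/eqP; rewrite eq_le -oppr_le0; apply/andP; split; lra.
Qed.

(** Closes the chain from [Phi xs] to the dual function, the dual value, the primal value and back
    to [Phi xs]; the link between the two values is the assumed zero gap. *)
Lemma optimal_pair_intro (xs : primal I) ys :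
  (forall i, edom (rho I i) (xs i)) ->
  (forall x : primal I, (forall i, edom (rho I i) (x i)) -> Phi xs <= Phi x - mdot (gsum x) ys) ->
  cone I (- gsum xs) -> polar_cone (cone I) ys -> optimal_pair xs ys.
Proof.
move=> xd h xf yK.
have d1 : ((Phi xs)%:E <= dual_function ys)%E.
  apply: le_ereal_inf_tmp => _ [x _ <-].
  have [xx|] := ltP (objective x) +oo%E.
    have xxd := objective_edom xx.
    by rewrite objective_fin // dotpE -EFinB lee_fin; exact: h.
  by rewrite leye_eq => /eqP ->; rewrite addye // leey.
have d2 : (dual_function ys <= dual_value I)%E by apply: ereal_sup_ubound; exists ys.
have d3 : (primal_value I <= (Phi xs)%:E)%E.
  by rewrite -objective_fin //; apply: ereal_inf_lbound; exists xs.
split; split=> //.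
  apply/eqP; rewrite eq_le objective_fin // d3 andbT zero_gap.
  exact: le_trans d1 d2.
by apply/eqP; rewrite eq_le d2 -zero_gap; exact: le_trans d3 d1.
Qed.

End OptimalPairs.

Section SaddlePoints.
Variables (R : realType) (I : instance R).
Hypothesis I_ok : admissible I.
Local Notation N := (nodes I).
Local Notation m := (cdim I).
Local Notation Ct := (@bounded_consensus R N m (bnd I)).
Local Notation Y := (polar_cone (cone I) `&` @dual_ball R m (bnd I)).

Let P_ok : problem_ok I. Proof. by case: I_ok. Qed.
Let K_closed : closed (cone I). Proof. by case: P_ok => [[]]. Qed.
Let K_cone : convex_cone (cone I). Proof. by case: P_ok => [[]]. Qed.
Let N0 : (0 < N)%N. Proof. exact: nodes_gt0. Qed.

(* Optimal multiplier of the constraint y_1 = ... = y_N. *)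
Definition vstar (xs : primal I) : 'M[R]_(N, m) := average (gstack xs) - gstack xs.

Lemma consensus_multiplierE (xs : primal I) : consensus_multiplier xs = enorm (vstar xs).
Proof. by rewrite /consensus_multiplier (eucl_dist_proj (average_proj N0 _)) enormC. Qed.

Lemma row_sum_gstack (x : primal I) : row_sum (gstack x) = gsum x.
Proof. by apply: eq_bigr => i _; rewrite row_gstack. Qed.

Lemma vstar_orth (xs : primal I) C : consensus C -> mdot (vstar xs) C = 0.
Proof. by move=> CC; rewrite /vstar -opprB mdotNl average_orth ?oppr0. Qed.

Lemma gstack_vstar (xs : primal I) :
  gstack xs + vstar xs = replicate N (N%:R^-1 *: gsum xs).
Proof. by rewrite addrC subrK /average row_sum_gstack. Qed.

Lemma mdot_gstack_vstar (xs : primal I) (z : 'M[R]_(N, m)) :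
  mdot (gstack xs + vstar xs) z = N%:R^-1 * \sum_i mdot (row i z) (gsum xs).
Proof.
by rewrite gstack_vstar mdotC mdot_replicate mdotZr mdot_suml.
Qed.

Lemma mdot_gstack_replicate (x : primal I) ys :
  mdot (gstack x) (replicate N ys) = mdot (gsum x) ys.
Proof. by rewrite mdot_replicate row_sum_gstack. Qed.

Lemma replicate_Ct ys : dual_ball (bnd I) ys -> Ct (replicate N ys).
Proof.
by move=> yB; split; [exact: replicate_consensus | move=> i; rewrite row_replicate].
Qed.

(** Both [vstar xs] and [n] are orthogonal to consensus vectors, so the normal cone condition holds
    with equality. *)
Lemma comparator_test (xs : primal I) ys n :
  (forall i, edom (rho I i) (xs i)) -> Y ys ->
  (forall C, consensus C -> mdot n C = 0) ->
  comparator xs (vstar xs + n) (replicate N ys).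
Proof.
move=> xd [yK yB] nC; split=> //; first exact: replicate_Ct.
  by move=> i; rewrite row_replicate.
move=> z [zC _]; have cz := consensusB zC (replicate_consensus N ys).
by rewrite mdotDl vstar_orth // nC // addr0.
Qed.

(** Global minimality is tested at points that differ from [xs] in one node, built with [dfwith].
    For the dual condition, [gstack xs + vstar xs] has all its rows equal to [gsum xs] divided by
    the number of nodes, so feasibility and complementarity suffice. *)
Lemma saddle_of_optimal (xs : primal I) ys : optimal_pair xs ys ->
  dual_ball (bnd I) ys -> saddle xs (vstar xs) (replicate N ys).
Proof.
move=> xsP yB; have [xd h c0 xf yK] := optimal_pair_facts I_ok xsP.
split.
- rewrite -(addr0 (vstar xs)); apply: comparator_test => // C _; exact: mdot0l.
- move=> i x ex; rewrite row_replicate.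
  pose w : primal I := @dfwith _ _ xs i x.
  have wi : w i = x by exact: dfwith_in.
  have wj j : j != i -> w j = xs j by rewrite eq_sym; exact: dfwith_out.
  have wd j : edom (rho I j) (w j).
    by have [->|/wj ->] := eqVneq j i; [rewrite wi | exact: xd].
  have e1 : Phi w = phi x + \sum_(j | j != i) phi (xs j).
    by rewrite /Phi (bigD1 i) //= wi; congr (_ + _); apply: eq_bigr => j /wj ->.
  have e2 : gsum w = gcon I i x + \sum_(j | j != i) gcon I j (xs j).
    by rewrite /gsum (bigD1 i) //= wi; congr (_ + _); apply: eq_bigr => j /wj ->.
  have := h _ wd; rewrite e1 e2 [X in X <= _ -> _]/Phi (bigD1 i) //=.
  have : mdot (gcon I i (xs i) + \sum_(j | j != i) gcon I j (xs j)) ys = 0.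
    by rewrite -[RHS]c0 /gsum [in RHS](bigD1 i).
  rewrite !(mdotDl (gcon I i _)); move: (\sum_(j | j != i) gcon I j (xs j)) => S.
  move: (\sum_(j | j != i) phi (xs j)) => T; rewrite /phi.
  by gen_vectors => r1 r2 f1 f2 g1 g2; lra.
- move=> z zY; rewrite mdotBr !mdot_gstack_vstar -mulrBr -sumrB mulr_ge0 ?invr_ge0 ?ler0n //.
  apply: sumr_ge0 => i _; rewrite row_replicate (mdotC ys) c0 subr0.
  by have := polarP (zY i).1 xf; rewrite mdotNr oppr_le0.
Qed.

Lemma saddle_global (u : primal I) vv ys : saddle u vv (replicate N ys) ->
  forall x : primal I, (forall i, edom (rho I i) (x i)) ->
  Phi u - mdot (gsum u) ys <= Phi x - mdot (gsum x) ys.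
Proof.
move=> [_ h _] x xd; rewrite -!mdot_gstack_replicate !mdot_gstack /Phi -!sumrB.
by apply: ler_sum => i _; exact: h.
Qed.

(** A saddle point is a priori optimal only over the dual ball. The ball has radius [2B] while some
    dual optimum [y0] has norm at most [B], so [y0] can move inside the ball along every polar
    direction ([dir]). As [y0] also minimizes [<gsum u, z>] over [Y], these directions give
    feasibility through [bipolar]. *)
Lemma optimal_of_saddle (u : primal I) vv yb :
  saddle u vv (replicate N yb) -> optimal_pair u yb.
Proof.
move=> sdl; have hu := saddle_global sdl.
have [[ud [_ yB] yK S2] _ S3] := sdl.
have i0 : 'I_N := Ordinal N0.
have ybK : polar_cone (cone I) yb by rewrite -(row_replicate yb i0).
have h2 z : Y z -> mdot (gsum u) yb <= mdot (gsum u) z.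
  move=> [zK zB]; have zY i : Y (row i (replicate N z)) by rewrite row_replicate.
  have := S3 _ zY; have := S2 _ (replicate_Ct zB).
  rewrite !mdotBr !mdotDl !mdot_gstack_replicate; lra.
have [_ _ [[xs [ys xsP]] _] [b0 [y0 y0P y0b]] _] := I_ok.
have xsy0 : optimal_pair xs y0 by split=> //; case: xsP.
have [xd h c0 xf y0K] := optimal_pair_facts I_ok xsy0.
have dir y' : polar_cone (cone I) y' -> exists2 t : R, 0 < t & Y (y0 + t *: y').
  move=> yK'; move: b0 y0b; case: (bnd I) => [b||//] b0 y0b.
    exists (b / (1 + enorm y')).
      by rewrite divr_gt0 // ltr_pwDl // enorm_ge0.
    have t0 : 0 < b / (1 + enorm y') by rewrite divr_gt0 // ltr_pwDl // enorm_ge0.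
    split; first by apply: polar_add => //; apply: polar_scale => //; exact: ltW.
    rewrite dual_ball_finE; apply: le_trans (enormD _ _) _.
    rewrite enormZ gtr0_norm //; move: y0b; rewrite lee_fin => y0b.
    have : b / (1 + enorm y') * enorm y' <= b.
      have e0 := enorm_ge0 y'; rewrite mulrAC ler_pdivrMr ?ltr_pwDl // ler_pM2l // lerDr //.
    lra.
  exists 1 => //; split; last exact: dual_ball_pinfty.
  by rewrite scale1r; apply: polar_add.
have Y0 : Y y0.
  have [t t0 [_ hB]] := dir 0 (fun k _ => ltac:(rewrite dotpE oppr0 mdot0l; exact: lexx)).
  by split=> //; rewrite scaler0 addr0 in hB.
have e1 := h _ ud; have e2 := h2 _ Y0; have e3 := hu _ xd.
have e4 : 0 <= mdot (gsum xs) yb.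
  by have := polarP ybK xf; rewrite mdotNr mdotC oppr_le0.
(* The four inequalities combine into [Phi u - <gsum u, yb> <= Phi xs <= Phi u - <gsum u, y0>], the
   reverse of [e2]. *)
have cE : mdot (gsum u) y0 = mdot (gsum u) yb by apply/eqP; rewrite eq_le; apply/andP; split; lra.
have uf : cone I (- gsum u).
  apply: (bipolar K_closed K_cone) => y' y'K; have [t t0 tY] := dir _ y'K.
  have := h2 _ tY; rewrite mdotDr mdotZr cE lerDl pmulr_rge0 // mdotNr oppr_le0.
  by rewrite mdotC.
have Yz : Y 0.
  split; last exact: dual_ball0.
  by move=> k _; rewrite dotpE oppr0 mdot0l.
have := h2 _ Yz; rewrite mdot0r => c1.
have := polarP ybK uf; rewrite mdotNr mdotC oppr_le0 => c2.
apply: optimal_pair_intro => // x xd'; have := hu _ xd'; lra.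
Qed.

Variables (gamma beta : R).
Variables (xi : nat -> primal I) (v y : nat -> 'M[R]_(N, m)).
Hypothesis run : dpda gamma beta xi v y.

(** The term [<gstack xs + vstar xs, y k.+1>] of the gap is nonnegative, since dual iterates lie in
    the polar cone and [xs] is feasible. Dropping it leaves a Lagrangian difference and the tested
    disagreement, both suited to averaging over [k]. *)
Lemma gap_test (xs : primal I) yt n k : cone I (- gsum xs) ->
  (forall C, consensus C -> mdot n C = 0) ->
  Phi (xi k.+1) - mdot (gsum (xi k.+1)) yt - Phi xs + mdot n (y k.+1) <=
  gap xi y xs (vstar xs + n) (replicate N yt) k.
Proof.
move=> xf nC; rewrite /gap !mdot_gstack_replicate addrA mdotBr !(mdotDl _ n).
rewrite (nC _ (replicate_consensus N yt)).
have -> : mdot (gstack xs + vstar xs) (replicate N yt) = mdot (gsum xs) yt.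
  rewrite mdotDl mdot_gstack_replicate vstar_orth ?addr0 //.
  exact: replicate_consensus.
have : 0 <= mdot (gstack xs + vstar xs) (y k.+1).
  rewrite mdot_gstack_vstar mulr_ge0 ?invr_ge0 ?ler0n //; apply: sumr_ge0 => i _.
  have [yK _] := y_proj I_ok run k.+1 i.
  by have := polarP yK xf; rewrite mdotNr oppr_le0.
lra.
Qed.

End SaddlePoints.

(** * Ergodic rates *)

Section Ergodic.
Variable R : realType.

Lemma ergodic_recr (V : lmodType R) (u : nat -> V) K :
  ergodic u K.+2 = K.+2%:R^-1 *: u K.+2 + (1 - K.+2%:R^-1) *: ergodic u K.+1.
Proof.
rewrite /ergodic big_nat_recr //= scalerDr addrC; congr (_ + _).
rewrite scalerA; congr (_ *: _).
have h : (K.+1%:R : R) != 0 by rewrite pnatr_eq0.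
have h' : (K.+1%:R + 1 : R) != 0 by rewrite natr1 pnatr_eq0.
rewrite -(natr1 K.+1); move: (K.+1%:R : R) h h' => a h h'; field.
by rewrite ?h ?h'.
Qed.

Lemma ergodic1 (V : lmodType R) (u : nat -> V) : ergodic u 1 = u 1%N.
Proof. by rewrite /ergodic big_nat1 invr1 scale1r. Qed.

(** Jensen's inequality, relative to [D] because [fine (rho x)] is convex only on the domain of
    [rho]. *)
Lemma ergodic_convex n (D : set 'rV[R]_n) (h : 'rV[R]_n -> R) (u : nat -> 'rV[R]_n) :
  cvx_set D ->
  (forall a b t, D a -> D b -> 0 <= t -> t <= 1 ->
     h (t *: a + (1 - t) *: b) <= t * h a + (1 - t) * h b) ->
  (forall k, D (u k.+1)) -> forall K,
  D (ergodic u K.+1) /\ h (ergodic u K.+1) <= ergodic (fun k => h (u k) : R^o) K.+1.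
Proof.
move=> cD hc uD; elim=> [|K [IH1 IH2]]; first by rewrite !ergodic1.
have k0 : 0 <= (K.+2%:R^-1 : R) by rewrite invr_ge0 ler0n.
have k1 : (K.+2%:R^-1 : R) <= 1 by rewrite invf_le1 ?ler1n.
rewrite !ergodic_recr; split; first exact: cD.
apply: le_trans (hc _ _ _ (uD _) IH1 k0 k1) _.
by rewrite lerD2l /= -[leRHS]/(_ * _) ler_wpM2l // subr_ge0.
Qed.

Lemma ergodicE (f : nat -> R) K :
  ergodic (f : nat -> R^o) K = K%:R^-1 * \sum_(k < K) f k.+1.
Proof. by rewrite /ergodic big_add1 big_mkord. Qed.

Lemma mdot_ergodic p q (A : 'M[R]_(p, q)) (u : nat -> 'M[R]_(p, q)) K :
  mdot A (ergodic u K) = ergodic (fun k => mdot A (u k) : R^o) K.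
Proof.
rewrite /ergodic mdotZr mdotC mdot_suml; congr (_ * _).
by apply: eq_bigr => k _; rewrite mdotC.
Qed.

End Ergodic.

Section Rates.
Variables (R : realType) (I : instance R).
Hypothesis I_ok : admissible I.
Local Notation N := (nodes I).
Local Notation m := (cdim I).
Local Notation Y := (polar_cone (cone I) `&` @dual_ball R m (bnd I)).

Let P_ok : problem_ok I. Proof. by case: I_ok. Qed.
Let K_closed : closed (cone I). Proof. by case: P_ok => [[]]. Qed.
Let K_cone : convex_cone (cone I). Proof. by case: P_ok => [[]]. Qed.
Let N0 : (0 < N)%N. Proof. exact: nodes_gt0. Qed.

(** The weight [2 |ys|] on the violation is twice what the lower bound of the suboptimality can
    consume; the remaining half is the violation term of the infeasibility. *)
Lemma rate_bounds_intro (xs : primal I) ys xi y L : optimal_pair xs ys -> 0 <= L ->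
  (forall K, let xib : primal I := fun i => ergodic (fun k => xi k i) K.+1 in
     (forall i, edom (rho I i) (xib i)) /\
     Phi xib - Phi xs + 2 * enorm ys * eucl_dist (cone I) (- gsum xib)
     + eucl_dist (@consensus R N m) (ergodic y K.+1) <= L / K.+1%:R) ->
  rate_bounds xs ys xi y L.
Proof.
move=> xsP L0 h; split=> // -[//|K] _ xib F gap viol.
have [xd hK] := h K; rewrite -/xib in xd hK.
set c := L / K.+1%:R in hK *.
have [xsd hs c0 xf yK] := optimal_pair_facts I_ok xsP.
have vE : viol = enorm ys * eucl_dist (cone I) (- gsum xib) by [].
have dC0 : 0 <= eucl_dist (@consensus R N m) (ergodic y K.+1).
  by rewrite (eucl_dist_proj (average_proj N0 _)) enorm_ge0.
have gapE : gap = (Phi xib - Phi xs)%:E by rewrite /gap !objective_fin // EFinB.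
have FE : F = eucl_dist (@consensus R N m) (ergodic y K.+1) + viol by [].
clearbody F viol gap.
have g0 : 0 <= Phi xib - Phi xs + viol.
  have := hs _ xd; have := polar_dist K_closed K_cone (- gsum xib) yK.
  rewrite vE mdotNr mdotC; lra.
have v0 : 0 <= viol.
  rewrite vE mulr_ge0 ?enorm_ge0 //.
  by have [z [zP _ _]] := cone_proj K_closed K_cone (- gsum xib); rewrite (eucl_dist_proj zP) enorm_ge0.
have hK' : Phi xib - Phi xs + viol <= c - F by rewrite FE vE; move: hK; lra.
split.
- lra.
- by rewrite gapE -EFinD lee_fin.
- by rewrite gapE -EFinD lee_fin.
- by rewrite gapE lee_fin ler_norml; apply/andP; split; rewrite FE in hK'; lra.
Qed.

Variables (gamma beta : R).
Hypotheses (gamma0 : 0 < gamma) (beta0 : 0 <= beta).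
Variables (xi : nat -> primal I) (v y : nat -> 'M[R]_(N, m)).
Hypothesis run : dpda gamma beta xi v y.
Hypothesis y_le : forall k i, enorm (row i (y k)) <= beta.
Local Notation Err := (@Err R I gamma v y).
Local Notation lyap := (@lyap R I gamma beta xi v y).
Local Notation gap := (@gap R I xi y).

Lemma sum_gap_le u vv yy K : comparator u vv yy ->
  \sum_(k < K.+1) gap u vv yy k <=
  lyap u vv yy 0 + start_defect xi + \sum_(k < K.+1) Err vv yy k.
Proof.
move=> cmp; suff : \sum_(k < K.+1) gap u vv yy k + lyap u vv yy K.+1 <=
   lyap u vv yy 0 + start_defect xi + \sum_(k < K.+1) Err vv yy k.
  by have := lyap_ge0 I_ok beta gamma0 xi v y u vv yy K.+1; lra.
have step k : gap u vv yy k + lyap u vv yy k.+1 <=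
    lyap u vv yy k + Err vv yy k + (if k == 0%N then start_defect xi else 0).
  have := lyapunov_step I_ok gamma0 run cmp (y_le k).
  have g0 : 0 <= gamma / 4 * enorm (y k.+1 - y k) ^+ 2.
    by rewrite mulr_ge0 ?sqr_ge0 // divr_ge0 // ltW.
  have v0 : 0 <= 1 / (4 * gamma) * enorm (v k.+1 - v k) ^+ 2.
    by rewrite mulr_ge0 ?sqr_ge0 // divr_ge0 // mulr_ge0 // ltW.
  lra.
elim: K => [|K IH]; first by rewrite !big_ord1; have := step 0%N; rewrite /=; lra.
rewrite big_ord_recr [X in _ <= _ + X]big_ord_recr /=; have := step K.+1; rewrite /=; lra.
Qed.

Lemma phi_gcon_convex (i : 'I_N) (yt : 'rV[R]_m) (a b : 'rV[R]_(dim i)) t :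
  polar_cone (cone I) yt ->
  edom (rho I i) a -> edom (rho I i) b -> 0 <= t -> t <= 1 ->
  phi (t *: a + (1 - t) *: b) - mdot (gcon I i (t *: a + (1 - t) *: b)) yt <=
  t * (phi a - mdot (gcon I i a) yt) + (1 - t) * (phi b - mdot (gcon I i b) yt).
Proof.
move=> yK ad bd t0 t1.
have h1 := fine_convex (rho_proper P_ok i) (@rho_convex _ _ P_ok i) ad bd t0 t1.
have h2 : fsm I i (t *: a + (1 - t) *: b) <= t * fsm I i a + (1 - t) * fsm I i b.
  by case: P_ok => _ _ /(_ i)[_ cf _ _ _] _; exact: cf.
have h3 : mdot (t *: gcon I i a + (1 - t) *: gcon I i b
     - gcon I i (t *: a + (1 - t) *: b)) yt <= 0.
  case: P_ok => _ _ _ /(_ i)[_ cg _ _ _]; rewrite mdotC.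
  by apply: polarP yK _; exact: cg.
move: h1 h2 h3; rewrite /phi; move: (t *: a + (1 - t) *: b) => w.
by gen_vectors => r1 r2 r3 f1 f2 f3 g1 g2 g3; rewrite !mdotDE !mdotZl; lra.
Qed.

Lemma lagrangian_ergodic (yt : 'rV[R]_m) K : polar_cone (cone I) yt ->
  let xib : primal I := fun i => ergodic (fun k => xi k i) K.+1 in
  (forall i, edom (rho I i) (xib i)) /\
  Phi xib - mdot (gsum xib) yt <=
  ergodic (fun k => Phi (xi k) - mdot (gsum (xi k)) yt : R^o) K.+1.
Proof.
move=> yK xib.
have h (i : 'I_N) := @ergodic_convex R _ (edom (rho I i))
  (fun x => phi x - mdot (gcon I i x) yt) (fun k => xi k i)
  (edom_convex (rho_proper P_ok i) (@rho_convex _ _ P_ok i))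
  (fun a b t => @phi_gcon_convex i yt a b t yK) (fun k => xi_edom I_ok run k i) K.
split=> [i|]; first by have [] := h i.
have sE (x : primal I) : Phi x - mdot (gsum x) yt = \sum_i (phi (x i) - mdot (gcon I i (x i)) yt).
  by rewrite sumrB /gsum mdot_suml.
have -> : (fun k => Phi (xi k) - mdot (gsum (xi k)) yt) =
    (fun k => \sum_i (phi (xi k i) - mdot (gcon I i (xi k i)) yt)).
  by apply/funext => k; exact: sE.
rewrite sE /ergodic.
rewrite exchange_big /= scaler_sumr; apply: ler_sum => i _; exact: (h i).2.
Qed.

(* Testing the Lyapunov inequality at the multiplier 2 r d of the constraint, d
   the direction of the violation, and at a unit perturbation of vstar makes both
   residuals appear in the gap. *)
Lemma core_rate (xs : primal I) ys (r L : R) K : optimal_pair xs ys -> 0 <= r ->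
  (forall d : 'rV[R]_m, enorm d <= 1 -> dual_ball (bnd I) ((2 * r) *: d)) ->
  (forall yt n, Y yt -> enorm yt <= 2 * r ->
     (forall C, consensus C -> mdot n C = 0) -> enorm n <= 1 ->
     lyap xs (vstar xs + n) (replicate N yt) 0 + start_defect xi
     + \sum_(k < K.+1) Err (vstar xs + n) (replicate N yt) k <= L) ->
  let xib : primal I := fun i => ergodic (fun k => xi k i) K.+1 in
  (forall i, edom (rho I i) (xib i)) /\
  Phi xib - Phi xs + 2 * r * eucl_dist (cone I) (- gsum xib)
  + eucl_dist (@consensus R N m) (ergodic y K.+1) <= L / K.+1%:R.
Proof.
move=> xsP r0 rB hL xib.
have [xsd hs c0 xf _] := optimal_pair_facts I_ok xsP.
have [d [dK d1 dE]] := dist_direction K_closed K_cone (- gsum xib).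
have [n [nC n1 nE]] := consensus_direction N0 (ergodic y K.+1).
have r2 : 0 <= 2 * r by rewrite mulr_ge0.
pose yt := (2 * r) *: d.
have ytY : Y yt by split; [exact: polar_scale | exact: rB].
have yt_le : enorm yt <= 2 * r by rewrite enormZ ger0_norm // ler_piMr.
have [xd hx] := lagrangian_ergodic K ytY.1; split=> //; rewrite -/xib in hx.
have hsum := le_trans (sum_gap_le K (comparator_test I_ok xsd ytY nC)) (hL _ _ ytY yt_le nC n1).
have : \sum_(k < K.+1) (Phi (xi k.+1) - mdot (gsum (xi k.+1)) yt - Phi xs + mdot n (y k.+1)) <= L.
  by apply: le_trans hsum; apply: ler_sum => k _; exact: (gap_test I_ok run).
rewrite big_split sumrB /= sumr_const card_ord => {}hsum.
have k0 : 0 < (K.+1%:R : R) by rewrite ltr0n.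
have {}hsum := ler_wpM2l (ltW (_ : 0 < K.+1%:R^-1)) hsum.
rewrite -nE mdot_ergodic.
have -> : 2 * r * eucl_dist (cone I) (- gsum xib) = - mdot (gsum xib) yt.
  by rewrite -dE -mdotZl mdotNr mdotC.
move: hx (hsum (ltac:(by rewrite invr_gt0))).
rewrite !ergodicE mulrDr mulrBr -(mulr_natl (Phi xs)) mulKf ?gt_eqF // (mulrC L).
move: (_^-1 * \sum_(k < _) _) (_^-1 * \sum_(k < _) _) (_^-1 * L) => a b c; lra.
Qed.

End Rates.

(** * Summed averaging errors *)

Section Sequences.
Variable R : realType.

(** Apart from [X0], the right-hand side is the square of [sqrt V + t], so the errors add up on the
    level of square roots. [X0] is charged once, at step 0, and stands for [start_defect]. *)
Lemma sqrt_growth (V t : nat -> R) (X0 : R) : 0 <= X0 -> (forall k, 0 <= V k) ->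
  (forall k, 0 <= t k) ->
  (forall k, V k.+1 <= V k + (if k == 0%N then X0 else 0)
     + 2 * t k * Num.sqrt (V k) + t k ^+ 2) ->
  forall K, Num.sqrt (V K) <= Num.sqrt (V 0%N + X0) + \sum_(k < K) t k.
Proof.
move=> X00 V0 t0 h.
have step k W : 0 <= W -> V k + (if k == 0%N then X0 else 0) <= W ^+ 2 ->
    Num.sqrt (V k.+1) <= W + t k.
  move=> W0 hW; rewrite -(@ler_pXn2r _ 2) ?nnegrE ?sqrtr_ge0 ?addr_ge0 //.
  rewrite sqr_sqrtr //; apply: le_trans (h k) _.
  have sW : Num.sqrt (V k) <= W.
    rewrite -(@ler_pXn2r _ 2) ?nnegrE ?sqrtr_ge0 // sqr_sqrtr //.
    by apply: le_trans hW; rewrite lerDl; case: ifP.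
  have := ler_wpM2l (t0 k) sW; move: hW; case: ifP => _; lra.
elim=> [|K IH]; first by rewrite big_ord0 addr0 ler_wsqrtr // lerDl.
rewrite big_ord_recr addrA; apply: step; first exact: le_trans (sqrtr_ge0 _) IH.
case: K IH => [|K] IH /=; first by rewrite big_ord0 addr0 sqr_sqrtr // addr_ge0.
by rewrite addr0 -[leLHS]sqr_sqrtr // ler_pXn2r ?nnegrE ?sqrtr_ge0 // (le_trans (sqrtr_ge0 _) IH).
Qed.

Definition growth (e : nat -> R) K : R := \prod_(k < K) (1 + 17 * e k).

Lemma growthS e K : growth e K.+1 = growth e K * (1 + 17 * e K).
Proof. by rewrite /growth big_ord_recr. Qed.

Lemma growth_ge0 (e : nat -> R) K : (forall k, 0 <= e k) -> 0 <= growth e K.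
Proof. by move=> e0; apply: prodr_ge0 => k _; rewrite addr_ge0 // mulr_ge0. Qed.

(* The first T factors are at most (k + 2) / (k + 1) and telescope; the others
   have a bounded product since the weights k + 1 exceed T. *)
Lemma growth_le (e : nat -> R) (T : R) : (forall k, 0 <= e k) ->
  (forall k, 24 * (k.+1%:R * e k) <= 1) ->
  (forall K, \sum_(k < K) k.+1%:R * e k <= T) ->
  forall K, growth e K <= expR 17 * (T + 2).
Proof.
move=> e0 e1 eT K.
have T0 : 0 <= T by have := eT 0%N; rewrite big_ord0.
have E1 : 1 <= (expR 17 : R) by rewrite -expR0 ler_expR.
have small k : growth e k <= k.+1%:R.
  elim: k => [|k IH]; first by rewrite /growth big_ord0.
  rewrite growthS -(natr1 k.+1).
  have k0 : 0 < (k.+1%:R : R) by rewrite ltr0n.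
  apply: (@le_trans _ _ (k.+1%:R * (1 + 17 * e k))).
    by rewrite ler_wpM2r // addr_ge0 // mulr_ge0.
  have := e1 k; have := mulr_ge0 (ltW k0) (e0 k).
  by move: (k.+1%:R : R) (e k) => a b; lra.
have [KK0|K0K] := leqP K (Num.truncn T).+1.
  apply: le_trans (small K) _.
  have : (K.+1%:R : R) <= T + 2.
    have : (Num.truncn T)%:R <= T by rewrite truncn_le.
    have : (K%:R : R) <= (Num.truncn T).+1%:R by rewrite ler_nat.
    by rewrite -!natr1; lra.
  move=> hK; apply: le_trans hK _; rewrite ler_peMl //; lra.
have [n nE] : exists n, K = ((Num.truncn T).+1 + n)%N by exists (K - (Num.truncn T).+1)%N; rewrite subnKC // ltnW.
rewrite nE /growth big_split_ord /= -/(growth e (Num.truncn T).+1).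
have h1 : growth e (Num.truncn T).+1 <= T + 2.
  apply: le_trans (small _) _; have : (Num.truncn T)%:R <= T by rewrite truncn_le.
  by rewrite -!natr1; lra.
suff h2 : \prod_(i < n) (1 + 17 * e ((Num.truncn T).+1 + i)%N) <= expR 17.
  rewrite mulrC; apply: ler_pM => //; last exact: growth_ge0.
  by apply: prodr_ge0 => k _; rewrite addr_ge0 // mulr_ge0.
apply: (@le_trans _ _ (expR (17 * \sum_(i < n) e ((Num.truncn T).+1 + i)%N))).
  rewrite mulr_sumr expR_sum; apply: ler_prod => i _.
  by rewrite addr_ge0 ?mulr_ge0 //= expR_ge1Dx.
rewrite ler_expR -[leRHS]mulr1 ler_wpM2l //.
have tT : T < (Num.truncn T).+1%:R by rewrite truncnS_gt.
have tp : 0 < ((Num.truncn T).+1%:R : R) by rewrite ltr0n.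
rewrite -(ler_pM2l tp) mulr1; apply: le_trans (ltW tT).
apply: le_trans (eT ((Num.truncn T).+1 + n)%N).
rewrite big_split_ord /= -[leLHS]add0r lerD //.
  by apply: sumr_ge0 => i _; rewrite mulr_ge0.
rewrite mulr_sumr; apply: ler_sum => i _; rewrite ler_wpM2r // ler_nat.
exact: leq_trans (leq_addr i _) (leqnSn _).
Qed.

End Sequences.

Section TotalError.
Variables (R : realType) (I : instance R).
Hypothesis I_ok : admissible I.
Local Notation N := (nodes I).
Local Notation m := (cdim I).

Let P_ok : problem_ok I. Proof. by case: I_ok. Qed.
Let N0 : (0 < N)%N. Proof. exact: nodes_gt0. Qed.

Definition weight : R := N%:R * Gam I * C0 I.

Lemma NGam_gt0 : 0 < N%:R * Gam I.
Proof. by case: I_ok => _ _ _ _ [[G0 _ _ _ _] _]; rewrite mulr_gt0 ?ltr0n. Qed.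

Lemma C0_terms_ge0 k : 0 <= C0_terms I k.
Proof.
case: I_ok => _ _ _ _ [[_ /andP[a0 _] _ _ _] _].
by rewrite /C0_terms mulr_ge0 // exprn_ge0 // ltW.
Qed.

Lemma sum_eps_le K : \sum_(k < K) k.+1%:R * eps I k <= weight.
Proof.
have [_ _ _ _ [_ cvC]] := I_ok.
have : \sum_(k < K) C0_terms I k <= C0 I.
  have := @nondecreasing_cvgn_le R (series (C0_terms I)) _ cvC K.
  rewrite /series /= big_mkord; apply; apply: nondecreasing_series => n _ _.
  exact: C0_terms_ge0.
move=> h; apply: le_trans (ler_wpM2l (ltW NGam_gt0) h); rewrite mulr_sumr.
by apply: ler_sum => k _; rewrite /eps /C0_terms mulrC mulrA.
Qed.

Lemma weight_ge0 : 0 <= weight.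
Proof. by have := sum_eps_le 0; rewrite big_ord0. Qed.

(** Common scale of the initial Lyapunov value and of [start_defect], for all tested points at once:
    the [+ 1] covers unit perturbations of [vstar xs], and [r] the norm of the dual vector. *)
Definition omega (xs : primal I) (beta gamma r : R) : R :=
  \sum_i (1 + Lf I i + Cg I i + beta * Lg I i) * enorm (xs i - start I i) ^+ 2
  + gamma^-1 * (enorm (vstar xs) + 1) ^+ 2 + N%:R * (Cg_mean I + gamma) * r ^+ 2.

Lemma sum_Cg : \sum_i Cg I i = N%:R * Cg_mean I.
Proof. by rewrite /Cg_mean mulrA mulfV ?mul1r // pnatr_eq0 -lt0n. Qed.

Lemma Cg_mean_ge0 : 0 <= Cg_mean I.
Proof.
rewrite /Cg_mean mulr_ge0 ?invr_ge0 ?ler0n //.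
by apply: sumr_ge0 => i _; exact: Cg_ge0.
Qed.

Variables (gamma beta : R).
Hypotheses (gamma0 : 0 < gamma) (beta0 : 0 <= beta).

Lemma omega_parts xs r :
  [/\ 0 <= \sum_i (1 + Lf I i + Cg I i + beta * Lg I i) * enorm (xs i - start I i) ^+ 2,
      0 <= gamma^-1 * (enorm (vstar xs) + 1) ^+ 2 &
      0 <= N%:R * (Cg_mean I + gamma) * r ^+ 2].
Proof.
have L0 := Lf_ge0 P_ok; have c0 := Cg_ge0 P_ok; have G0 := Lg_ge0 P_ok.
split.
- apply: sumr_ge0 => i _; rewrite mulr_ge0 ?sqr_ge0 //.
  by rewrite !addr_ge0 // mulr_ge0.
- by rewrite mulr_ge0 ?sqr_ge0 // invr_ge0 ltW.
- have cg : 0 <= Cg_mean I + gamma by apply: addr_ge0; [exact: Cg_mean_ge0 | exact: ltW].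
  by apply: mulr_ge0; [apply: mulr_ge0; rewrite ?ler0n | exact: sqr_ge0].
Qed.

Lemma omega_ge0 xs r : 0 <= omega xs beta gamma r.
Proof. by have [a b c] := omega_parts xs r; rewrite /omega !addr_ge0. Qed.

Variables (xi : nat -> primal I) (v y : nat -> 'M[R]_(N, m)).
Hypothesis run : dpda gamma beta xi v y.
Local Notation lyap := (@lyap R I gamma beta xi v y).

(** [c] is 1 at the saddle point and 2 at the tested multipliers, whose norm may reach [2 * r]. *)
Lemma lyap_start_omega xs n yt (c r : R) : enorm n <= 1 -> enorm yt <= c * r -> 1 <= c -> 0 <= r ->
  lyap xs (vstar xs + n) (replicate N yt) 0 <= 9 / 4 * c ^+ 2 * omega xs beta gamma r.
Proof.
move=> n1 yr c1 r0; apply: le_trans (lyap_start I_ok gamma0 beta0 run _ _ _) _.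
have [a0 b0 d0] := omega_parts xs r.
have hv : gamma^-1 * enorm (vstar xs + n) ^+ 2 <= gamma^-1 * (enorm (vstar xs) + 1) ^+ 2.
  rewrite ler_wpM2l ?invr_ge0 ?(ltW gamma0) // ler_pXn2r ?nnegrE ?enorm_ge0 ?addr_ge0 ?enorm_ge0 //.
  by apply: le_trans (enormD _ _) _; rewrite lerD2l.
have hy : \sum_i (Cg I i + 9 / 4 * gamma) * enorm (row i (replicate N yt)) ^+ 2 <=
   9 / 4 * c ^+ 2 * (N%:R * (Cg_mean I + gamma) * r ^+ 2).
  apply: (@le_trans _ _ (\sum_(i < N) (Cg I i + 9 / 4 * gamma) * (c * r) ^+ 2)).
    apply: ler_sum => i _; rewrite row_replicate ler_wpM2l //.
      by rewrite addr_ge0 ?Cg_ge0 // mulr_ge0 // ltW.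
    by rewrite ler_pXn2r ?nnegrE ?enorm_ge0 // mulr_ge0 // (le_trans _ c1).
  rewrite -mulr_suml big_split /= sum_Cg sumr_const card_ord -(mulr_natl (9 / 4 * gamma) N) exprMn.
  have := mulr_ge0 (mulr_ge0 (ler0n R N) Cg_mean_ge0) (sqr_ge0 (c * r)).
  rewrite exprMn; move: (N%:R : R) (Cg_mean I) => n' C; lra.
have c2 : 0 <= 9 / 4 * c ^+ 2 - 1 by nra.
have ha := mulr_ge0 c2 a0; have hb := mulr_ge0 c2 b0.
rewrite /omega !mulrDr; move: ha hb hv hy; rewrite !mulrBl !mul1r.
lra.
Qed.

Lemma start_defect_omega xs yb r vv : saddle xs vv (replicate N yb) -> enorm yb <= r ->
  start_defect xi <= 2 * omega xs beta gamma r.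
Proof.
move=> sdl yr; apply: le_trans (start_defect_le I_ok beta0 run sdl) _.
have [a0 b0 d0] := omega_parts xs r.
have r0 : 0 <= r by apply: le_trans yr; exact: enorm_ge0.
have hL : \sum_i Lf I i * enorm (xs i - start I i) ^+ 2 <=
   \sum_i (1 + Lf I i + Cg I i + beta * Lg I i) * enorm (xs i - start I i) ^+ 2.
  apply: ler_sum => i _; rewrite ler_wpM2r ?sqr_ge0 //.
  have := Cg_ge0 P_ok i; have := mulr_ge0 beta0 (Lg_ge0 P_ok i).
  by gen_vectors => L C G; lra.
have hC : \sum_i Cg I i * enorm (row i (replicate N yb)) ^+ 2 <=
   N%:R * (Cg_mean I + gamma) * r ^+ 2.
  apply: (@le_trans _ _ (\sum_(i < N) Cg I i * r ^+ 2)).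
    apply: ler_sum => i _; rewrite row_replicate ler_wpM2l ?Cg_ge0 //.
    by rewrite ler_pXn2r ?nnegrE ?enorm_ge0.
  rewrite -mulr_suml sum_Cg ler_wpM2r ?sqr_ge0 // ler_wpM2l ?ler0n //.
  by rewrite lerDl ltW.
rewrite /omega; lra.
Qed.

End TotalError.

Section ErrorBounds.
Variables (R : realType) (I : instance R).
Hypothesis I_ok : admissible I.
Local Notation N := (nodes I).
Local Notation m := (cdim I).
Local Notation sN := (Num.sqrt (N%:R : R)).
Local Notation T := (weight I).

Let P_ok : problem_ok I. Proof. by case: I_ok. Qed.
Let N0 : (0 < N)%N. Proof. exact: nodes_gt0. Qed.

Variables (gamma beta : R).
Hypotheses (gamma0 : 0 < gamma) (beta0 : 0 <= beta).
Variables (xi : nat -> primal I) (v y : nat -> 'M[R]_(N, m)).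
Hypothesis run : dpda gamma beta xi v y.
Local Notation Err := (@Err R I gamma v y).
Local Notation eta := (@eta R I gamma v y).
Local Notation wk := (@wk R I gamma v y).
Local Notation lyap := (@lyap R I gamma beta xi v y).
Local Notation xk := (@xk R I gamma v y).
Local Notation eps := (eps I).

Lemma sN_ge0 : 0 <= sN. Proof. exact: sqrtr_ge0. Qed.

Lemma enorm_replicate (z : 'rV[R]_m) : enorm (replicate N z) <= sN * enorm z.
Proof. by apply: enorm_le_rows => [|i]; rewrite ?enorm_ge0 // row_replicate. Qed.

(** Changing the comparison point costs a constant independent of [k], so bounds on the iterates
    around one saddle point control the errors at all tested points. *)
Lemma xk_test_le vv n (yb yt : 'rV[R]_m) (r : R) k :
  enorm n <= 1 -> enorm yb <= r -> enorm yt <= 2 * r ->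
  enorm (xk (vv + n) (replicate N yt) k) <=
  enorm (xk vv (replicate N yb) k) + (1 + 3 * (gamma * (sN * r))).
Proof.
move=> n1 br tr.
have -> : xk (vv + n) (replicate N yt) k =
   xk vv (replicate N yb) k - (n + gamma *: replicate N (yt - yb)).
  by apply/matrixP => i j; rewrite /xk /replicate !mxE; ring.
apply: le_trans (enormB _ _) _; rewrite lerD2l.
apply: le_trans (enormD _ _) _; apply: lerD => //.
rewrite enormZ gtr0_norm //.
have h : enorm (yt - yb) <= 3 * r by apply: le_trans (enormB _ _) _; lra.
have := ler_wpM2l sN_ge0 h; have := enorm_replicate (yt - yb) => h1 h2.
have := ler_wpM2l (ltW gamma0) (le_trans h1 h2); lra.
Qed.

Lemma err_ge0 vv yy k : 0 <= Err vv yy k.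
Proof.
have e0 := eta_ge0 I_ok gamma v y k.
by rewrite mulr_ge0 // addr_ge0 ?enorm_ge0 // mulr_ge0 // ltW.
Qed.

Lemma lyapunov_step_weak k u vv yy : saddle u vv yy ->
  (forall i, enorm (row i (y k)) <= beta) ->
  lyap u vv yy k.+1 <= lyap u vv yy k + (if k == 0%N then start_defect xi else 0)
   + Err vv yy k.
Proof.
move=> sdl yb; have [cmp _ _] := sdl.
have := lyapunov_step I_ok gamma0 run cmp yb; have := gap_ge0 I_ok run k sdl.
have g0 : 0 <= gamma / 4 * enorm (y k.+1 - y k) ^+ 2.
  by rewrite mulr_ge0 ?sqr_ge0 // divr_ge0 // ltW.
have v0 : 0 <= 1 / (4 * gamma) * enorm (v k.+1 - v k) ^+ 2.
  by rewrite mulr_ge0 ?sqr_ge0 // divr_ge0 // mulr_ge0 // ltW.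
lra.
Qed.

Lemma start_defect_ge0 : 0 <= start_defect xi.
Proof.
by apply: sumr_ge0 => i _; rewrite mulr_ge0 ?sqr_ge0 // divr_ge0 // Lf_ge0.
Qed.

(** * Errors when a dual bound is known *)

Section KnownBound.
Variable b : R.
Hypotheses (bndE : bnd I = b%:E) (betaE : beta = 2 * b).

Lemma b_gt0 : 0 < b. Proof. by have := bnd_gt0 I_ok; rewrite bndE lte_fin. Qed.

Lemma y_le_known k i : enorm (row i (y k)) <= beta.
Proof. by have [_] := y_proj I_ok run k i; rewrite bndE dual_ball_finE betaE. Qed.

Lemma y_stack_le k : enorm (y k) <= sN * (2 * b).
Proof.
apply: enorm_le_rows => [|i]; first by rewrite mulr_ge0 // ltW // b_gt0.
by rewrite -betaE y_le_known.
Qed.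

(** Each increment is [gamma] times the difference of two vectors of the box. The resulting linear
    growth is matched by the weight [k + 1] in [C0_terms]. *)
Lemma v_le_known k : enorm (v k) <= 4 * gamma * b * sN * k%:R.
Proof.
elim: k => [|k IH]; first by have [_ -> _ _] := run; rewrite enorm0 mulr0.
have -> : v k.+1 = v k + gamma *: (y k - averager I k (wk k)).
  by rewrite -(v_step gamma0 run) addrC subrK.
have r_le : enorm (averager I k (wk k)) <= sN * (2 * b).
  case: I_ok => _ _ _ _ [[_ _ _ _ /(_ k (wk k))[rB _]] _].
  apply: enorm_le_rows => [|i]; first by rewrite mulr_ge0 // ltW // b_gt0.
  by have := rB i; rewrite bndE dual_ball_finE.
apply: le_trans (enormD _ _) _; rewrite enormZ gtr0_norm //.
have h := le_trans (enormB (y k) (averager I k (wk k))) (lerD (y_stack_le k) r_le).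
move: IH (ler_wpM2l (ltW gamma0) h); rewrite -(natr1 k); move: (k%:R : R) sN => k' s; lra.
Qed.

Lemma eta_le_known k : eta k <= 4 * b * sN * (k.+1%:R * eps k).
Proof.
have hw : enorm (wk k) <= 4 * b * sN * k.+1%:R.
  apply: le_trans (enormD _ _) _; rewrite enormZ gtr0_norm ?invr_gt0 //.
  have := ler_wpM2l (ltW (_ : 0 < gamma^-1)) (v_le_known k).
  rewrite invr_gt0 => /(_ gamma0).
  have -> : gamma^-1 * (4 * gamma * b * sN * k%:R) = 4 * b * sN * k%:R.
    by field; rewrite gt_eqF.
  have := y_stack_le k; have := mulr_ge0 sN_ge0 (ltW b_gt0).
  rewrite -(natr1 k); move: (k%:R : R) => k'; lra.
by have := ler_wpM2l (eps_ge0 I_ok k) hw; rewrite /(eta _); lra.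
Qed.

Lemma sum_eta_known K : \sum_(k < K) eta k <= 4 * b * sN * T.
Proof.
apply: (@le_trans _ _ (\sum_(k < K) 4 * b * sN * (k.+1%:R * eps k))).
  by apply: ler_sum => k _; exact: eta_le_known.
rewrite -mulr_sumr ler_wpM2l ?sum_eps_le //.
by rewrite mulr_ge0 ?sN_ge0 // mulr_ge0 // ltW // b_gt0.
Qed.

(** With [t = sqrt (2 gamma) * eta] the error is at most [2 t sqrt V + t ^ 2], because the square of
    [xk] is at most [8 gamma V]; then [sqrt_growth] applies. A bound on the sums of [eta] is all
    that is asked of the averaging, so the convergence proof uses this in both cases. *)
Lemma lyap_bounded_of_sum u vv yy S K : saddle u vv yy ->
  (forall k i, enorm (row i (y k)) <= beta) ->
  (forall K, \sum_(k < K) eta k <= S) ->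
  lyap u vv yy K <= 2 * (lyap u vv yy 0 + start_defect xi) + 4 * gamma * S ^+ 2.
Proof.
move=> sdl yb eS.
have V0 k := lyap_ge0 I_ok beta gamma0 xi v y u vv yy k.
have e0 := eta_ge0 I_ok gamma v y.
pose g := Num.sqrt gamma * Num.sqrt 2.
have g2 : g ^+ 2 = 2 * gamma by rewrite /g exprMn !sqr_sqrtr ?(ltW gamma0) // mulrC.
have g0 : 0 <= g by rewrite mulr_ge0 ?sqrtr_ge0.
clearbody g.
have t0 k : 0 <= g * eta k by rewrite mulr_ge0.
have step k : lyap u vv yy k.+1 <= lyap u vv yy k
    + (if k == 0%N then start_defect xi else 0)
    + 2 * (g * eta k) * Num.sqrt (lyap u vv yy k) + (g * eta k) ^+ 2.
  apply: le_trans (lyapunov_step_weak sdl (yb k)) _; rewrite -[leRHS]addrA lerD2l.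
  have hx : enorm (xk vv yy k) <= 2 * g * Num.sqrt (lyap u vv yy k).
    rewrite -(@ler_pXn2r _ 2) ?nnegrE ?enorm_ge0 ?mulr_ge0 ?sqrtr_ge0 //.
    rewrite !exprMn g2 (sqr_sqrtr (V0 k)); apply: le_trans (xk_le_lyap I_ok beta gamma0 xi v y u vv yy k) _; lra.
  have := ler_wpM2l (e0 k) hx; rewrite /(Err _ _ _) exprMn g2.
  have := mulr_ge0 (ltW gamma0) (sqr_ge0 (eta k)); lra.
have := sqrt_growth start_defect_ge0 V0 t0 step K.
rewrite -mulr_sumr => h.
have h' : Num.sqrt (lyap u vv yy K) <= Num.sqrt (lyap u vv yy 0 + start_defect xi) + g * S.
  by apply: le_trans h _; rewrite lerD2l ler_wpM2l.
have S0 : 0 <= S by have := eS 0%N; rewrite big_ord0.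
rewrite -(sqr_sqrtr (V0 K)).
have a0 := addr_ge0 (V0 0%N) start_defect_ge0.
rewrite -(ler_pXn2r (n := 2)) ?nnegrE ?sqrtr_ge0 ?addr_ge0 ?sqrtr_ge0 ?mulr_ge0 // in h'.
apply: le_trans h' _; rewrite -{2}(sqr_sqrtr a0).
have := sqr_ge0 (Num.sqrt (lyap u vv yy 0 + start_defect xi) - g * S).
have -> : 4 * gamma * S ^+ 2 = 2 * (g * S) ^+ 2 by rewrite exprMn g2; ring.
move: (Num.sqrt _) (g * S) => p q; lra.
Qed.

Lemma known_total xs yb yt n K : saddle xs (vstar xs) (replicate N yb) ->
  enorm yb <= b -> enorm yt <= 2 * b -> enorm n <= 1 ->
  lyap xs (vstar xs + n) (replicate N yt) 0 + start_defect xi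
  + \sum_(k < K) Err (vstar xs + n) (replicate N yt) k <=
  20 * omega xs beta gamma b + 500 * (gamma * b ^+ 2 * N%:R * T ^+ 2).
Proof.
move=> sdl ybb ytb n1; have b0 := ltW b_gt0.
have g0 := ltW gamma0.
set Om := omega _ _ _ _; pose S := 4 * b * sN * T.
have sN2 : sN ^+ 2 = N%:R by rewrite sqr_sqrtr.
have h1 : lyap xs (vstar xs + n) (replicate N yt) 0 <= 9 * Om.
  have c1 : 1 <= (2 : R) by rewrite ler1n.
  have := lyap_start_omega I_ok gamma0 beta0 run xs n1 ytb c1 b0.
  by rewrite -/Om; lra.
have h2 := start_defect_omega I_ok gamma0 beta0 run sdl ybb; rewrite -/Om in h2.
have h3 : lyap xs (vstar xs) (replicate N yb) 0 <= 3 * Om.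
  have n0 : enorm (0 : 'M[R]_(N, m)) <= 1 by rewrite enorm0.
  have yb1 : enorm yb <= 1 * b by rewrite mul1r.
  have := lyap_start_omega I_ok gamma0 beta0 run xs n0 yb1 (lexx 1) b0.
  rewrite addr0 -/Om.
  have := omega_ge0 I_ok gamma0 beta0 xs b; rewrite -/Om; lra.
have hV k := lyap_bounded_of_sum k sdl y_le_known sum_eta_known.
rewrite -/S in hV.
have S0 : 0 <= S by have := sum_eta_known 0; rewrite big_ord0.
have e0 := eta_ge0 I_ok gamma v y.
have eS k : eta k <= S.
  apply: le_trans (sum_eta_known k.+1); rewrite big_ord_recr /= lerDr.
  by apply: sumr_ge0 => j _.
pose q := 1 + 3 * (gamma * (sN * b)).
pose X := Num.sqrt (8 * gamma * (10 * Om + 4 * gamma * S ^+ 2)).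
have Om0 : 0 <= Om by exact: omega_ge0.
have X0 : 0 <= 8 * gamma * (10 * Om + 4 * gamma * S ^+ 2).
  have := mulr_ge0 g0 (sqr_ge0 S) => gS.
  by apply: mulr_ge0; [rewrite mulr_ge0 | lra].
have hX k : enorm (xk (vstar xs) (replicate N yb) k) <= X.
  rewrite -(@ler_pXn2r _ 2) ?nnegrE ?enorm_ge0 ?sqrtr_ge0 // [leRHS]sqr_sqrtr //.
  apply: le_trans (xk_le_lyap I_ok beta gamma0 xi v y xs _ _ k) _.
  by apply: ler_wpM2l; [rewrite mulr_ge0 | have := hV k; lra].
have hE : \sum_(k < K) Err (vstar xs + n) (replicate N yt) k <= S * (X + q + gamma * S).
  apply: (@le_trans _ _ (\sum_(k < K) eta k * (X + q + gamma * S))).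
    apply: ler_sum => k _; rewrite ler_wpM2l // lerD //.
      by apply: le_trans (xk_test_le _ _ n1 ybb ytb) _; rewrite lerD2r.
    by rewrite ler_wpM2l.
  rewrite -mulr_suml ler_wpM2r ?sum_eta_known // !addr_ge0 ?sqrtr_ge0 //.
    by rewrite !mulr_ge0 ?sN_ge0.
  by rewrite mulr_ge0.
have gV : 0 < gamma^-1 by rewrite invr_gt0.
(* Weights chosen so that, by [hX2], the term in [X ^+ 2] contributes exactly one [Om]. *)
have hSX : S * X <= 20 * (gamma * S ^+ 2) + gamma^-1 * X ^+ 2 / 80.
  have := mulr_ge0 (ltW gV) (sqr_ge0 (40 * gamma * S - X)).
  have -> : gamma^-1 * (40 * gamma * S - X) ^+ 2 =
     1600 * (gamma * S ^+ 2) - 80 * (S * X) + gamma^-1 * X ^+ 2.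
    by field; rewrite gt_eqF.
  lra.
have hX2 : gamma^-1 * X ^+ 2 = 80 * Om + 32 * (gamma * S ^+ 2).
  by rewrite sqr_sqrtr //; field; rewrite gt_eqF.
(* These two parts of [Om] absorb the constant shift [q] between comparison points. *)
have OmE : gamma^-1 <= Om /\ gamma * (sN * b) ^+ 2 <= Om.
  have [a1 a2 a3] := omega_parts I_ok gamma0 beta0 xs b.
  have : gamma^-1 * 1 <= gamma^-1 * (enorm (vstar xs) + 1) ^+ 2.
    rewrite ler_wpM2l ?(ltW gV) //; have := enorm_ge0 (vstar xs); nra.
  have : gamma * (sN * b) ^+ 2 <= N%:R * (Cg_mean I + gamma) * b ^+ 2.
    rewrite exprMn sN2; have := mulr_ge0 (mulr_ge0 (ler0n R N) (Cg_mean_ge0 I_ok)) (sqr_ge0 b).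
    move: (N%:R : R) (Cg_mean I) => n' C; lra.
  by rewrite /Om /omega; split; lra.
have [om1 om2] := OmE.
have hS1 : S <= (gamma * S ^+ 2 + gamma^-1) / 2.
  have := mulr_ge0 (ltW gV) (sqr_ge0 (gamma * S - 1)).
  have -> : gamma^-1 * (gamma * S - 1) ^+ 2 = gamma * S ^+ 2 - 2 * S + gamma^-1.
    by field; rewrite gt_eqF.
  lra.
have hS2 : S * (3 * (gamma * (sN * b))) <= (9 * (gamma * S ^+ 2) + gamma * (sN * b) ^+ 2) / 2.
  have := mulr_ge0 g0 (sqr_ge0 (3 * S - sN * b)); lra.
have SE : gamma * S ^+ 2 = 16 * (gamma * b ^+ 2 * N%:R * T ^+ 2).
  by transitivity (16 * (gamma * b ^+ 2 * sN ^+ 2 * T ^+ 2)); [rewrite /S; ring | rewrite sN2].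
have T0 : 0 <= gamma * b ^+ 2 * N%:R * T ^+ 2.
  by have := mulr_ge0 g0 (sqr_ge0 S); rewrite SE; lra.
clearbody Om.
move: hE; rewrite /q !mulrDr mulr1; move: h1 h2 hSX hX2 hS1 hS2 SE T0 om1 om2 Om0.
have -> : S * (gamma * S) = gamma * S ^+ 2 by ring.
move: (gamma * S ^+ 2) (gamma^-1 * X ^+ 2) (gamma * (sN * b) ^+ 2) => p1 p2 p3.
move: (gamma * b ^+ 2 * N%:R * T ^+ 2) (S * X) (S * (3 * _)) => p4 p5 p6; lra.
Qed.

End KnownBound.
End ErrorBounds.

(** * Errors without a dual bound *)

Section UnknownBound.
Variables (R : realType) (I : instance R).
Hypothesis I_ok : admissible I.
Local Notation N := (nodes I).
Local Notation m := (cdim I).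
Local Notation sN := (Num.sqrt (N%:R : R)).
Local Notation T := (weight I).
Local Notation eps := (eps I).

Let P_ok : problem_ok I. Proof. by case: I_ok. Qed.
Let N0 : (0 < N)%N. Proof. exact: nodes_gt0. Qed.

Definition blowup : R := expR 17 * (T + 2).

Lemma blowup_ge1 : 1 <= blowup.
Proof.
have E1 : 1 <= (expR 17 : R) by rewrite -expR0 ler_expR.
have T0 := weight_ge0 I_ok; have := ler_pM ler01 ler01 E1 (_ : 1 <= T + 2).
by rewrite mul1r; apply; lra.
Qed.

Hypothesis enough : forall k, 24 * (k.+1%:R * eps k) <= 1.

Lemma eps_le k : eps k <= 24^-1.
Proof.
have h := enough k; have e0 := eps_ge0 I_ok k.
have : 1 <= (k.+1%:R : R) by rewrite ler1n.
move: h; move: (k.+1%:R : R) (eps k) e0 => a e e0 h a1.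
have : e <= a * e by rewrite ler_peMl.
by move=> h2; lra.
Qed.

Variables (gamma beta : R).
Hypotheses (gamma0 : 0 < gamma) (beta0 : 0 <= beta).
Variables (xi : nat -> primal I) (v y : nat -> 'M[R]_(N, m)).
Hypothesis run : dpda gamma beta xi v y.
Local Notation Err := (@Err R I gamma v y).
Local Notation eta := (@eta R I gamma v y).
Local Notation wk := (@wk R I gamma v y).
Local Notation lyap := (@lyap R I gamma beta xi v y).
Local Notation xk := (@xk R I gamma v y).

Variables (xs : primal I) (ys : 'rV[R]_m).
Hypothesis sdl : saddle xs (vstar xs) (replicate N ys).
Local Notation r := (enorm ys).
Local Notation Om := (omega xs beta gamma r).
Local Notation V := (lyap xs (vstar xs) (replicate N ys)).

(** Serves two purposes: it dominates [vstar xs + gamma *: replicate N ys], which separates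
    [gamma *: wk] from [xk], and the cost of changing the comparison point in [xk_test_le]. *)
Definition offset : R := enorm (vstar xs) + 1 + 3 * (gamma * (sN * r)).
Definition level0 : R := V 0%N + start_defect xi + gamma^-1 * offset ^+ 2.

Lemma offset_ge0 : 0 <= offset.
Proof. by rewrite /offset !addr_ge0 ?enorm_ge0 // !mulr_ge0 ?sqrtr_ge0 ?enorm_ge0 ?(ltW gamma0). Qed.

Lemma eta_le k : gamma * eta k <= eps k * (enorm (xk (vstar xs) (replicate N ys) k) + offset).
Proof.
rewrite /(eta _) mulrCA ler_wpM2l ?eps_ge0 //.
rewrite -(gtr0_norm gamma0) -enormZ gtr0_norm //.
have -> : gamma *: wk k = xk (vstar xs) (replicate N ys) k
    + (vstar xs + gamma *: replicate N ys).
  rewrite /(wk _) /(xk _ _ _) scalerDr scalerA mulfV ?gt_eqF // scale1r.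
  by apply/matrixP => i j; rewrite !mxE; ring.
apply: le_trans (enormD _ _) _; rewrite lerD2l; apply: le_trans (enormD _ _) _.
rewrite enormZ gtr0_norm //; have h := ler_wpM2l (ltW gamma0) (enorm_replicate ys).
have := mulr_ge0 (ltW gamma0) (mulr_ge0 (sqrtr_ge0 (N%:R : R)) (enorm_ge0 ys)).
rewrite /offset; lra.
Qed.

(** Origin of the factor 17: as [eps k <= 1/24], [gamma * Err] is at most [25/24 * eps] times the
    square of [|xk| + offset]. Splitting the square costs 2 and the square of [xk] is at most
    [8 gamma V], which gives [2 * 8 * 25/24 < 17]. *)
Lemma err_le vv yy k :
  enorm (xk vv yy k) <= enorm (xk (vstar xs) (replicate N ys) k) + offset ->
  Err vv yy k <= 17 * eps k * (V k + gamma^-1 * offset ^+ 2).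
Proof.
have := eta_le k; have := xk_le_lyap I_ok beta gamma0 xi v y xs (vstar xs) (replicate N ys) k.
rewrite /(Err _ _ _); have := eps_le k; have := eps_ge0 I_ok k; have := offset_ge0.
have := enorm_ge0 (xk (vstar xs) (replicate N ys) k); have := eta_ge0 I_ok gamma v y k.
move: (enorm (xk _ _ k)) (enorm (xk vv yy k)) (V k) (eps k) offset (eta k).
move=> X X' W e c h h0 X0 c0 e0 e1 XW hh XX.
rewrite -(ler_pM2l gamma0).
have -> : gamma * (17 * e * (W + gamma^-1 * c ^+ 2)) = 17 * e * (gamma * W + c ^+ 2).
  by field; rewrite gt_eqF.
have hb : X' + gamma * h <= (X + c) * (25 / 24).
  apply: (@le_trans _ _ ((X + c) + 24^-1 * (X + c))); last by lra.
  apply: lerD => //; apply: le_trans hh _; rewrite ler_wpM2r // addr_ge0 //.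
have h1 : gamma * (h * (X' + gamma * h)) <= e * (X + c) * ((X + c) * (25 / 24)).
  rewrite mulrA; apply: (@le_trans _ _ (gamma * h * ((X + c) * (25 / 24)))).
    by rewrite ler_wpM2l // mulr_ge0 // ltW.
  by rewrite ler_wpM2r // !mulr_ge0 // addr_ge0.
apply: le_trans h1 _; rewrite -!mulrA (mulrCA 17) ler_wpM2l //.
have := sqr_ge0 (X - c); have := sqr_ge0 c; have := sqr_ge0 X; lra.
Qed.

(** Adding the constant in [offset] to [V] makes the recursion homogeneous. The dual bound is
    assumed only before step [K], the form needed for the induction on the dual iterates. *)
Lemma level_growth K : (forall k, (k < K)%N -> forall i, enorm (row i (y k)) <= beta) ->
  V K + gamma^-1 * offset ^+ 2 <= growth eps K * level0.
Proof.
have e0 := eps_ge0 I_ok.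
have c0 : 0 <= gamma^-1 * offset ^+ 2 by rewrite mulr_ge0 ?sqr_ge0 ?invr_ge0 ?(ltW gamma0).
have d0 := start_defect_ge0 I_ok xi.
have V0 := lyap_ge0 I_ok beta gamma0 xi v y xs (vstar xs) (replicate N ys).
have l0 : 0 <= level0 by rewrite /level0; have := V0 0%N; lra.
have step k : (forall i, enorm (row i (y k)) <= beta) ->
    V k.+1 + gamma^-1 * offset ^+ 2 <= (1 + 17 * eps k) *
      (V k + gamma^-1 * offset ^+ 2 + (if k == 0%N then start_defect xi else 0)).
  move=> yb; have h1 := lyapunov_step_weak I_ok gamma0 run sdl yb.
  have h2 : Err (vstar xs) (replicate N ys) k <= 17 * eps k * (V k + gamma^-1 * offset ^+ 2).
    by apply: err_le; rewrite lerDl offset_ge0.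
  have : 0 <= 17 * eps k * (if k == 0%N then start_defect xi else 0).
    by apply: mulr_ge0; [rewrite mulr_ge0 | case: ifP].
  move: h1 h2; move: (if k == 0%N then _ else _) => d; lra.
case: K => [|K] yb.
  rewrite /growth big_ord0 mul1r /level0; lra.
elim: K yb => [|K IH] yb.
  apply: le_trans (step _ (yb _ _)) _ => //=.
  rewrite /growth big_ord1; apply: ler_wpM2l.
    by have := e0 0%N; lra.
  by rewrite /level0 addrAC.
apply: le_trans (step _ (yb _ _)) _ => //=.
rewrite addr0 growthS -mulrA [leRHS]mulrCA; apply: ler_wpM2l.
  by have := e0 K.+1; lra.
by apply: IH => k kK; apply: yb; exact: ltnW.
Qed.

Lemma growth_blowup K : growth eps K <= blowup.
Proof. by apply: growth_le => // [|K']; [exact: eps_ge0 | exact: sum_eps_le]. Qed.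

Lemma level0_le : level0 <= 23 * Om.
Proof.
have n0 : enorm (0 : 'M[R]_(N, m)) <= 1 by rewrite enorm0.
have yb1 : enorm ys <= 1 * r by rewrite mul1r.
have := lyap_start_omega I_ok gamma0 beta0 run xs n0 yb1 (lexx 1) (enorm_ge0 ys).
have := start_defect_omega I_ok gamma0 beta0 run sdl (lexx _).
have [a1 a2 a3] := omega_parts I_ok gamma0 beta0 xs r.
have hc : gamma^-1 * offset ^+ 2 <= 18 * Om.
  have : offset ^+ 2 <= 2 * (enorm (vstar xs) + 1) ^+ 2 + 18 * (gamma ^+ 2 * (N%:R * r ^+ 2)).
    have -> : gamma ^+ 2 * (N%:R * r ^+ 2) = (gamma * (sN * r)) ^+ 2.
      by rewrite !exprMn (sqr_sqrtr (ler0n R N)).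
    have := sqr_ge0 (enorm (vstar xs) + 1 - 3 * (gamma * (sN * r))).
    rewrite /offset; lra.
  have gV : 0 <= gamma^-1 by rewrite invr_ge0 ltW.
  move=> /(ler_wpM2l gV) h; apply: le_trans h _.
  have -> : gamma^-1 * (2 * (enorm (vstar xs) + 1) ^+ 2 + 18 * (gamma ^+ 2 * (N%:R * r ^+ 2))) =
     2 * (gamma^-1 * (enorm (vstar xs) + 1) ^+ 2) + 18 * (gamma * (N%:R * r ^+ 2)).
    by field; rewrite gt_eqF.
  have : 0 <= N%:R * Cg_mean I * r ^+ 2 by apply: mulr_ge0 (mulr_ge0 (ler0n R N) (Cg_mean_ge0 I_ok)) (sqr_ge0 r).
  move: a1 a2 a3; rewrite /omega; move: (\sum_i _) (gamma^-1 * _) => A B.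
  move: (N%:R : R) (Cg_mean I) => n' C; lra.
rewrite addr0 /level0; have := omega_ge0 I_ok gamma0 beta0 xs r; lra.
Qed.

Lemma V_le K : (forall k, (k < K)%N -> forall i, enorm (row i (y k)) <= beta) ->
  V K <= 23 * blowup * Om.
Proof.
move=> yb; have := level_growth yb.
have c0 : 0 <= gamma^-1 * offset ^+ 2 by rewrite mulr_ge0 ?sqr_ge0 ?invr_ge0 ?(ltW gamma0).
have O0 := omega_ge0 I_ok gamma0 beta0 xs r.
have : growth eps K * level0 <= blowup * (23 * Om).
  apply: ler_pM; [exact/growth_ge0/eps_ge0 | | exact: growth_blowup | exact: level0_le].
  have := lyap_ge0 I_ok beta gamma0 xi v y xs (vstar xs) (replicate N ys) 0.
  have := start_defect_ge0 I_ok xi; rewrite /level0; lra.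
lra.
Qed.

(* beta only has to exceed the bound that the estimates up to step k give for
   the next dual iterate; this closes the induction. *)
Lemma y_le_unknown :
  r + Num.sqrt (92 * blowup * Om / gamma) <= beta ->
  forall k i, enorm (row i (y k)) <= beta.
Proof.
move=> hb k; have [n] := ubnP k; elim: n k => // n IH k /ltnSE kn i.
have h := V_le (fun j jk => IH j (leq_trans jk kn)).
apply: le_trans hb.
have -> : row i (y k) = row i (replicate N ys) + row i (y k - replicate N ys).
  by rewrite -linearD /= addrC subrK.
apply: le_trans (enormD _ _) _; rewrite row_replicate lerD2l.
apply: le_trans (enorm_row_le _ _) _.
have O0 := omega_ge0 I_ok gamma0 beta0 xs r.
have P0 : 0 <= 92 * blowup * Om / gamma.
  by apply: mulr_ge0 (mulr_ge0 (mulr_ge0 (ler0n R 92) (le_trans ler01 blowup_ge1)) O0) _; rewrite invr_ge0 ltW.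
rewrite -(@ler_pXn2r _ 2) ?nnegrE ?enorm_ge0 ?sqrtr_ge0 // [leRHS]sqr_sqrtr //.
rewrite ler_pdivlMr // mulrC.
apply: le_trans (y_le_lyap I_ok beta gamma0 xi v y xs (vstar xs) (replicate N ys) k) _; lra.
Qed.

Hypothesis y_le : forall k i, enorm (row i (y k)) <= beta.

Lemma unknown_total yt n K : enorm yt <= 2 * r -> enorm n <= 1 ->
  lyap xs (vstar xs + n) (replicate N yt) 0 + start_defect xi
  + \sum_(k < K) Err (vstar xs + n) (replicate N yt) k <= 40 * blowup * Om.
Proof.
move=> ytr n1.
have c1 : 1 <= (2 : R) by rewrite ler1n.
have h1 := lyap_start_omega I_ok gamma0 beta0 run xs n1 ytr c1 (enorm_ge0 ys).
have h2 := start_defect_omega I_ok gamma0 beta0 run sdl (lexx _).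
have O0 := omega_ge0 I_ok gamma0 beta0 xs r.
have l0 : 0 <= level0.
  have := lyap_ge0 I_ok beta gamma0 xi v y xs (vstar xs) (replicate N ys) 0.
  have : 0 <= gamma^-1 * offset ^+ 2 by rewrite mulr_ge0 ?sqr_ge0 ?invr_ge0 ?(ltW gamma0).
  have := start_defect_ge0 I_ok xi; rewrite /level0; lra.
(* By [growthS] the right-hand side grows by [17 * eps K * growth eps K * level0] per step, which
   dominates the next error. *)
have hE : \sum_(k < K) Err (vstar xs + n) (replicate N yt) k <= growth eps K * level0 - level0.
  elim: K => [|K IH]; first by rewrite /growth !big_ord0 mul1r subrr.
  rewrite big_ord_recr /= growthS.
  have hx : enorm (xk (vstar xs + n) (replicate N yt) K) <=
      enorm (xk (vstar xs) (replicate N ys) K) + offset.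
    apply: le_trans (xk_test_le gamma0 v y (vstar xs) K n1 (lexx r) ytr) _.
    by rewrite /offset; have := enorm_ge0 (vstar xs); lra.
  have h17 : 0 <= 17 * eps K by rewrite mulr_ge0 // eps_ge0.
  have := ler_wpM2l h17 (level_growth (K := K) (fun k _ => y_le k)).
  have := err_le hx; lra.
have hP : growth eps K * level0 <= blowup * (23 * Om).
  by apply: ler_pM => //; [exact/growth_ge0/eps_ge0 | exact: growth_blowup | exact: level0_le].
have := ler_wpM2r O0 blowup_ge1; lra.
Qed.

(** Deliberately crude: the convergence proof only needs a bound uniform in [K], so [|xk|] is
    estimated by 1 plus its square. *)
Lemma sum_eta_unknown K :
  \sum_(k < K) eta k <= gamma^-1 * ((1 + 8 * gamma * (23 * blowup * Om) + offset) * T).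
Proof.
have O0 := omega_ge0 I_ok gamma0 beta0 xs r.
have B0 : 0 <= 23 * blowup * Om.
  by apply: mulr_ge0 (mulr_ge0 (ler0n R 23) (le_trans ler01 blowup_ge1)) O0.
have c0 := offset_ge0.
rewrite -[leLHS](mulKf (lt0r_neq0 gamma0)) ler_wpM2l ?invr_ge0 ?(ltW gamma0) //.
rewrite mulr_sumr; apply: (@le_trans _ _
   (\sum_(k < K) (1 + 8 * gamma * (23 * blowup * Om) + offset) * (k.+1%:R * eps k))).
  apply: ler_sum => k _; apply: le_trans (eta_le k) _; rewrite mulrC.
  have hX : enorm (xk (vstar xs) (replicate N ys) k) <= 1 + 8 * gamma * (23 * blowup * Om).
    have := xk_le_lyap I_ok beta gamma0 xi v y xs (vstar xs) (replicate N ys) k.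
    have g8 : 0 <= 8 * gamma by rewrite mulr_ge0 // ltW.
    have := ler_wpM2l g8 (V_le (K := k) (fun j _ => y_le j)).
    have := sqr_ge0 (enorm (xk (vstar xs) (replicate N ys) k) - 1).
    have := enorm_ge0 (xk (vstar xs) (replicate N ys) k); nra.
  apply: ler_pM.
  - by apply: addr_ge0 => //; exact: enorm_ge0.
  - exact: eps_ge0.
  - by rewrite lerD2r.
  - by rewrite ler_peMl ?eps_ge0 // ler1n.
rewrite -mulr_sumr; apply: ler_wpM2l; last exact: sum_eps_le.
have : 0 <= gamma * (23 * blowup * Om) by apply: mulr_ge0 => //; exact: ltW.
lra.
Qed.

End UnknownBound.

(** * Convergence *)

Section BoundedSeries.
Variables (R : realType) (u : nat -> R) (S : R).
Hypotheses (u0 : forall k, 0 <= u k) (uS : forall K, \sum_(k < K) u k <= S).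

Lemma bounded_series_is_cvg : cvgn (series u).
Proof.
apply: nondecreasing_is_cvgn; first by apply: nondecreasing_series => n _ _.
exists S => _ [K _ <-]; rewrite /series /= big_mkord; exact: uS.
Qed.

Lemma bounded_series_cvg0 : u @ \oo --> (0 : R).
Proof. exact: cvg_series_cvg_0 bounded_series_is_cvg. Qed.

Lemma bounded_series_tail (e : R) : 0 < e -> exists n0, forall k0 n, (n0 <= k0)%N ->
  \sum_(i < n) u (k0 + i)%N <= e.
Proof.
move=> e0; have cv := bounded_series_is_cvg.
have le_lim : forall K, series u K <= limn (series u).
  by apply: nondecreasing_cvgn_le => //; apply: nondecreasing_series => n _ _.
have /cvgrPdist_le /(_ _ e0) [n0 _ h] := cv.
exists n0 => k0 n k0n; have /= := h k0 k0n; have := le_lim (k0 + n)%N.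
rewrite /series /= !big_mkord big_split_ord /= => h1 h2.
have := ler_norm (limn (series u) - \sum_(i < k0) u i).
rewrite /series /= in h1 h2 *; lra.
Qed.

End BoundedSeries.

Lemma cvg_sub_filter (R : realType) (s : nat -> R) (l : R) (f : nat -> nat)
  (U : set_system nat) : Filter U -> \oo `<=` U -> (forall j, j <= f j)%N ->
  s @ \oo --> l -> (fun j => s (f j)) @ U --> l.
Proof.
move=> FU oU fj sl B /sl [n0 _ h]; apply: oU; exists n0 => // j /= nj.
by apply: h; exact: leq_trans nj (fj j).
Qed.

Section Convergence.
Variables (R : realType) (I : instance R).
Hypothesis I_ok : admissible I.
Local Notation N := (nodes I).
Local Notation m := (cdim I).
Local Notation Ct := (@bounded_consensus R N m (bnd I)).
Local Notation Y := (polar_cone (cone I) `&` @dual_ball R m (bnd I)).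

Let P_ok : problem_ok I. Proof. by case: I_ok. Qed.
Let N0 : (0 < N)%N. Proof. exact: nodes_gt0. Qed.

Variables (gamma beta : R).
Hypotheses (gamma0 : 0 < gamma) (beta0 : 0 <= beta).
Variables (xi : nat -> primal I) (v y : nat -> 'M[R]_(N, m)).
Hypothesis run : dpda gamma beta xi v y.
Local Notation Err := (@Err R I gamma v y).
Local Notation eta := (@eta R I gamma v y).
Local Notation wk := (@wk R I gamma v y).
Local Notation lyap := (@lyap R I gamma beta xi v y).
Local Notation xk := (@xk R I gamma v y).

Hypothesis y_le : forall k i, enorm (row i (y k)) <= beta.
Variable S : R.
Hypothesis eta_S : forall K, \sum_(k < K) eta k <= S.

Variables (xs : primal I) (y0 : 'rV[R]_m).
Hypotheses (xsP : optimal_pair xs y0) (y0B : dual_ball (bnd I) y0).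
Let sdl : saddle xs (vstar xs) (replicate N y0). Proof. exact: saddle_of_optimal. Qed.

Let B := 2 * (lyap xs (vstar xs) (replicate N y0) 0 + start_defect xi) + 4 * gamma * S ^+ 2.

Lemma lyap_le k : lyap xs (vstar xs) (replicate N y0) k <= B.
Proof. exact: lyap_bounded_of_sum. Qed.

Lemma sqr_bound (a c : R) : 0 <= c -> a ^+ 2 <= c -> a <= 1 + c.
Proof. by move=> c0 ac; have := sqr_ge0 (a - 1); nra. Qed.

Lemma B_ge0 : 0 <= B.
Proof. by apply: le_trans (lyap_le 0); exact: lyap_ge0. Qed.

Lemma v_bounded : exists c, forall k, enorm (v k) <= c.
Proof.
exists (1 + 4 * gamma * B + enorm (vstar xs)) => k.
have g4 : 0 <= 4 * gamma by rewrite mulr_ge0 // ltW.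
rewrite -[v k](subrK (vstar xs)); apply: le_trans (enormD _ _) _; rewrite lerD2r.
apply: sqr_bound; first by rewrite mulr_ge0 // B_ge0.
apply: le_trans (v_le_lyap I_ok beta gamma0 xi v y xs (vstar xs) (replicate N y0) k) _.
by rewrite ler_wpM2l // lyap_le.
Qed.

Lemma y_bounded : exists c, forall k, enorm (y k) <= c.
Proof. by exists (Num.sqrt N%:R * beta) => k; exact: enorm_le_rows. Qed.

Lemma xi_bounded i : exists c, forall k, enorm (xi k i) <= c.
Proof.
exists (1 + 2 * B + enorm (xs i)) => k.
rewrite -[xi k i](subrK (xs i)); apply: le_trans (enormD _ _) _; rewrite lerD2r.
apply: sqr_bound; first by rewrite mulr_ge0 // B_ge0.
apply: le_trans (xi_le_lyap I_ok beta gamma0 xi v y xs (vstar xs) (replicate N y0) k i) _.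
by rewrite ler_wpM2l // lyap_le.
Qed.

Lemma gstack_bounded : exists c, forall k, enorm (gstack (xi k)) <= c.
Proof.
have h i : exists c, forall k, enorm (gcon I i (xi k i)) <= c.
  have [c hc] := xi_bounded i.
  exists (Cg I i * (c + enorm (xs i)) + enorm (gcon I i (xs i))) => k.
  rewrite -[gcon I i (xi k i)](subrK (gcon I i (xs i))); apply: le_trans (enormD _ _) _.
  rewrite lerD2r; case: P_ok => _ _ _ /(_ i)[_ _ lg _ _].
  apply: le_trans (lg _ _) _; rewrite ler_wpM2l ?Cg_ge0 //.
  by apply: le_trans (enormB _ _) _; rewrite lerD2r.
have [f fP] := choice h.
have f0 i : 0 <= f i by apply: le_trans (fP i 0%N); exact: enorm_ge0.
exists (Num.sqrt N%:R * \sum_i f i) => k; apply: enorm_le_rows => [|i].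
  by apply: sumr_ge0.
rewrite row_gstack; apply: le_trans (fP i k) _; rewrite (bigD1 i) //= lerDl.
by apply: sumr_ge0.
Qed.

Lemma err_sum_bounded vv yy : exists c, forall K, \sum_(k < K) Err vv yy k <= c.
Proof.
have [cv hv] := v_bounded; have [cy hy] := y_bounded.
have e0 := eta_ge0 I_ok gamma v y.
have S0 : 0 <= S by have := eta_S 0; rewrite big_ord0.
have eS k : eta k <= S.
  apply: le_trans (eta_S k.+1); rewrite big_ord_recr /= lerDr.
  by apply: sumr_ge0 => j _.
pose c := (cv + enorm vv) + gamma * (cy + enorm yy) + gamma * S.
have hc k : enorm (xk vv yy k) + gamma * eta k <= c.
  apply: lerD; last by rewrite ler_wpM2l // ltW.
  apply: le_trans (enormD _ _) _; rewrite enormZ gtr0_norm //; apply: lerD.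
    by apply: le_trans (enormB _ _) _; rewrite lerD2r.
  rewrite ler_wpM2l ?(ltW gamma0) //.
  by apply: le_trans (enormB _ _) _; rewrite lerD2r.
have c0 : 0 <= c.
  by apply: le_trans (hc 0%N); rewrite addr_ge0 ?enorm_ge0 // mulr_ge0 // ltW.
exists (S * c) => K; apply: (@le_trans _ _ (\sum_(k < K) eta k * c)).
  by apply: ler_sum => k _; rewrite ler_wpM2l.
by rewrite -mulr_suml ler_wpM2r.
Qed.

Lemma step_sum_bounded : exists c, forall K,
  \sum_(k < K) (gamma / 4 * enorm (y k.+1 - y k) ^+ 2
                + 1 / (4 * gamma) * enorm (v k.+1 - v k) ^+ 2) <= c.
Proof.
have [c hc] := err_sum_bounded (vstar xs) (replicate N y0).
pose V := lyap xs (vstar xs) (replicate N y0).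
pose st k := gamma / 4 * enorm (y k.+1 - y k) ^+ 2
                + 1 / (4 * gamma) * enorm (v k.+1 - v k) ^+ 2.
have V0 k : 0 <= V k by exact: lyap_ge0.
exists (V 0%N + start_defect xi + c) => K.
suff : \sum_(k < K) st k + V K <= V 0%N + start_defect xi
    + \sum_(k < K) Err (vstar xs) (replicate N y0) k.
  by have := hc K; have := V0 K; rewrite /st; lra.
have d0 := start_defect_ge0 I_ok xi.
have step k : st k + V k.+1 <= V k + Err (vstar xs) (replicate N y0) k
   + (if k == 0%N then start_defect xi else 0).
  have [cmp _ _] := sdl.
  have := lyapunov_step I_ok gamma0 run cmp (y_le k); have := gap_ge0 I_ok run k sdl.
  rewrite /st /V; lra.
case: K => [|K]; first by rewrite !big_ord0; lra.
elim: K => [|K IH]; first by rewrite !big_ord1; have := step 0%N; rewrite /=; lra.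
rewrite big_ord_recr [X in _ <= _ + X]big_ord_recr /=; have := step K.+1; rewrite /=; lra.
Qed.

Lemma scaled_sqr_cvg0 (a : R) (s : nat -> R) : 0 < a -> (forall k, 0 <= s k) ->
  (fun k => a * s k ^+ 2) @ \oo --> (0 : R) -> s @ \oo --> (0 : R).
Proof.
move=> a0 s0 h.
have h2 : (fun k => s k ^+ 2) @ \oo --> (0 : R).
  rewrite -(mulr0 a^-1) (_ : (fun k => s k ^+ 2) = (fun k => a^-1 * (a * s k ^+ 2))).
    exact: cvgMl_tmp.
  by apply/funext => k; rewrite mulKf // gt_eqF.
have h3 : (fun k => Num.sqrt (s k ^+ 2)) @ \oo --> Num.sqrt (0 : R).
  by apply: continuous_cvg h2; exact: sqrt_continuous.
have e : (fun k => Num.sqrt (s k ^+ 2)) = s.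
  by apply/funext => k; rewrite sqrtr_sqr ger0_norm.
by rewrite sqrtr0 e in h3.
Qed.

Lemma dy_cvg0 : (fun k => enorm (y k.+1 - y k)) @ \oo --> (0 : R).
Proof.
have [c hc] := step_sum_bounded.
have g4 : 0 < gamma / 4 by rewrite divr_gt0.
apply: (scaled_sqr_cvg0 g4) => [k|]; first exact: enorm_ge0.
apply: (@bounded_series_cvg0 _ _ c) => [k|K].
  by rewrite mulr_ge0 ?sqr_ge0 // ltW.
apply: le_trans (hc K); apply: ler_sum => k _; rewrite lerDl mulr_ge0 ?sqr_ge0 //.
by rewrite divr_ge0 // mulr_ge0 // ltW.
Qed.

Lemma dv_cvg0 : (fun k => enorm (v k.+1 - v k)) @ \oo --> (0 : R).
Proof.
have [c hc] := step_sum_bounded.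
have g4 : 0 < 1 / (4 * gamma) by rewrite divr_gt0 // mulr_gt0.
apply: (scaled_sqr_cvg0 g4) => [k|]; first exact: enorm_ge0.
apply: (@bounded_series_cvg0 _ _ c) => [k|K].
  by rewrite mulr_ge0 ?sqr_ge0 // ltW.
apply: le_trans (hc K); apply: ler_sum => k _; rewrite lerDr mulr_ge0 ?sqr_ge0 //.
by rewrite divr_ge0 // ltW.
Qed.

Lemma eta_cvg0 : eta @ \oo --> (0 : R).
Proof. by apply: (@bounded_series_cvg0 _ _ S) => // k; exact: eta_ge0. Qed.

Definition dxi k : R := \sum_i 2^-1 * enorm (xi k.+1 i - xi k i) ^+ 2.

(** The primal inequality with the current iterate as comparison point: for a fixed dual vector the
    prox-gradient step decreases the Lagrangian. Indices start at 1 because [xi 0] may lie outside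
    the domain. *)
Lemma primal_decrease k :
  Phi (xi k.+2) - mdot (gstack (xi k.+2)) (y k.+1) + dxi k.+1 <=
  Phi (xi k.+1) - mdot (gstack (xi k.+1)) (y k.+1).
Proof.
have ud i : edom (rho I i) (xi k.+1 i) by exact: (xi_edom I_ok run).
have := primal_step I_ok run ud (y_le k.+1).
have -> : \sum_i (tau beta i)^-1 / 2 * enorm (xi k.+1 i - xi k.+1 i) ^+ 2 = 0.
  by apply: big1 => i _; rewrite subrr enorm0 expr0n /= mulr0.
have h1 : dxi k.+1 <= \sum_i (tau beta i)^-1 / 2 * enorm (xi k.+2 i - xi k.+1 i) ^+ 2.
  apply: ler_sum => i _; rewrite ler_wpM2r ?sqr_ge0 //.
  have : 1 <= (tau beta i)^-1.
    by rewrite tauVE; apply: ler_wpDr; [exact: Cg_ge0 | rewrite le_max lexx].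
  lra.
have h2 : 0 <= \sum_i Cg I i / 2 * enorm (xi k.+2 i - xi k.+1 i) ^+ 2.
  by apply: sumr_ge0 => i _; rewrite mulr_ge0 ?sqr_ge0 // divr_ge0 // Cg_ge0.
rewrite /=; lra.
Qed.

(* Without slack in the primal step-sizes the increments of xi need not be
   summable; but if they stayed away from 0 the Lagrangian would decrease to -oo. *)
Lemma dxi_small (e : R) (n : nat) : 0 < e -> exists2 k, (n <= k)%N & dxi k.+1 < e.
Proof.
move=> e0; apply: contrapT => hn.
have big k : (n <= k)%N -> e <= dxi k.+1.
  by move=> nk; rewrite leNgt; apply/negP => h; apply: hn; exists k.
have [H hH] := gstack_bounded; have [cy hcy] := y_bounded.
have H0 : 0 <= H by apply: le_trans (hH 0%N); exact: enorm_ge0.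
pose a k := Phi (xi k.+1) - mdot (gstack (xi k.+1)) (y k.+1).
(* Dual increments below this size change the Lagrangian by at most [e / 2], half of the decrease
   provided by [big]. *)
have e1 : 0 < e / 2 / (1 + H) by rewrite !divr_gt0 // ltr_pwDl.
have [n1 _ hn1] : \forall k \near \oo, enorm (y k.+1 - y k) <= e / 2 / (1 + H).
  have /cvgrPdist_le /(_ _ e1) := dy_cvg0; apply: filterS => k.
  by rewrite sub0r normrN ger0_norm ?enorm_ge0.
have dec k : (maxn n n1 <= k)%N -> a k.+1 <= a k - e / 2.
  rewrite geq_max => /andP[nk n1k].
  have := primal_decrease k; have := big k nk.
  have /= h := hn1 k.+1 (leqW n1k).
  have cs := cauchy_schwarzN (gstack (xi k.+2)) (y k.+2 - y k.+1).
  have : enorm (gstack (xi k.+2)) * enorm (y k.+2 - y k.+1) <= e / 2.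
    apply: (@le_trans _ _ ((1 + H) * (e / 2 / (1 + H)))).
      apply: ler_pM; rewrite ?enorm_ge0 //.
      by apply: le_trans (hH _) _; rewrite lerDr.
    by rewrite mulrC divfK // gt_eqF // ltr_pwDl.
  rewrite /a; move: cs; rewrite mdotBr; lra.
have lin j : a (maxn n n1 + j)%N <= a (maxn n n1) - j%:R * (e / 2).
  elim: j => [|j IH]; first by rewrite addn0 mul0r subr0.
  rewrite addnS; apply: le_trans (dec _ (leq_addr _ _)) _.
  by rewrite -(natr1 j); lra.
have [_ S1 _] := sdl.
have low k : Phi xs - mdot (gstack xs) (replicate N y0)
     - H * (cy + enorm (replicate N y0)) <= a k.
  have h1 : Phi xs - mdot (gstack xs) (replicate N y0) <=
      Phi (xi k.+1) - mdot (gstack (xi k.+1)) (replicate N y0).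
    rewrite !mdot_gstack /Phi -!sumrB; apply: ler_sum => i _; apply: S1.
    exact: (xi_edom I_ok run).
  have h2 := cauchy_schwarz (gstack (xi k.+1)) (y k.+1 - replicate N y0).
  have h3 : enorm (gstack (xi k.+1)) * enorm (y k.+1 - replicate N y0) <=
      H * (cy + enorm (replicate N y0)).
    apply: ler_pM; rewrite ?enorm_ge0 //.
    by apply: le_trans (enormB _ _) _; rewrite lerD2r.
  rewrite /a; move: h2; rewrite mdotBr; lra.
set lo := _ - _ - _ in low.
pose j := Num.bound ((a (maxn n n1) - lo) / (e / 2)).
have e2 : 0 < e / 2 by rewrite divr_gt0.
have hb : a (maxn n n1) - lo < j%:R * (e / 2).
  rewrite -ltr_pdivrMr //; apply: archi_boundP.
  by rewrite divr_ge0 ?(ltW e2) // subr_ge0.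
have := lin j; have := low (maxn n n1 + j)%N; lra.
Qed.

(** * Cluster points are saddle points *)

Section Cluster.
Variables (U : set_system nat) (f : nat -> nat).
Context {FU : ProperFilter U}.
Hypotheses (oU : \oo `<=` U) (fj : forall j, (j <= f j)%N).
Hypothesis dxi0 : (fun j => dxi (f j).+1) @ U --> (0 : R).
Variables (u : primal I) (vv yy : 'M[R]_(N, m)).
Hypotheses (xu : forall i, mx_lim U (fun j => xi (f j).+1 i) (u i))
  (vl : mx_lim U (fun j => v (f j).+1) vv) (yl : mx_lim U (fun j => y (f j).+1) yy).

Let fj1 j : (j <= (f j).+1)%N. Proof. exact: leqW. Qed.

(** The inequalities of one iteration involve two consecutive iterates; vanishing increments give
    them the same limit. *)
Lemma next_mx_lim p q (s : nat -> 'M[R]_(p, q)) A (b : nat -> R) :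
  mx_lim U (fun j => s (f j).+1) A ->
  (forall j, enorm (s (f j).+2 - s (f j).+1) <= b j) -> b @ U --> (0 : R) ->
  mx_lim U (fun j => s (f j).+2) A.
Proof.
move=> sA sb b0.
have d0 : mx_lim U (fun j => s (f j).+2 - s (f j).+1) 0.
  by apply: (@squeeze_mx_lim _ _ _ FU _ _ _ _ b) => // j; rewrite subr0.
have h : mx_lim U (fun j => s (f j).+1 + (s (f j).+2 - s (f j).+1)) (A + 0).
  exact: mx_limD.
rewrite addr0 in h; have e : (fun j => s (f j).+1 + (s (f j).+2 - s (f j).+1)) =
    (fun j => s (f j).+2) by apply/funext => j; rewrite addrC subrK.
by rewrite e in h.
Qed.

Lemma xu_next i : mx_lim U (fun j => xi (f j).+2 i) (u i).
Proof.
apply: (@next_mx_lim _ _ (fun k => xi k i) _ (fun j => Num.sqrt (2 * dxi (f j).+1)) (@xu i)) => [j|].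
  rewrite -[leLHS]ger0_norm ?enorm_ge0 // -sqrtr_sqr; apply: ler_wsqrtr.
  rewrite /dxi (bigD1 i) //=; set t := \sum_(_ | _) _.
  have : 0 <= t by apply: sumr_ge0 => l _; rewrite mulr_ge0 ?sqr_ge0.
  lra.
rewrite -sqrtr0; apply: continuous_cvg; first exact: sqrt_continuous.
by rewrite -(mulr0 2); exact: cvgMl_tmp.
Qed.

Lemma vl_next : mx_lim U (fun j => v (f j).+2) vv.
Proof.
by apply: (@next_mx_lim _ _ v _ _ vl (fun j => lexx _)); exact: (cvg_sub_filter _ oU fj1 dv_cvg0).
Qed.

Lemma yl_next : mx_lim U (fun j => y (f j).+2) yy.
Proof.
by apply: (@next_mx_lim _ _ y _ _ yl (fun j => lexx _)); exact: (cvg_sub_filter _ oU fj1 dy_cvg0).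
Qed.

Lemma gcon_mx_lim i (s : nat -> 'rV[R]_(dim i)) A :
  mx_lim U s A -> mx_lim U (fun j => gcon I i (s j)) (gcon I i A).
Proof.
move=> sA; apply: (@squeeze_mx_lim _ _ _ FU _ _ _ _ (fun j => Cg I i * enorm (s j - A))) => [j|].
  by case: P_ok => _ _ _ /(_ i)[_ _ lg _ _].
by rewrite -(mulr0 (Cg I i)); apply: cvgMl_tmp; exact: cvg_enormB.
Qed.

Lemma gstack_mx_lim (s : nat -> primal I) A : (forall i, mx_lim U (fun j => s j i) (A i)) ->
  mx_lim U (fun j => gstack (s j)) (gstack A).
Proof.
move=> sA i j; rewrite mxE; under eq_fun do rewrite mxE.
exact: (gcon_mx_lim (sA i)).
Qed.

(** Passes to the limit in the closed epigraph of [rho], with the smooth part replaced by its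
    tangent at a free point [x0], since [u] is not yet known to lie in [fdom]. Taking [x0 = xs i]
    proves that it lies in the domain; taking [x0 = u i] afterwards makes the tangent exact and
    gives [cluster_primal]. *)
Lemma rho_limit i x x0 : edom (rho I i) x -> fdom I i x0 ->
  (rho I i (u i) <= (phi x - mdot (gcon I i x) (row i yy) + mdot (gcon I i (u i)) (row i yy)
     - fsm I i x0 - mdot (gradient (fsm I i) x0) (u i - x0))%:E)%E.
Proof.
move=> xd x0d.
pose c j : R := phi x - mdot (gcon I i x) (row i (y (f j).+1))
  + (tau beta i)^-1 / 2 * (enorm (xi (f j).+1 i - x) ^+ 2 - enorm (xi (f j).+2 i - x) ^+ 2)
  + mdot (gcon I i (xi (f j).+2 i)) (row i (y (f j).+1))
  - fsm I i x0 - mdot (gradient (fsm I i) x0) (xi (f j).+2 i - x0).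
have hc j : (rho I i (xi (f j).+2 i) <= (c j)%:E)%E.
  have d := xi_edom I_ok run (f j).+1 i.
  rewrite -(edom_fineK (rho_proper P_ok i) d) lee_fin /c.
  have := node_step I_ok run xd (y_le (f j).+1 i).
  have := fsm_gradient_ineq P_ok (xi (f j).+2 i) x0d.
  have : 0 <= Cg I i / 2 * enorm (xi (f j).+2 i - xi (f j).+1 i) ^+ 2.
    by rewrite mulr_ge0 ?sqr_ge0 // divr_ge0 // Cg_ge0.
  by rewrite /phi /=; gen_vectors => *; lra.
have yr := mx_lim_row (i := i) yl.
have cl : c @ U --> (phi x - mdot (gcon I i x) (row i yy) + mdot (gcon I i (u i)) (row i yy)
     - fsm I i x0 - mdot (gradient (fsm I i) x0) (u i - x0)).
  apply: cvgB; last first.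
    by apply: cvg_mdot; [exact: mx_lim_cst | apply: mx_limB; [exact: xu_next | exact: mx_lim_cst]].
  apply: cvgB; last exact: cvg_cst.
  apply: cvgD; last by apply: cvg_mdot => //; apply: gcon_mx_lim; exact: xu_next.
  rewrite -[X in _ --> X]addr0; apply: cvgD.
    apply: cvgB; first exact: cvg_cst.
    by apply: cvg_mdot => //; exact: mx_lim_cst.
  rewrite -(mulr0 ((tau beta i)^-1 / 2)); apply: cvgMl_tmp.
  rewrite -(subrr (enorm (u i - x) ^+ 2)); apply: cvgB; apply: cvg_enorm_sqr; apply: mx_limB;
    try exact: mx_lim_cst.
    exact: xu.
  exact: xu_next.
have xl : (fun j => xi (f j).+2 i) @ U --> u i.
  by apply: cvg_enorm0; apply: cvg_enormB; exact: xu_next.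
have [_ cE _] : [/\ proper_fun (rho I i), closed_fun (rho I i) & convex_efun (rho I i)].
  by case: P_ok => _ /(_ i).
move: cl; set M := (X in _ --> X) => cl.
have pl : (fun j => (xi (f j).+2 i, c j)) @ U --> (u i, M) by apply: (@cvg_pair _ _ _ U (nbhs (u i)) (nbhs M) _ _ _ _ _ xl cl).
apply: (@closed_cvg _ _ U FU (fun j => (xi (f j).+2 i, c j)) _ cE _ (u i, M) pl).
exact: nearW.
Qed.

Lemma u_edom i : edom (rho I i) (u i).
Proof.
have [xd _ _ _ _] := optimal_pair_facts I_ok xsP.
apply: le_lt_trans (rho_limit (xd i) (edom_fdom P_ok (xd i))) _.
exact: ltry.
Qed.

Lemma cluster_primal i x : edom (rho I i) x ->
  phi (u i) - mdot (gcon I i (u i)) (row i yy) <= phi x - mdot (gcon I i x) (row i yy).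
Proof.
move=> xd; have ud := u_edom i.
have := rho_limit xd (edom_fdom P_ok ud).
rewrite -(edom_fineK (rho_proper P_ok i) ud) lee_fin subrr mdot0r /phi; lra.
Qed.

Lemma cluster_dual z : (forall i, Y (row i z)) -> 0 <= mdot (gstack u + vv) (z - yy).
Proof.
move=> zY.
pose lhs j := mdot (2 *: gstack (xi (f j).+2) - gstack (xi (f j).+1)
   + 2 *: v (f j).+2 - v (f j).+1) (y (f j).+2 - z).
pose rhs j : R := \sum_i (kappa gamma i)^-1 / 2 * enorm (row i (y (f j).+1 - z)) ^+ 2
    - \sum_i (kappa gamma i)^-1 / 2 * enorm (row i (y (f j).+2 - z)) ^+ 2.
have h j : lhs j <= rhs j.
  have := dual_step I_ok gamma0 run (f j).+1 zY; rewrite /lhs /rhs.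
  have : 0 <= \sum_i (kappa gamma i)^-1 / 2 * enorm (row i (y (f j).+2 - y (f j).+1)) ^+ 2.
    apply: sumr_ge0 => i _; rewrite mulr_ge0 ?sqr_ge0 // divr_ge0 // invr_ge0.
    by rewrite ltW // kappa_gt0.
  lra.
have lhsl : lhs @ U --> mdot (2 *: gstack u - gstack u + 2 *: vv - vv) (yy - z).
  apply: cvg_mdot; last by apply: mx_limB; [exact: yl_next | exact: mx_lim_cst].
  apply: mx_limB; last exact: vl.
  apply: mx_limD; last by apply: mx_limZ; exact: vl_next.
  apply: mx_limB; last by apply: gstack_mx_lim; exact: xu.
  by apply: mx_limZ; apply: gstack_mx_lim; exact: xu_next.
have rhsl : rhs @ U --> (0 : R).
  rewrite -(subrr (\sum_i (kappa gamma i)^-1 / 2 * enorm (row i (yy - z)) ^+ 2)).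
  apply: cvgB; apply: cvg_sumr => i; apply: cvgMl_tmp; apply: cvg_enorm_sqr;
    apply: mx_lim_row; apply: mx_limB; try exact: mx_lim_cst.
    exact: yl.
  exact: yl_next.
have := ler_cvg_to lhsl rhsl (nearW _ h).
have -> : 2 *: gstack u - gstack u + 2 *: vv - vv = gstack u + vv.
  by apply/matrixP => a b; rewrite !mxE; ring.
move=> h'; rewrite -[z - yy]opprB mdotNr oppr_ge0; exact: h'.
Qed.

Lemma cluster_rows i : Y (row i yy).
Proof.
have yr := mx_lim_row (i := i) yl; split; last first.
  apply: (dual_ball_lim (bnd_gt0 I_ok) FU _ yr).
  by apply: nearW => j; have [] := y_proj I_ok run (f j).+1 i.
move=> k kK; rewrite dotpE.
have hm : mx_lim U (fun j => - row i (y (f j).+1)) (- row i yy).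
  by rewrite -[- row i yy]sub0r; under eq_fun do rewrite -sub0r; apply: mx_limB => //; exact: mx_lim_cst.
have hk : mx_lim U (fun=> k) k by exact: mx_lim_cst.
apply: (cvgr_to_ge (cvg_mdot hm hk)); apply: nearW => j.
by have [yK _] := y_proj I_ok run (f j).+1 i; rewrite -dotpE; exact: yK.
Qed.

(** The exact projections tend to [yy]: they are within [eta] of the averager's outputs, which by
    [v_step] differ from [y] by an increment of [v] over [gamma]. The projection inequality then
    passes to the limit. *)
Lemma cluster_averaging : Ct yy /\ forall z, Ct z -> mdot vv (z - yy) <= 0.
Proof.
have [p pP] := choice (averager_proj I_ok gamma v y).
pose r k := averager I k (wk k).
have rp : mx_lim U (fun j => r (f j).+1 - p (f j).+1) 0.
  apply: (@squeeze_mx_lim _ _ _ FU _ _ _ _ (fun j => eta (f j).+1)) => [j|].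
    by rewrite subr0; exact: (pP _).2.
  exact: (cvg_sub_filter _ oU fj1 eta_cvg0).
have yr : mx_lim U (fun j => y (f j).+1 - r (f j).+1) 0.
  apply: (@squeeze_mx_lim _ _ _ FU _ _ _ _
    (fun j => gamma^-1 * enorm (v (f j).+2 - v (f j).+1))) => [j|].
    by rewrite subr0 (v_step gamma0 run) enormZ gtr0_norm // mulKf // gt_eqF.
  rewrite -(mulr0 gamma^-1); apply: cvgMl_tmp.
  exact: (cvg_sub_filter _ oU fj1 dv_cvg0).
have pl : mx_lim U (fun j => p (f j).+1) yy.
  have h : mx_lim U (fun j => y (f j).+1 - (y (f j).+1 - r (f j).+1 + (r (f j).+1 - p (f j).+1))) (yy - (0 + 0)).
    by apply: mx_limB => //; exact: mx_limD.
  have e : (fun j => y (f j).+1 - (y (f j).+1 - r (f j).+1 + (r (f j).+1 - p (f j).+1))) =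
      (fun j => p (f j).+1) by apply/funext => j; apply/matrixP => a b; rewrite !mxE; ring.
  by rewrite e addr0 subr0 in h.
have yC : Ct yy.
  by apply: (bounded_consensus_lim N0 (bnd_gt0 I_ok) FU _ pl) => j; exact: (pP _).1.1.
split=> // z zC.
have h j : mdot (v (f j).+2 + gamma *: (r (f j).+1 - p (f j).+1)) (z - p (f j).+1) <= 0.
  have := proj_ineq (bounded_consensus_convex (bnd_gt0 I_ok)) (pP (f j).+1).1 zC.
  have -> : v (f j).+2 + gamma *: (r (f j).+1 - p (f j).+1) = gamma *: (wk (f j).+1 - p (f j).+1).
    have -> : v (f j).+2 = gamma *: (wk (f j).+1 - r (f j).+1).
      rewrite -[LHS](subrK (v (f j).+1)) (v_step gamma0 run) -/(r _) /(wk _).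
      rewrite !scalerBr scalerDr scalerA mulfV ?gt_eqF // scale1r.
      by apply/matrixP => a b; rewrite !mxE; ring.
    by rewrite -scalerDr addrA subrK.
  by rewrite mdotZl pmulr_rle0.
have cl : (fun j => mdot (v (f j).+2 + gamma *: (r (f j).+1 - p (f j).+1)) (z - p (f j).+1)) @ U
    --> mdot (vv + gamma *: 0) (z - yy).
  apply: cvg_mdot; last by apply: mx_limB => //; exact: mx_lim_cst.
  by apply: mx_limD; [exact: vl_next | exact: mx_limZ].
by rewrite scaler0 addr0 in cl; apply: (cvgr_to_le cl); exact: nearW.
Qed.

Lemma cluster_saddle : saddle u vv yy.
Proof.
have [yC S2] := cluster_averaging.
split; last exact: cluster_dual; last exact: cluster_primal.
by split=> // i; [exact: u_edom | have [] := cluster_rows i].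
Qed.

Lemma lyap_cluster0 : (fun j => lyap u vv yy (f j).+1) @ U --> (0 : R).
Proof.
have d0 p q : enorm (0 : 'M[R]_(p, q)) ^+ 2 = 0 by rewrite enorm0 expr0n.
have xd i : mx_lim U (fun j => xi (f j).+1 i - u i) 0.
  by rewrite -(subrr (u i)); apply: mx_limB; [exact: xu | exact: mx_lim_cst].
have vd : mx_lim U (fun j => v (f j).+1 - vv) 0.
  by rewrite -(subrr vv); apply: mx_limB => //; exact: mx_lim_cst.
have yd : mx_lim U (fun j => y (f j).+1 - yy) 0.
  by rewrite -(subrr yy); apply: mx_limB => //; exact: mx_lim_cst.
have e : (0 : R) = \sum_i (tau beta i)^-1 / 2 * enorm (0 : 'rV[R]_(@dim _ I i)) ^+ 2
  + 1 / (2 * gamma) * enorm (0 : 'M[R]_(N, m)) ^+ 2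
  + \sum_i (kappa gamma i)^-1 / 2 * enorm (row i (0 : 'M[R]_(N, m))) ^+ 2
  + mdot ((gstack u - gstack u) + (0 : 'M[R]_(N, m))) (0 : 'M[R]_(N, m)).
  rewrite d0 mulr0 mdot0r addr0 big1 => [|i _]; last by rewrite d0 mulr0.
  by rewrite big1 ?addr0 // => i _; rewrite linear0 d0 mulr0.
rewrite [X in _ --> X]e; apply: cvgD; [apply: cvgD; [apply: cvgD|]|].
- by apply: cvg_sumr => i; apply: cvgMl_tmp; exact: cvg_enorm_sqr.
- by apply: cvgMl_tmp; exact: cvg_enorm_sqr.
- by apply: cvg_sumr => i; apply: cvgMl_tmp; apply: cvg_enorm_sqr; exact: mx_lim_row.
- apply: cvg_mdot => //; apply: mx_limD => //; apply: mx_limB; last exact: mx_lim_cst.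
  by apply: gstack_mx_lim; exact: xu.
Qed.

(** Quasi-Fejer argument: from an index where the Lyapunov function is below [e / 2] and the
    remaining errors sum to at most [e / 2], it stays below [e] for good. *)
Lemma lyap_to_cluster : lyap u vv yy @ \oo --> (0 : R).
Proof.
have sdl' := cluster_saddle; have [c hc] := err_sum_bounded vv yy.
have E0 k : 0 <= Err vv yy k by exact: err_ge0.
have V0 k : 0 <= lyap u vv yy k by exact: lyap_ge0.
apply/cvgrPdist_le => e e0; have e2 : 0 < e / 2 by rewrite divr_gt0.
have [n0 tail] := bounded_series_tail E0 hc e2.
have [j [nj Vj]] : exists j, (n0 <= (f j).+1)%N /\ lyap u vv yy (f j).+1 <= e / 2.
  have h1 : \forall j \near U, lyap u vv yy (f j).+1 <= e / 2.
    move/cvgrPdist_le : lyap_cluster0 => /(_ _ e2); apply: filterS => j.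
    by rewrite sub0r normrN ger0_norm.
  have h2 : \forall j \near U, (n0 <= j)%N by apply: oU; exists n0.
  have [j [a b]] := @filter_ex _ _ FU _ (filterI h2 h1).
  by exists j; split=> //; exact: leq_trans a (fj1 j).
have step n : lyap u vv yy ((f j).+1 + n)%N <=
    lyap u vv yy (f j).+1 + \sum_(i < n) Err vv yy ((f j).+1 + i)%N.
  elim: n => [|n IH]; first by rewrite addn0 big_ord0 addr0.
  rewrite addnS big_ord_recr /=.
  have := lyapunov_step_weak I_ok gamma0 run sdl' (y_le ((f j).+1 + n)%N).
  rewrite addSn /=; move: IH; rewrite addSn; lra.
exists (f j).+1 => // k /= jk; rewrite sub0r normrN ger0_norm //.
rewrite -(subnKC jk); apply: le_trans (step _) _.
by have := tail (f j).+1 (k - (f j).+1)%N nj; lra.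
Qed.

End Cluster.

Theorem convergence : iterates_converge xi y.
Proof.
have small j : exists k, (j <= k)%N /\ dxi k.+1 < j.+1%:R^-1.
  have e0 : 0 < (j.+1%:R^-1 : R) by rewrite invr_gt0 ltr0n.
  by have [k jk dk] := dxi_small j e0; exists k.
have [f fP] := choice small.
have [U [UU oU]] := ultraFilterLemma (eventually_filter).
have FU : ProperFilter U := @ultra_proper _ _ UU.
have fj j : (j <= f j)%N by have [] := fP j.
have d0 : (fun j => dxi (f j).+1) @ U --> (0 : R).
  have hU : (fun j => j.+1%:R^-1 : R) @ U --> (0 : R).
    by move=> A /(@cvg_harmonic R) hA; exact: oU.
  apply/cvgrPdist_lt => e e0; move/cvgrPdist_lt : hU => /(_ _ e0); apply: filterS => j.
  rewrite !sub0r !normrN ger0_norm ?invr_ge0 ?ler0n // => h.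
  rewrite ger0_norm; last by apply: sumr_ge0 => i _; rewrite mulr_ge0 ?sqr_ge0.
  by apply: lt_trans h; have [] := fP j.
have hx i : exists A, mx_lim U (fun j => xi (f j).+1 i) A.
  by have [c hc] := xi_bounded i; apply: (@bounded_mx_lim _ _ _ _ _ _ c) => j; exact: hc.
pose u : primal I := fun i => projT1 (cid (hx i)).
have xu i : mx_lim U (fun j => xi (f j).+1 i) (u i) by exact: (projT2 (cid (hx i))).
have [vv vl] : exists A, mx_lim U (fun j => v (f j).+1) A.
  by have [c hc] := v_bounded; apply: (@bounded_mx_lim _ _ _ _ _ _ c) => j; exact: hc.
have [yy yl] : exists A, mx_lim U (fun j => y (f j).+1) A.
  by have [c hc] := y_bounded; apply: (@bounded_mx_lim _ _ _ _ _ _ c) => j; exact: hc.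
have sd : saddle u vv yy by exact (cluster_saddle oU fj d0 xu vl yl).
have V0 : lyap u vv yy @ \oo --> (0 : R) by exact (lyap_to_cluster oU fj d0 xu vl yl).
have [[_ [yC _] _ _] _ _] := sd; have [yb ybE] := consensusE yC.
exists u, yb; split.
- by rewrite ybE in sd; exact (optimal_of_saddle I_ok sd).
- move=> i; apply: cvg_enorm0.
  apply: (scaled_sqr_cvg0 (ltr01 : 0 < (1 : R))) => [k|]; first exact: enorm_ge0.
  apply: (squeeze_cvgr (f := fun _ => 0) (h := fun k => 2 * lyap u vv yy k)).
  + apply: nearW => k; rewrite mul1r sqr_ge0 /=; exact: xi_le_lyap.
  + exact: cvg_cst.
  + by rewrite -(mulr0 2); exact: cvgMl_tmp.
- rewrite -ybE; apply: cvg_enorm0.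
  apply: (scaled_sqr_cvg0 gamma0) => [k|]; first exact: enorm_ge0.
  apply: (squeeze_cvgr (f := fun _ => 0) (h := fun k => 4 * lyap u vv yy k)).
  + apply: nearW => k; rewrite mulr_ge0 ?sqr_ge0 ?(ltW gamma0) //=; exact: y_le_lyap.
  + exact: cvg_cst.
  + by rewrite -(mulr0 4); exact: cvgMl_tmp.
Qed.

End Convergence.

(** * Rate constants and the choice of beta *)

Section Guarantees.
Variable R : realType.

(** With a known bound the tested multipliers have radius [2 * b] whatever [ys] is, while the rates
    weigh the violation by [|ys|]; the first factor converts one weight into the other. *)
Definition Lam (I : instance R) (xs : primal I) (ys : 'rV[R]_(cdim I)) (gamma beta : R) : R :=
  match bnd I with
  | EFin b => (1 + 2 * enorm ys / b) *
      (20 * omega xs beta gamma b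
       + 500 * (gamma * b ^+ 2 * (nodes I)%:R * weight I ^+ 2))
  | _ => 40 * blowup I * omega xs beta gamma (enorm ys)
  end.

Definition curvature (I : instance R) (xs : primal I) : R :=
  \sum_i Lg I i * enorm (xs i - start I i) ^+ 2.

(** Makes the hypothesis of [y_le_unknown] hold, [omega] being affine in [beta] with slope
    [curvature]. As 736 is 8 times 92, each of the two parts under the root is at most
    [beta ^ 2 / 8], so the root is at most [beta / 2]; [2 |ys|] covers the other half and 1 ensures
    positivity. *)
Definition betabar (I : instance R) (xs : primal I) (ys : 'rV[R]_(cdim I)) (gamma : R) : R :=
  1 + 2 * enorm ys
  + Num.sqrt (736 * blowup I * omega xs 0 gamma (enorm ys) / gamma)
  + 736 * blowup I * curvature xs / gamma.

Lemma omega_curvature (I : instance R) (xs : primal I) beta gamma r :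
  omega xs beta gamma r = omega xs 0 gamma r + beta * curvature xs.
Proof.
rewrite /omega /curvature mulr_sumr.
have -> : \sum_i (1 + Lf I i + Cg I i + beta * Lg I i) * enorm (xs i - start I i) ^+ 2 =
  \sum_i (1 + Lf I i + Cg I i + 0 * Lg I i) * enorm (xs i - start I i) ^+ 2
  + \sum_i beta * (Lg I i * enorm (xs i - start I i) ^+ 2).
  by rewrite -big_split; apply: eq_bigr => i _ /=; gen_vectors => a b c; ring.
ring.
Qed.

Lemma curvature_ge0 (I : instance R) (xs : primal I) : admissible I -> 0 <= curvature xs.
Proof.
move=> I_ok; have [P_ok _ _ _ _] := I_ok.
by apply: sumr_ge0 => i _; rewrite mulr_ge0 ?sqr_ge0 // Lg_ge0.
Qed.

Lemma betabar_gt0 (I : instance R) (xs : primal I) ys gamma : admissible I -> 0 < gamma ->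
  0 < betabar xs ys gamma.
Proof.
move=> I_ok g0; have B0 := curvature_ge0 xs I_ok.
have P0 := le_trans ler01 (blowup_ge1 I_ok).
have h : 0 <= 736 * blowup I * curvature xs / gamma.
  by apply: mulr_ge0 (mulr_ge0 (mulr_ge0 (ler0n R 736) P0) B0) _; rewrite invr_ge0 ltW.
have := enorm_ge0 ys; have := sqrtr_ge0 (736 * blowup I * omega xs 0 gamma (enorm ys) / gamma).
rewrite /betabar; lra.
Qed.

Lemma betabar_le (I : instance R) (xs : primal I) ys gamma beta : admissible I -> 0 < gamma ->
  betabar xs ys gamma <= beta ->
  enorm ys + Num.sqrt (92 * blowup I * omega xs beta gamma (enorm ys) / gamma) <= beta.
Proof.
move=> I_ok g0 hb; have B0 := curvature_ge0 xs I_ok.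
have P0 := le_trans ler01 (blowup_ge1 I_ok).
have O0 := omega_ge0 I_ok g0 (lexx 0) xs (enorm ys).
have gV : 0 <= gamma^-1 by rewrite invr_ge0 ltW.
have a0 : 0 <= 736 * blowup I * omega xs 0 gamma (enorm ys) / gamma.
  by apply: mulr_ge0 (mulr_ge0 (mulr_ge0 (ler0n R 736) P0) O0) gV.
have c0 : 0 <= 736 * blowup I * curvature xs / gamma.
  by apply: mulr_ge0 (mulr_ge0 (mulr_ge0 (ler0n R 736) P0) B0) gV.
have y0 := enorm_ge0 ys.
move: hb; rewrite /betabar (omega_curvature xs beta).
have -> : 92 * blowup I * (omega xs 0 gamma (enorm ys) + beta * curvature xs) / gamma =
   (736 * blowup I * omega xs 0 gamma (enorm ys) / gamma) / 8
   + beta * (736 * blowup I * curvature xs / gamma) / 8.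
  by field; rewrite gt_eqF.
move: a0 c0; set a := 736 * _ * omega _ _ _ _ / _; set c := 736 * _ * curvature _ / _.
clearbody a c; move: (enorm ys) y0 => y y0 a0 c0 hb.
have s0 := sqrtr_ge0 a; have sE := sqr_sqrtr a0.
have b0 : 0 <= beta by lra.
suff h : Num.sqrt (a / 8 + beta * c / 8) <= beta / 2 by lra.
rewrite -(@ler_pXn2r _ 2) ?nnegrE ?sqrtr_ge0 ?divr_ge0 // sqr_sqrtr; last first.
  by have := mulr_ge0 b0 c0; lra.
have h1 : a <= beta ^+ 2 by rewrite -sE ler_pXn2r ?nnegrE //; lra.
have h2 : beta * c <= beta ^+ 2 by rewrite expr2 ler_wpM2l //; lra.
lra.
Qed.

Lemma enough_rounds_eps (I : instance R) : admissible I -> enough_rounds I ->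
  forall k, 24 * (k.+1%:R * eps I k) <= 1.
Proof.
move=> I_ok er k; have NG := NGam_gt0 I_ok.
have [_ _ _ _ [[_ /andP[a0 a1] _ _ _] _]] := I_ok.
have k0 : 0 < (k.+1%:R : R) by rewrite ltr0n.
have aV : 1 < (alpha I)^-1 by rewrite invf_gt1.
have lV : 0 < ln (alpha I)^-1 by rewrite ln_gt0.
have x0 : 0 < 24 * (nodes I)%:R * Gam I * k.+1%:R.
  by rewrite -(mulrA 24) mulr_gt0 // mulr_gt0.
have := er k; rewrite ler_pdivrMr // [leRHS]mulr_natl -lnXn ?invr_gt0 //.
rewrite ler_ln ?posrE ?exprn_gt0 ?invr_gt0 // exprVn => h.
have ap : 0 < alpha I ^+ rounds I k by rewrite exprn_gt0.
have := ler_wpM2r (ltW ap) h; rewrite mulVf ?gt_eqF // /eps; lra.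
Qed.

(** Any optimal [xs] may be paired with the dual optimum [y0] of norm at most [b], optimality of a
    pair being optimality of each component. *)
Lemma known_bound_guarantees (I : instance R) (b gamma : R) : admissible I ->
  bnd I = b%:E -> 0 < gamma -> guarantees (@Lam I) gamma (2 * b).
Proof.
move=> I_ok bE g0 xi v y run.
have b0 : 0 < b by have := bnd_gt0 I_ok; rewrite bE lte_fin.
have beta0 : 0 <= 2 * b by rewrite mulr_ge0 // ltW.
have [P_ok _ [[xs0 [ys0 xs0P]] _] [_ [y0 y0P y0b]] _] := I_ok.
have K_closed : closed (cone I) by case: P_ok => [[]].
have K_cone : convex_cone (cone I) by case: P_ok => [[]].
rewrite bE lee_fin in y0b.
have y0B : dual_ball (bnd I) y0 by rewrite bE dual_ball_finE; lra.
have y_le := y_le_known I_ok run bE (erefl (2 * b)).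
have etaS := sum_eta_known I_ok g0 run bE (erefl (2 * b)).
split.
  have xy0 : optimal_pair xs0 y0 by split=> //; case: xs0P.
  exact: (convergence I_ok g0 beta0 run y_le etaS xy0 y0B).
move=> xs ys xsP.
have xy0 : optimal_pair xs y0 by split=> //; case: xsP.
have sdl := saddle_of_optimal I_ok xy0 y0B.
pose L := 20 * omega xs (2 * b) gamma b + 500 * (gamma * b ^+ 2 * (nodes I)%:R * weight I ^+ 2).
have ratio0 : 0 <= 2 * enorm ys / b.
  by rewrite divr_ge0 ?(ltW b0) // mulr_ge0 // enorm_ge0.
have L0 : 0 <= L.
  have Om0 := omega_ge0 I_ok g0 beta0 xs b.
  have q0 := mulr_ge0 (mulr_ge0 (mulr_ge0 (ltW g0) (sqr_ge0 b)) (ler0n R (nodes I))) (sqr_ge0 (weight I)).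
  exact (addr_ge0 (mulr_ge0 (ler0n R 20) Om0) (mulr_ge0 (ler0n R 500) q0)).
have LamE : Lam xs ys gamma (2 * b) = (1 + 2 * enorm ys / b) * L by rewrite /Lam bE.
rewrite LamE; apply: (rate_bounds_intro I_ok xsP).
  by apply: mulr_ge0 => //; lra.
move=> K xib.
have ball (d : 'rV[R]_(cdim I)) : enorm d <= 1 -> dual_ball (bnd I) ((2 * b) *: d).
  by move=> d1; rewrite bE dual_ball_finE enormZ ger0_norm // ler_piMr.
have total yt n : (polar_cone (cone I) `&` dual_ball (bnd I)) yt -> enorm yt <= 2 * b ->
    (forall C, consensus C -> mdot n C = 0) -> enorm n <= 1 ->
    lyap gamma (2 * b) xi v y xs (vstar xs + n) (replicate (nodes I) yt) 0 + start_defect xi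
     + \sum_(k < K.+1) Err gamma v y (vstar xs + n) (replicate (nodes I) yt) k <= L.
  by move=> _ yt2 _ n1; exact: (known_total I_ok g0 beta0 run bE (erefl _) K.+1 sdl y0b yt2 n1).
have [xd h] := core_rate I_ok g0 run y_le xsP (ltW b0) ball total.
split; [exact: xd | rewrite -/xib in h].
have [_ hs _ _ y0K] := optimal_pair_facts I_ok xy0.
set d := eucl_dist (cone I) _ in h *; set dC := eucl_dist (@consensus _ _ _) _ in h *.
have dC0 : 0 <= dC.
  by rewrite /dC (eucl_dist_proj (average_proj (nodes_gt0 I_ok) _)) enorm_ge0.
have d0 : 0 <= d.
  rewrite /d; have [z [zP _ _]] := cone_proj K_closed K_cone (- gsum xib).
  by rewrite (eucl_dist_proj zP) enorm_ge0.
have g1 : - (b * d) <= Phi xib - Phi xs.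
  have := hs _ xd; have := polar_dist K_closed K_cone (- gsum xib) y0K.
  have := ler_wpM2r d0 y0b; rewrite -/d mdotNr mdotC; lra.
(* [core_rate] controls [2 * b * d], while the lower bound through [y0] consumes only [b * d]. Hence
   [b * d] is itself of order [1 / K], and any multiple of it can be added. *)
have bd : b * d <= L / K.+1%:R by move: h; move: (L / _) => q; lra.
have := ler_wpM2l ratio0 bd.
have -> : 2 * enorm ys / b * (b * d) = 2 * enorm ys * d by field; rewrite gt_eqF.
have -> : (1 + 2 * enorm ys / b) * L / K.+1%:R =
   L / K.+1%:R + 2 * enorm ys / b * (L / K.+1%:R) by rewrite mulrDl mul1r mulrDl !mulrA.
have := mulr_ge0 (ltW b0) d0.
move: h; move: (L / K.+1%:R) (2 * enorm ys / b) => q p; lra.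
Qed.

(** One optimal pair fixes [beta] and bounds the dual iterates; once this is done, the error
    estimates hold around every other pair [xs'], [ys']. *)
Lemma unknown_bound_guarantees (I : instance R) (gamma beta : R) (xs : primal I) ys :
  admissible I -> bnd I = +oo%E -> enough_rounds I -> 0 < gamma -> optimal_pair xs ys ->
  betabar xs ys gamma <= beta -> guarantees (@Lam I) gamma beta.
Proof.
move=> I_ok bE er g0 xsP hb xi v y run.
have beta0 : 0 <= beta by apply: le_trans hb; apply: ltW; exact: betabar_gt0.
have enough := enough_rounds_eps I_ok er.
have ball (yt : 'rV[R]_(cdim I)) : dual_ball (bnd I) yt by rewrite bE; exact: dual_ball_pinfty.
have sdl := saddle_of_optimal I_ok xsP (ball ys).
have y_le := y_le_unknown I_ok enough g0 beta0 run sdl (betabar_le I_ok g0 hb).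
have etaS := sum_eta_unknown I_ok enough g0 beta0 run sdl y_le.
split; first exact: (convergence I_ok g0 beta0 run y_le etaS xsP (ball ys)).
move=> xs' ys' xsP'; have sdl' := saddle_of_optimal I_ok xsP' (ball ys').
have LamE : Lam xs' ys' gamma beta = 40 * blowup I * omega xs' beta gamma (enorm ys').
  by rewrite /Lam bE.
rewrite LamE; apply: (rate_bounds_intro I_ok xsP').
  apply: mulr_ge0; last exact: omega_ge0.
  by apply: mulr_ge0 => //; exact: le_trans ler01 (blowup_ge1 I_ok).
move=> K xib.
have total yt n : (polar_cone (cone I) `&` dual_ball (bnd I)) yt -> enorm yt <= 2 * enorm ys' ->
    (forall C, consensus C -> mdot n C = 0) -> enorm n <= 1 ->
    lyap gamma beta xi v y xs' (vstar xs' + n) (replicate (nodes I) yt) 0 + start_defect xi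
     + \sum_(k < K.+1) Err gamma v y (vstar xs' + n) (replicate (nodes I) yt) k <=
    40 * blowup I * omega xs' beta gamma (enorm ys').
  by move=> _ yt2 _ n1; exact: (unknown_total I_ok enough g0 beta0 run sdl' y_le).
exact: (core_rate I_ok g0 run y_le xsP' (enorm_ge0 ys') (fun d _ => ball _) total).
Qed.

End Guarantees.

(** * Estimates of the constants *)

Ltac ge0 := solve [repeat first [assumption | exact: sqr_ge0 | exact: ltW | exact: ler01
  | exact: ler0n | apply: mulr_ge0 | apply: addr_ge0]].

Section RealEstimates.
Variable R : realType.
Variables (s T d M : R).
Hypotheses (s1 : 1 <= s) (d0 : 0 < d) (dT : d <= T).

Let s0 : 0 < s. Proof. exact: lt_le_trans ltr01 s1. Qed.
Let T0 : 0 < T. Proof. exact: lt_le_trans d0 dT. Qed.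
Let dV : 0 < d^-1. Proof. by rewrite invr_gt0. Qed.

Ltac tidy := clear - s1 d0 dT s0 T0 dV M.

(** Absorption of lower-order terms: a quantity at least [d] is inserted as a factor at the price of
    [d^-1]. The lower bounds [delta] of the O-estimates enter in this way. *)
Lemma le_ratio (x a : R) : d <= a -> 0 <= x -> x <= d^-1 * (a * x).
Proof. by move=> da x0; rewrite mulrA ler_peMl // mulrC ler_pdivlMr // mul1r. Qed.

Lemma le_ratio2 (x a b : R) : d <= a -> d <= b -> 0 <= x -> x <= d^-1 * d^-1 * (a * (b * x)).
Proof.
move=> da db x0; have x1 := le_ratio db x0.
apply: le_trans x1 _; rewrite -mulrA ler_wpM2l ?(ltW dV) //.
by apply: le_ratio => //; rewrite mulr_ge0 // (le_trans (ltW d0)).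
Qed.

Definition c_known : R := 5 * (20 * (d^-1 + d^-1 * d^-1 + (M + 1) ^+ 2 + 3) + 500).

Lemma estimate_known (b Rx2 C v D0 B y g : R) : g = (s * T * b)^-1 ->
  d <= b -> 0 <= Rx2 -> 0 <= C -> 0 <= v -> v <= M ->
  D0 <= s ^+ 2 * Rx2 -> B <= s ^+ 2 * Rx2 -> 0 <= y -> y <= 2 * b ->
  (1 + 2 * y / b) * (20 * (D0 + 2 * b * B + g^-1 * (v + 1) ^+ 2 + s ^+ 2 * (C + g) * b ^+ 2)
     + 500 * (g * b ^+ 2 * s ^+ 2 * T ^+ 2)) <=
  c_known * (s ^+ 2 * b * (Rx2 + C * b) + s * T * b).
Proof.
move=> gE db R0 C0 v0 vM hD hB y0 yb.
have b0 : 0 < b := lt_le_trans d0 db.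
have A0 : 0 <= s ^+ 2 * Rx2 by ge0.
have W0 : 0 < s * T * b by rewrite !mulr_gt0.
have hA := le_ratio db A0.
have hv : (v + 1) ^+ 2 <= (M + 1) ^+ 2 by rewrite ler_pXn2r ?nnegrE //; lra.
have hv' := ler_wpM2l (ltW W0) hv.
have hBb := ler_wpM2l (ltW b0) hB.
have e1 : g * b ^+ 2 * s ^+ 2 * T ^+ 2 = s * T * b.
  by rewrite gE; field; rewrite !gt_eqF.
have e2 : s ^+ 2 * (C + g) * b ^+ 2 = s ^+ 2 * C * b ^+ 2 + s * b / T.
  by rewrite gE; field; rewrite !gt_eqF.
have hg : s * b / T <= d^-1 * d^-1 * (s * T * b).
  have sb : 0 <= s * b / T by rewrite divr_ge0 ?(ltW T0) // mulr_ge0 ?(ltW s0) // ltW.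
  apply: le_trans (le_ratio2 dT dT sb) _.
  by rewrite le_eqVlt; apply/orP; left; apply/eqP; field; rewrite !gt_eqF.
have Cb0 : 0 <= s ^+ 2 * C * b ^+ 2 by ge0.
have m0 : 0 <= (M + 1) ^+ 2 by exact: sqr_ge0.
have dd0 : 0 <= d^-1 * d^-1 by ge0.
have ge : g^-1 = s * T * b by rewrite gE invrK.
have ratio : 1 + 2 * y / b <= 5.
  have : 2 * y / b <= 4 by rewrite ler_pdivrMr //; lra.
  lra.
have ratio0 : 0 <= 1 + 2 * y / b by rewrite addr_ge0 // divr_ge0 ?(ltW b0) // mulr_ge0.
set E := s ^+ 2 * b * (Rx2 + C * b) + s * T * b.
pose k := d^-1 + d^-1 * d^-1 + (M + 1) ^+ 2 + 3.
have k0 : 0 <= k by rewrite /k; have := ltW dV; lra.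
have bA0 : 0 <= b * (s ^+ 2 * Rx2) by ge0.
have E0 : 0 <= E by rewrite /E; lra.
have big : 20 * (D0 + 2 * b * B + g^-1 * (v + 1) ^+ 2 + s ^+ 2 * (C + g) * b ^+ 2)
     + 500 * (g * b ^+ 2 * s ^+ 2 * T ^+ 2) <= (20 * k + 500) * E.
  rewrite e1 e2 ge.
  have EE : E = b * (s ^+ 2 * Rx2) + s ^+ 2 * C * b ^+ 2 + s * T * b by rewrite /E; ring.
  have t1 := mulr_ge0 (ltW dV) Cb0; have t2 := mulr_ge0 (ltW dV) (ltW W0).
  have t3 := mulr_ge0 dd0 Cb0; have t4 := mulr_ge0 dd0 bA0.
  have t5 := mulr_ge0 m0 Cb0; have t6 := mulr_ge0 m0 bA0.
  rewrite EE /k; move: (s ^+ 2 * C * b ^+ 2) (s * b / T) (s * T * b) W0 Cb0 hv' hg t1 t2 t3 t4 t5 t6.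
  move: hA hD hBb bA0; rewrite -(mulrA 2 b B).
  move: (s ^+ 2 * Rx2) (b * B) ((M + 1) ^+ 2) ((v + 1) ^+ 2) (d^-1 * d^-1) => p q r t u.
  move: (b * p) (d^-1) => bp dd *; lra.
apply: le_trans (ler_wpM2l ratio0 big) _.
have kE : 0 <= (20 * k + 500) * E by apply: mulr_ge0 E0; move: k0; tidy; lra.
apply: le_trans (ler_wpM2r kE ratio) _.
by rewrite /c_known -/k mulrA.
Qed.

Definition k_unknown : R := d^-1 + (M + 1) ^+ 2 * d^-1 ^+ 6 + M * d^-1 ^+ 3 + 1.
Definition p_unknown (e : R) : R := e * (1 + 2 * d^-1).
Definition c_unknown (e : R) : R :=
  let p := p_unknown e in
  40 * p * (k_unknown + (4 * d^-1 + 736 * p * d^-1 + 368 * p * k_unknown)) * d^-1.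

(** [G] is the scale of [Om0] and [W] that of the chosen [beta]. Since [W] times the bound on the
    curvature term [B] is again [G], the large [beta] does not worsen the order. *)
Lemma estimate_unknown (e P Rx C v D0 B X y g : R) :
  1 <= e -> P = e * (T + 2) -> g = s * T * Rx ^+ 2 -> d <= Rx ->
  0 <= C -> C <= M -> 0 <= v -> v <= M -> D0 <= s ^+ 2 * Rx ^+ 2 ->
  0 <= B -> B <= s ^+ 2 * Rx ^+ 2 -> 0 <= y -> 1 <= X -> y ^+ 2 <= X ->
  let Om0 := D0 + g^-1 * (v + 1) ^+ 2 + s ^+ 2 * (C + g) * y ^+ 2 in
  0 <= Om0 ->
  40 * P * (Om0 + (1 + 2 * y + Num.sqrt (736 * P * Om0 / g) + 736 * P * B / g) * B) <=
  c_unknown e * (s ^+ 2 * s * T ^+ 3 * Rx ^+ 2 * X).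
Proof.
move=> e1 PE gE dR C0 CM v0 vM hD B0 hB y0 X1 yX Om0 Om00.
have Rx0 : 0 < Rx := lt_le_trans d0 dR.
have R20 : 0 < Rx ^+ 2 by rewrite exprn_gt0.
have g0 : 0 < g by rewrite gE !mulr_gt0.
have M0 : 0 <= M := le_trans v0 vM.
have p0 : 0 <= p_unknown e by rewrite /p_unknown mulr_ge0 ?addr_ge0 ?mulr_ge0 ?(ltW dV) // (le_trans ler01 e1).
have n1 : 1 <= s ^+ 2 by rewrite exprn_ege1.
have n0 : 0 < s ^+ 2 by rewrite exprn_gt0.
have P0 : 0 <= P by rewrite PE mulr_ge0 ?(le_trans ler01 e1) // addr_ge0 // ltW.
have PT : P <= p_unknown e * T.
  have := le_ratio dT (ler01 : (0 : R) <= 1); rewrite mulr1 => h.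
  have e0 : 0 <= e by lra.
  have := ler_wpM2l e0 h; rewrite PE /p_unknown; lra.
have X0 : 0 <= X by lra.
pose G := g * s ^+ 2 * X.
have gnX : g <= G.
  rewrite /G -mulrA ler_peMr ?(ltW g0) //.
  by have := ler_pM ler01 ler01 n1 X1; rewrite mulr1.
have G0 : 0 < G := lt_le_trans g0 gnX.
(* A lower bound on [g] lets constants and even [g^-1] be absorbed into multiples of [g]. *)
have g3 : d ^+ 3 <= g.
  have h1 : d <= s * T by have := ler_pM ler01 (ltW d0) s1 dT; rewrite mul1r.
  have h2 : d ^+ 2 <= Rx ^+ 2 by rewrite ler_pXn2r ?nnegrE ?(ltW d0) // ltW.
  by rewrite gE exprS; apply: ler_pM => //; rewrite ?sqr_ge0 ?(ltW d0).
have d3 : 0 < d ^+ 3 by rewrite exprn_gt0.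
have dV3 : 0 <= d^-1 ^+ 3 by rewrite exprn_ge0 // ltW.
have dV6 : 0 <= d^-1 ^+ 6 by rewrite exprn_ge0 // ltW.
have one_g : 1 <= d^-1 ^+ 3 * g by rewrite exprVn mulrC ler_pdivlMr // mul1r.
have gV : g^-1 <= d^-1 ^+ 6 * g.
  rewrite -[leLHS]mul1r ler_pdivrMr // -mulrA -expr2.
  have := ler_pM ler01 ler01 one_g one_g; rewrite mul1r => h; apply: le_trans h _.
  by rewrite le_eqVlt; apply/orP; left; apply/eqP; ring.
have b1 : D0 <= d^-1 * G.
  apply: le_trans hD _.
  have : s ^+ 2 * Rx ^+ 2 <= s ^+ 2 * (d^-1 * g) * X.
    apply: (@le_trans _ _ (s ^+ 2 * (d^-1 * g))).
      rewrite ler_wpM2l ?(ltW n0) // gE.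
      have hT := le_ratio dT (ltW R20); apply: le_trans hT _.
      rewrite ler_wpM2l ?(ltW dV) // -(mulrA s) ler_peMl //.
      by rewrite mulr_ge0 ?(ltW T0) ?(ltW R20).
    by rewrite ler_peMr // mulr_ge0 ?(ltW n0) // mulr_ge0 ?(ltW dV) // ltW.
  by rewrite /G; lra.
have b2 : g^-1 * (v + 1) ^+ 2 <= (M + 1) ^+ 2 * d^-1 ^+ 6 * G.
  have hv : (v + 1) ^+ 2 <= (M + 1) ^+ 2 by rewrite ler_pXn2r ?nnegrE //; move: v0 vM; tidy; lra.
  apply: (@le_trans _ _ (d^-1 ^+ 6 * g * (M + 1) ^+ 2)).
    by apply: ler_pM; rewrite ?sqr_ge0 // invr_ge0 ltW.
  have := ler_wpM2l (mulr_ge0 dV6 (sqr_ge0 (M + 1))) gnX; lra.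
have nX : s ^+ 2 * y ^+ 2 <= s ^+ 2 * X by rewrite ler_wpM2l // ltW.
have b3 : s ^+ 2 * C * y ^+ 2 <= M * d^-1 ^+ 3 * G.
  apply: (@le_trans _ _ (M * (s ^+ 2 * X))).
    have := ler_pM C0 (mulr_ge0 (ltW n0) (sqr_ge0 y)) CM nX; lra.
  have := ler_wpM2r (mulr_ge0 M0 (mulr_ge0 (ltW n0) X0)) one_g; rewrite mul1r /G; lra.
have b4 : s ^+ 2 * g * y ^+ 2 <= G.
  have := ler_wpM2l (ltW g0) nX; rewrite /G; lra.
have bOm : Om0 <= k_unknown * G.
  rewrite /Om0 /k_unknown; lra.
have k0 : 0 <= k_unknown.
  rewrite /k_unknown; have := mulr_ge0 (sqr_ge0 (M + 1)) dV6; have := mulr_ge0 M0 dV3.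
  have := ltW dV; lra.
pose p := p_unknown e; pose k := k_unknown.
pose W := s * X * T.
have W0 : 0 <= W by rewrite /W !mulr_ge0 ?(ltW s0) ?(ltW T0).
have dW : s * X <= d^-1 * W.
  have := le_ratio dT (mulr_ge0 (ltW s0) X0); rewrite /W; lra.
have sX : 1 <= s * X by have := ler_pM ler01 ler01 s1 X1; rewrite mulr1.
have c1 : Num.sqrt (736 * P * Om0 / g) <= d^-1 * W + 368 * p * k * W.
  have h1 : 736 * P * Om0 / g <= s ^+ 2 * (736 * p * k * T * X).
    rewrite ler_pdivrMr //.
    have := ler_pM P0 Om00 PT bOm; rewrite /G -/p -/k; lra.
  apply: le_trans (ler_wsqrtr h1) _.
  have q0 : 0 <= 736 * p * k * T * X.
    exact (mulr_ge0 (mulr_ge0 (mulr_ge0 (mulr_ge0 (ler0n R 736) p0) k0) (ltW T0)) X0).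
  rewrite sqrtrM ?sqr_ge0 // sqrtr_sqr gtr0_norm //.
  (* The root is linearized by [sqrt q <= (1 + q) / 2], with [1 <= X]; 368 is half of 736. *)
  have h2 : Num.sqrt (736 * p * k * T * X) <= X + 368 * p * k * T * X.
    have := sqr_ge0 (Num.sqrt (736 * p * k * T * X) - 1).
    rewrite sqrrB1 sqr_sqrtr //; move: X1; tidy; lra.
  have := ler_wpM2l (ltW s0) h2; move: dW; rewrite /W; tidy; lra.
have c2 : 736 * P * B / g <= 736 * p * d^-1 * W.
  apply: (@le_trans _ _ (736 * p * s)).
    rewrite ler_pdivrMr //.
    have := ler_pM P0 B0 PT hB; rewrite gE -/p; tidy; lra.
  have hs : s <= d^-1 * W by apply: le_trans dW; rewrite ler_peMr // ltW.
  have p7 : 0 <= 736 * p := mulr_ge0 (ler0n R 736) p0.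
  have := ler_wpM2l p7 hs; tidy; lra.
have yX' : y <= X.
  by have := sqr_ge0 (y - 1); rewrite sqrrB1; move: yX X1; tidy; lra.
have c3 : 1 + 2 * y <= 3 * d^-1 * W.
  have : X <= s * X by rewrite ler_peMl.
  move: dW X1 yX'; tidy; lra.
have bW : 1 + 2 * y + Num.sqrt (736 * P * Om0 / g) + 736 * P * B / g <=
   (4 * d^-1 + 736 * p * d^-1 + 368 * p * k) * W.
  by move: c1 c2 c3; tidy; lra.
set beta := 1 + 2 * y + _ + _ in bW *.
set k2 := 4 * d^-1 + _ + _ in bW.
have k20 : 0 <= k2.
  have pk : 0 <= p * k := mulr_ge0 p0 k0.
  have pd : 0 <= p * d^-1 := mulr_ge0 p0 (ltW dV).
  by rewrite /k2; move: (ltW dV) pk pd; rewrite -!(mulrA 736) -(mulrA 368);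
     move: (p * k) (p * d^-1) (d^-1); tidy => *; lra.
have WB : W * (s ^+ 2 * Rx ^+ 2) = G by rewrite /W /G gE; ring.
have bB : beta * B <= k2 * G.
  apply: (@le_trans _ _ (k2 * W * B)); first by rewrite ler_wpM2r.
  rewrite -(mulrA k2); apply: ler_wpM2l => //.
  by rewrite -WB; exact: ler_wpM2l.
have kk : Om0 + beta * B <= (k + k2) * G by rewrite [leRHS]mulrDl; exact (lerD bOm bB).
have kk0 : 0 <= (k + k2) * G by ge0.
have h3 : P * (Om0 + beta * B) <= p * T * ((k + k2) * G).
  apply: le_trans (ler_wpM2l P0 kk) _; exact: ler_wpM2r.
(* The bound obtained is only of order [T ^ 2]; a third factor [T] is inserted to reach the stated
   form. *)
have h4 : p * T * ((k + k2) * G) <= d^-1 * (T * (p * T * ((k + k2) * G))).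
  by apply: le_ratio => //; rewrite mulr_ge0 // mulr_ge0 // ltW.
have -> : c_unknown e * (s ^+ 2 * s * T ^+ 3 * Rx ^+ 2 * X) =
   40 * (d^-1 * (T * (p * T * ((k + k2) * G)))).
  by rewrite /c_unknown -/p -/k -/k2 /G gE; ring.
rewrite -mulrA; apply: ler_wpM2l => //; exact: le_trans h3 h4.
Qed.

Definition c_affine (e : R) : R :=
  40 * p_unknown e * (d^-1 + (M + 1) ^+ 2 * d^-1 + d^-1 + d^-1 * d^-1 * d^-1).

(** The terms in [g^-1] and [g] carry no factor [C]; the lower bound on [C] lets them be absorbed
    into [C * X]. *)
Lemma estimate_affine (e P Rx2 C v D0 X y g : R) :
  1 <= e -> P = e * (T + 2) -> g = (s * T)^-1 -> 0 <= Rx2 ->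
  d <= C -> 0 <= v -> v <= M -> D0 <= s ^+ 2 * Rx2 -> 1 <= X -> y ^+ 2 <= X ->
  0 <= D0 ->
  40 * P * (D0 + g^-1 * (v + 1) ^+ 2 + s ^+ 2 * (C + g) * y ^+ 2) <=
  c_affine e * (s ^+ 2 * T ^+ 2 * (Rx2 + C * X)).
Proof.
move=> e1 PE gE R0 dC v0 vM hD X1 yX D00.
have n0 : 0 < s ^+ 2 by rewrite exprn_gt0.
have M0 : 0 <= M := le_trans v0 vM.
have C0 : 0 < C := lt_le_trans d0 dC.
have X0 : 0 < X := lt_le_trans ltr01 X1.
have e0 : 0 <= e by lra.
have PT : P <= p_unknown e * T.
  have := le_ratio dT (ler01 : (0 : R) <= 1); rewrite mulr1 => h.
  have := ler_wpM2l e0 h; rewrite PE /p_unknown; lra.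
have p0 : 0 <= p_unknown e by rewrite /p_unknown mulr_ge0 ?addr_ge0 ?mulr_ge0 ?(ltW dV).
pose E := s ^+ 2 * T ^+ 2 * (Rx2 + C * X).
have CX0 : 0 <= s ^+ 2 * T ^+ 2 * (C * X).
  by rewrite mulr_ge0 ?mulr_ge0 ?sqr_ge0 // ltW.
have RX0 : 0 <= s ^+ 2 * T ^+ 2 * Rx2 by ge0.
have EE : E = s ^+ 2 * T ^+ 2 * Rx2 + s ^+ 2 * T ^+ 2 * (C * X) by rewrite /E mulrDr.
have gVE : g^-1 = s * T by rewrite gE invrK.
have t1 : T * D0 <= d^-1 * E.
  have h := ler_wpM2l (ltW T0) hD.
  have nR : 0 <= T * (s ^+ 2 * Rx2) by ge0.
  have := le_ratio dT nR; have := mulr_ge0 (ltW dV) CX0; rewrite EE; lra.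
have sn : s <= s ^+ 2 by rewrite expr2 ler_peMr // ltW.
have t2 : T * (s * T * (v + 1) ^+ 2) <= (M + 1) ^+ 2 * d^-1 * E.
  have hv : (v + 1) ^+ 2 <= (M + 1) ^+ 2 by rewrite ler_pXn2r ?nnegrE //; move: v0 vM; tidy; lra.
  have h1 : T ^+ 2 * s * (v + 1) ^+ 2 <= T ^+ 2 * s ^+ 2 * (M + 1) ^+ 2.
    have ts := ler_wpM2l (sqr_ge0 T) sn.
    exact (ler_pM (mulr_ge0 (sqr_ge0 T) (ltW s0)) (sqr_ge0 (v + 1)) ts hv).
  have q0 : 0 <= T ^+ 2 * s ^+ 2 * (M + 1) ^+ 2 by ge0.
  have h2 := le_ratio dC q0.
  have h3 : d^-1 * (C * (T ^+ 2 * s ^+ 2 * (M + 1) ^+ 2)) <=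
     d^-1 * (C * (T ^+ 2 * s ^+ 2 * (M + 1) ^+ 2)) * X.
    by rewrite ler_peMr // mulr_ge0 ?(ltW dV) // mulr_ge0 // ltW.
  have := mulr_ge0 (mulr_ge0 (sqr_ge0 (M + 1)) (ltW dV)) RX0; rewrite EE; lra.
have yX' := ler_wpM2l (ltW n0) yX.
have t3 : T * (s ^+ 2 * C * y ^+ 2) <= d^-1 * E.
  have h := ler_wpM2l (mulr_ge0 (ltW T0) (ltW C0)) yX'.
  have q0 : 0 <= T * C * (s ^+ 2 * X) by ge0.
  have := le_ratio dT q0; have := mulr_ge0 (ltW dV) RX0; rewrite EE; lra.
have t4 : T * (s ^+ 2 * g * y ^+ 2) <= d^-1 * d^-1 * d^-1 * E.
  have -> : T * (s ^+ 2 * g * y ^+ 2) = s * y ^+ 2 by rewrite gE; field; rewrite !gt_eqF.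
  have h1 : s * y ^+ 2 <= s ^+ 2 * X by apply: ler_pM; rewrite ?sqr_ge0 // ltW.
  have q0 : 0 <= s ^+ 2 * X by ge0.
  have h2 := le_ratio dC q0.
  have q1 : 0 <= C * (s ^+ 2 * X) by ge0.
  have h3 := ler_wpM2l (ltW dV) (le_ratio2 dT dT q1).
  have d3 : 0 <= d^-1 * d^-1 * d^-1 by ge0.
  have := mulr_ge0 d3 RX0; rewrite EE; lra.
set Om := D0 + _ + _.
have Om0 : 0 <= Om.
  have g0 : 0 < g by rewrite gE invr_gt0 mulr_gt0.
  have q1 := mulr_ge0 (ltW (mulr_gt0 s0 T0)) (sqr_ge0 (v + 1)).
  have q2 := mulr_ge0 (mulr_ge0 (ltW n0) (ltW (addr_gt0 C0 g0))) (sqr_ge0 y).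
  by rewrite /Om gVE; exact (addr_ge0 (addr_ge0 D00 q1) q2).
have h := ler_wpM2r Om0 PT.
have h2 : T * Om <= (d^-1 + (M + 1) ^+ 2 * d^-1 + d^-1 + d^-1 * d^-1 * d^-1) * E.
  by rewrite /Om gVE; lra.
have := ler_wpM2l p0 h2; rewrite /c_affine -/E; lra.
Qed.

End RealEstimates.

Section Constants.
Variable R : realType.

Lemma powR_three_halves (x : R) : 0 < x -> x `^ (3 / 2) = x * Num.sqrt x.
Proof.
move=> x0; have -> : 3 / 2 = 1 + 2^-1 :> R by lra.
by rewrite powRD ?(gt_eqF x0) ?implybT // powRr1 ?(ltW x0) // powR12_sqrt // ltW.
Qed.

Lemma powR_nine_halves (x : R) : 0 < x -> x `^ (9 / 2) = x ^+ 4 * Num.sqrt x.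
Proof.
move=> x0; have -> : 9 / 2 = 4%:R + 2^-1 :> R by lra.
by rewrite powRD ?(gt_eqF x0) ?implybT // powR_mulrn ?(ltW x0) // powR12_sqrt // ltW.
Qed.

Variable I : instance R.
Hypothesis I_ok : admissible I.
Local Notation N := (nodes I).

Lemma wnorm_le_Rx (d : 'I_N -> R) (xs : primal I) : (forall i, 0 <= d i) ->
  wnorm d (fun i => xs i - start I i) <= Rx (start I) xs * Num.sqrt N%:R ->
  \sum_i d i * enorm (xs i - start I i) ^+ 2 <= N%:R * Rx (start I) xs ^+ 2.
Proof.
move=> d0 h.
have S0 : 0 <= \sum_i d i * enorm (xs i - start I i) ^+ 2.
  by apply: sumr_ge0 => i _; rewrite mulr_ge0 ?sqr_ge0.
have wE : wnorm d (fun i => xs i - start I i) ^+ 2 =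
    \sum_i d i * enorm (xs i - start I i) ^+ 2.
  rewrite /wnorm -[RHS](sqr_sqrtr S0); congr (Num.sqrt _ ^+ 2).
  by apply: eq_bigr => i _; rewrite dotpE -enorm_sqr.
have w0 : 0 <= wnorm d (fun i => xs i - start I i) by exact: sqrtr_ge0.
have [NE _] : N%:R = Num.sqrt (N%:R : R) ^+ 2 /\ True by rewrite sqr_sqrtr ?ler0n.
rewrite -wE [X in X * _]NE -exprMn mulrC ler_pXn2r ?nnegrE //; first exact: le_trans h.
Qed.

Let s := Num.sqrt (N%:R : R).

Lemma sqrt_nodes_ge1 : 1 <= s.
Proof. by rewrite -sqrtr1 ler_wsqrtr // ler1n (nodes_gt0 I_ok). Qed.

Lemma sqrt_nodes_sqr : s ^+ 2 = N%:R.
Proof. by rewrite sqr_sqrtr ?ler0n. Qed.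

Lemma first_wnorm_le (xs : primal I) :
  \sum_i (1 + Lf I i + Cg I i) * enorm (xs i - start I i) ^+ 2 <=
  s ^+ 2 * Rx (start I) xs ^+ 2.
Proof.
have [P_ok _ _ _ _] := I_ok.
rewrite sqrt_nodes_sqr; apply: wnorm_le_Rx => [i|].
  by rewrite !addr_ge0 // ?Lf_ge0 ?Cg_ge0.
rewrite /Rx -mulrA mulVf ?mulr1; first by rewrite le_max lexx orbT.
by rewrite gt_eqF // (lt_le_trans ltr01 sqrt_nodes_ge1).
Qed.

Lemma curvature_le (xs : primal I) : curvature xs <= s ^+ 2 * Rx (start I) xs ^+ 2.
Proof.
have [P_ok _ _ _ _] := I_ok.
rewrite sqrt_nodes_sqr; apply: wnorm_le_Rx => [i|]; first exact: Lg_ge0.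
rewrite /Rx -mulrA mulVf ?mulr1; first by rewrite le_max lexx.
by rewrite gt_eqF // (lt_le_trans ltr01 sqrt_nodes_ge1).
Qed.

Lemma C0_le_weight (d : R) : 0 < d -> d <= C0 I -> d <= weight I.
Proof.
move=> d0 dC; have [_ _ _ _ [[_ _ NG _ _] _]] := I_ok.
by rewrite /weight (le_trans dC) // ler_peMl // (le_trans (ltW d0)).
Qed.

(** If [Lg] were positive, [tau] at [beta] equal to 1 and 2 over [Lg] would have its maximum at the
    second argument, and equality would give [Lf + 1 = Lf + 2]. *)
Lemma affine_case_Lg (i : 'I_N) : affine_case I -> Lg I i = 0.
Proof.
move=> [_ tauE]; have [P_ok _ _ _ _] := I_ok.
have L0 := Lg_ge0 P_ok i; have C0 := Cg_ge0 P_ok i; have F0 := Lf_ge0 P_ok i.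
have [->//|Ln] := eqVneq (Lg I i) 0.
have Lp : 0 < Lg I i by rewrite lt_def Ln.
have e (t : R) : t * (Lg I i)^-1 * Lg I i = t by rewrite mulfVK.
have V0 : 0 < (Lg I i)^-1 by rewrite invr_gt0.
have := tauE i _ _ (mulr_gt0 ltr01 V0) (mulr_gt0 (ltr0n R 2) V0).
rewrite /tau !e => /invr_inj.
rewrite !(max_idPr _) ?ler_wpDl //; lra.
Qed.

Lemma omega_affine (xs : primal I) beta gamma r : affine_case I ->
  omega xs beta gamma r = omega xs 0 gamma r.
Proof.
move=> aff; rewrite omega_curvature /curvature big1 ?mulr0 ?addr0 // => i _.
by rewrite (affine_case_Lg _ aff) mul0r.
Qed.

Lemma omega0E (xs : primal I) gamma r :
  omega xs 0 gamma r =
  \sum_i (1 + Lf I i + Cg I i) * enorm (xs i - start I i) ^+ 2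
  + gamma^-1 * (enorm (vstar xs) + 1) ^+ 2 + s ^+ 2 * (Cg_mean I + gamma) * r ^+ 2.
Proof.
rewrite /omega sqrt_nodes_sqr; congr (_ + _ + _).
by apply: eq_bigr => i _; rewrite mul0r addr0.
Qed.

End Constants.

Section Estimates.
Variables (R : realType) (I : instance R).
Hypothesis I_ok : admissible I.
Local Notation n := ((nodes I)%:R : R).
Local Notation s := (Num.sqrt ((nodes I)%:R : R)).

Let s1 : 1 <= s. Proof. exact: sqrt_nodes_ge1. Qed.
Let n0 : 0 < n. Proof. by rewrite ltr0n (nodes_gt0 I_ok). Qed.

(** The constants must be positive for every [M], including negative ones that no instance
    satisfies. *)
Lemma widen_constant (c L E : R) : 0 <= E -> L <= c * E -> L <= (`|c| + 1) * E.
Proof.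
by move=> E0 /le_trans; apply; apply: ler_wpM2r => //; rewrite ler_wpDr // ler_norm.
Qed.

Lemma powR_three_halves_weight :
  n `^ (3 / 2) * Gam I * C0 I = s * weight I.
Proof. by rewrite powR_three_halves // /weight; move: s => s'; ring. Qed.

Lemma known_bound_estimate (d M b : R) xs ys : 0 < d ->
  bnd I = b%:E -> enorm ys <= 2 * b -> d <= b -> d <= C0 I -> consensus_multiplier xs <= M ->
  Lam xs ys (n `^ (3 / 2) * Gam I * C0 I * b)^-1 (2 * b) <=
  (`|c_known d M| + 1) * (n * b * (Rx (start I) xs ^+ 2 + Cg_mean I * b)
    + n `^ (3 / 2) * Gam I * C0 I * b).
Proof.
move=> d0 bE yb db dC; rewrite (consensus_multiplierE I_ok) => vM.
have dT := C0_le_weight I_ok d0 dC.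
have b0 : 0 < b := lt_le_trans d0 db.
have T0 : 0 < weight I := lt_le_trans d0 dT.
rewrite powR_three_halves_weight.
have C0 := Cg_mean_ge0 I_ok.
apply: widen_constant.
  have h1 := mulr_ge0 (mulr_ge0 (ltW n0) (ltW b0))
    (addr_ge0 (sqr_ge0 (Rx (start I) xs)) (mulr_ge0 C0 (ltW b0))).
  exact (addr_ge0 h1 (mulr_ge0 (mulr_ge0 (sqrtr_ge0 _) (ltW T0)) (ltW b0))).
rewrite /Lam bE omega_curvature omega0E.
have := estimate_known s1 d0 dT (erefl (s * weight I * b)^-1) db (sqr_ge0 (Rx (start I) xs)) C0
  (enorm_ge0 _) vM (first_wnorm_le I_ok xs) (curvature_le I_ok xs) (enorm_ge0 ys) yb.
rewrite !sqrt_nodes_sqr; apply: le_trans; rewrite le_eqVlt; apply/orP; left; apply/eqP.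
move: (\sum_i _) (Cg_mean I) (curvature xs) (enorm _) (enorm _) (weight I) (_^-1) => *; ring.
Qed.

Lemma unknown_bound_estimate (d M gamma : R) xs ys : 0 < d -> bnd I = +oo%E ->
  d <= C0 I -> d <= Rx (start I) xs -> consensus_multiplier xs <= M -> Cg_mean I <= M ->
  gamma = n `^ (3 / 2) * Gam I * C0 I * Rx (start I) xs ^+ 2 ->
  Lam xs ys gamma (betabar xs ys gamma) <=
  (`|c_unknown d M (expR 17)| + 1) * (n `^ (9 / 2) * Gam I ^+ 3 * C0 I ^+ 3
    * Rx (start I) xs ^+ 2 * Num.max 1 (enorm ys ^+ 2)).
Proof.
move=> d0 bE dC dR; rewrite (consensus_multiplierE I_ok) => vM CM.
rewrite powR_three_halves_weight => gE.
have dT := C0_le_weight I_ok d0 dC.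
have T0 : 0 < weight I := lt_le_trans d0 dT.
have R0 : 0 < Rx (start I) xs := lt_le_trans d0 dR.
have X1 : 1 <= Num.max 1 (enorm ys ^+ 2) by rewrite le_max lexx.
have yX : enorm ys ^+ 2 <= Num.max 1 (enorm ys ^+ 2) by rewrite le_max lexx orbT.
have g0 : 0 < gamma.
  by rewrite gE; exact (mulr_gt0 (mulr_gt0 (lt_le_trans ltr01 s1) T0) (exprn_gt0 2 R0)).
have -> : n `^ (9 / 2) * Gam I ^+ 3 * C0 I ^+ 3 = s ^+ 2 * s * weight I ^+ 3.
  by rewrite powR_nine_halves // /weight sqrt_nodes_sqr; move: s => s'; ring.
have e1 : 1 <= expR 17 :> R by rewrite -[leLHS]expR0 ler_expR.
apply: widen_constant.
  have h := mulr_ge0 (mulr_ge0 (sqr_ge0 s) (sqrtr_ge0 n)) (exprn_ge0 3 (ltW T0)).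
  exact (mulr_ge0 (mulr_ge0 h (sqr_ge0 (Rx (start I) xs))) (le_trans ler01 X1)).
rewrite /Lam bE omega_curvature /betabar.
have Om0 := omega_ge0 I_ok g0 (lexx 0) xs (enorm ys).
rewrite omega0E in Om0 *.
exact (estimate_unknown s1 d0 dT e1 (erefl _) gE dR (Cg_mean_ge0 I_ok) CM
  (enorm_ge0 _) vM (first_wnorm_le I_ok xs) (curvature_ge0 xs I_ok) (curvature_le I_ok xs)
  (enorm_ge0 ys) X1 yX Om0).
Qed.

Lemma affine_estimate (d M : R) xs ys beta : 0 < d -> bnd I = +oo%E -> affine_case I ->
  d <= C0 I -> d <= Cg_mean I -> consensus_multiplier xs <= M ->
  Lam xs ys (n `^ (3 / 2) * Gam I * C0 I)^-1 beta <=
  (`|c_affine d M (expR 17)| + 1) * (n ^+ 3 * Gam I ^+ 2 * C0 I ^+ 2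
    * (Rx (start I) xs ^+ 2 + Cg_mean I * Num.max 1 (enorm ys ^+ 2))).
Proof.
move=> d0 bE aff dC dCg; rewrite (consensus_multiplierE I_ok) => vM.
have dT := C0_le_weight I_ok d0 dC.
have X1 : 1 <= Num.max 1 (enorm ys ^+ 2) by rewrite le_max lexx.
have yX : enorm ys ^+ 2 <= Num.max 1 (enorm ys ^+ 2) by rewrite le_max lexx orbT.
rewrite powR_three_halves_weight.
have -> : n ^+ 3 * Gam I ^+ 2 * C0 I ^+ 2 = s ^+ 2 * weight I ^+ 2.
  by rewrite /weight sqrt_nodes_sqr; ring.
have e1 : 1 <= expR 17 :> R by rewrite -[leLHS]expR0 ler_expR.
apply: widen_constant.
  have h := mulr_ge0 (Cg_mean_ge0 I_ok) (le_trans ler01 X1).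
  exact (mulr_ge0 (mulr_ge0 (sqr_ge0 s) (sqr_ge0 (weight I)))
    (addr_ge0 (sqr_ge0 (Rx (start I) xs)) h)).
have D0 : 0 <= \sum_i (1 + Lf I i + Cg I i) * enorm (xs i - start I i) ^+ 2.
  have [P_ok _ _ _ _] := I_ok.
  by apply: sumr_ge0 => i _; rewrite mulr_ge0 ?sqr_ge0 // !addr_ge0 // ?Lf_ge0 ?Cg_ge0.
rewrite /Lam bE omega_affine // omega0E.
exact (estimate_affine s1 d0 dT e1 (erefl _) (erefl _) (sqr_ge0 (Rx (start I) xs)) dCg
  (enorm_ge0 _) vM (first_wnorm_le I_ok xs) X1 yX D0).
Qed.

End Estimates.

(* X = O(E) is read with one constant c for all instances (all N, m, n_i, cones,
   functions, networks, operators) in which the quantities named in the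
   hypotheses "delta <= _" stay away from 0 and those named in "_ <= M" stay
   bounded; every other quantity is unrestricted. *)
Theorem theorem3p1 (R : realType) :
  exists (Lam : forall I : instance R,
            primal I -> 'rV[R]_(cdim I) -> R -> R -> R)
         (betabar : forall I : instance R,
            primal I -> 'rV[R]_(cdim I) -> R -> R),
  [/\ (* CASE 1: a dual bound b is known and beta = 2b *)
      (forall (I : instance R) (b gamma : R),
         admissible I -> bnd I = b%:E -> 0 < gamma ->
         guarantees (Lam I) gamma (2 * b)),
      (forall delta M : R, 0 < delta -> exists2 c : R, 0 < c &
         forall (I : instance R) (b : R) xs ys,
           admissible I -> bnd I = b%:E ->
           optimal_pair xs ys -> enorm ys <= 2 * b ->
           delta <= b -> delta <= C0 I -> consensus_multiplier xs <= M ->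
           let n := (nodes I)%:R : R in
           let gamma := (n `^ (3 / 2) * Gam I * C0 I * b)^-1 in
           Lam I xs ys gamma (2 * b) <=
           c * (n * b * (Rx (start I) xs ^+ 2 + Cg_mean I * b)
                + n `^ (3 / 2) * Gam I * C0 I * b)),
      (* CASE 2: no dual bound *)
      (forall (I : instance R) (gamma : R) xs ys,
         admissible I -> bnd I = +oo%E -> enough_rounds I -> 0 < gamma ->
         optimal_pair xs ys ->
         0 < betabar I xs ys gamma /\
         forall beta, betabar I xs ys gamma <= beta ->
           guarantees (Lam I) gamma beta),
      (forall delta M : R, 0 < delta -> exists2 c : R, 0 < c &
         forall (I : instance R) xs ys,
           admissible I -> bnd I = +oo%E -> enough_rounds I ->
           optimal_pair xs ys ->
           delta <= C0 I -> delta <= Rx (start I) xs ->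
           consensus_multiplier xs <= M -> Cg_mean I <= M ->
           let n := (nodes I)%:R : R in
           let gamma := n `^ (3 / 2) * Gam I * C0 I * Rx (start I) xs ^+ 2 in
           Lam I xs ys gamma (betabar I xs ys gamma) <=
           c * (n `^ (9 / 2) * Gam I ^+ 3 * C0 I ^+ 3 * Rx (start I) xs ^+ 2
                * Num.max 1 (enorm ys ^+ 2))) &
      (* CASE 2 with affine g_i and step-sizes tau_i independent of beta *)
      (forall delta M : R, 0 < delta -> exists2 c : R, 0 < c &
         forall (I : instance R) xs ys,
           admissible I -> bnd I = +oo%E -> enough_rounds I ->
           affine_case I -> optimal_pair xs ys ->
           delta <= C0 I -> delta <= Cg_mean I ->
           consensus_multiplier xs <= M ->
           let n := (nodes I)%:R : R in
           let gamma := (n `^ (3 / 2) * Gam I * C0 I)^-1 in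
           forall beta, betabar I xs ys gamma <= beta ->
           Lam I xs ys gamma beta <=
           c * (n ^+ 3 * Gam I ^+ 2 * C0 I ^+ 2
                * (Rx (start I) xs ^+ 2
                   + Cg_mean I * Num.max 1 (enorm ys ^+ 2))))].
Proof.
have c_gt0 (c : R) : 0 < `|c| + 1 by rewrite ltr_wpDl.
exists (@Lam R), (@betabar R); split.
- exact: known_bound_guarantees.
- move=> d M d0; exists (`|c_known d M| + 1) => // I b xs ys I_ok bE _ yb db dC vM.
  exact: (known_bound_estimate I_ok d0 bE yb db dC vM).
- move=> I gamma xs ys I_ok bE er g0 xsP; split; first exact: betabar_gt0.
  by move=> beta hb; exact: (unknown_bound_guarantees I_ok bE er g0 xsP hb).
- move=> d M d0; exists (`|c_unknown d M (expR 17)| + 1) => // I xs ys I_ok bE _ _ dC dR vM CM.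
  exact (@unknown_bound_estimate _ I I_ok d M _ xs ys d0 bE dC dR vM CM (erefl _)).
- move=> d M d0; exists (`|c_affine d M (expR 17)| + 1) => // I xs ys I_ok bE _ aff _ dC dCg vM.
  move=> n gamma beta _; exact: (affine_estimate I_ok ys beta d0 bE aff dC dCg vM).
Qed.
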